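(* The kernel of the $v$-adic arithmetic gamma distribution $\hat\Gamma_{\mathrm{ari},v}:\mathcal{U}^{\mathrm{ari}}\to\mathbb{C}_v^\times/\bar k^\times$ is the $\mathbb{Q}$-span of the classes of the elements \[ \sum_{i=0}^{r-1}[q^{i\deg v}z],\qquad z\in\tfrac1n\mathbb{Z}, \] where $n$ runs through all positive integers with $p\nmid n$ and $r$ is the order of $q^{\deg v}\bmod n$ in $(\mathbb{Z}/n\mathbb{Z})^\times$.
   Context: $q$ is a power of a prime $p$, $A=\mathbb{F}_q[\theta]$, $k=\mathbb{F}_q(\theta)$, $v\in A$ monic irreducible, $k_v$ the completion at $v$, $\mathbb{C}_v$ the completion of an algebraic closure of $k_v$, $\bar k$ the algebraic closure of $k$ in $\mathbb{C}_v$. For $i\ge0$, $D_{i,v}$ is the product of all monic polynomials of degree $i$ in $A$ not divisible by $v$; for $z=\sum z_iq^i\in\mathbb{Z}_p$ ($0\le z_i<q$), $\Gamma_{\mathrm{ari},v}(z+1)=\prod_{i\ge0}(-D_{i,v})^{z_i}\in k_v^\times$. Let $\mathbb{Z}_{(p)}=\mathbb{Z}_p\cap\mathbb{Q}$. For $z\in\mathbb{Q}$ let $\langle z\rangle$ be its fractional part ($0\le\langle z\rangle<1$, $z-\langle z\rangle\in\mathbb{Z}$). Let $\mathcal A^{\mathrm{ari}}_{\mathbb{Q}}$ be the $\mathbb{Q}$-vector space with basis the symbols $[z]$, $z\in\mathbb{Z}_{(p)}/\mathbb{Z}$. For $\ell\ge1$, let $\mathcal R^{\mathrm{ari}}_\ell$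 be the subspace spanned by $[z]-\sum_{i=0}^{\ell-1}z_i[\frac{q^i}{1-q^\ell}]$ for all $z\in\frac1{q^\ell-1}\mathbb{Z}/\mathbb{Z}$, where $0\le z_i<q$ are the integers with $\sum_{i=0}^{\ell-1}\frac{z_iq^i}{q^\ell-1}=\langle-z\rangle$; let $\mathcal R^{\mathrm{ari}}=\bigcup_\ell\mathcal R^{\mathrm{ari}}_\ell$ and $\mathcal U^{\mathrm{ari}}=\mathcal A^{\mathrm{ari}}_{\mathbb{Q}}/\mathcal R^{\mathrm{ari}}$. The group $\mathbb{C}_v^\times/\bar k^\times$ is a $\mathbb{Q}$-vector space (written multiplicatively). Put $\tilde\Gamma_{\mathrm{ari},v}(z\bmod\mathbb{Z})=\Gamma_{\mathrm{ari},v}(1-\langle-z\rangle)$; the $\mathbb{Q}$-linear map $[z]\mapsto\tilde\Gamma_{\mathrm{ari},v}(z)\bmod\bar k^\times$ vanishes on $\mathcal R^{\mathrm{ari}}$ and induces $\hat\Gamma_{\mathrm{ari},v}:\mathcal U^{\mathrm{ari}}\to\mathbb{C}_v^\times/\bar k^\times$. *)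

(* Defs.v *)
From HB Require Import structures.
From mathcomp Require Import all_boot all_order all_algebra all_field.
From mathcomp Require Import all_classical all_reals.
From mathcomp Require Import topology.
From mathcomp Require Import generic_quotient ring_quotient qpoly fraction.
From mathcomp.multinomials Require Import freeg.

Set Implicit Arguments.
Unset Strict Implicit.
Unset Printing Implicit Defensive.

Import Order.TTheory GRing.Theory Num.Theory.


Local Open Scope classical_set_scope.
Local Open Scope ring_scope.
Local Open Scope quotient_scope.

Section LinearSpan.
Variables (K : nzRingType) (V : lmodType K) (S : set V).

Definition lspan : set V :=
  [set x | exists2 s : seq (K * V), (forall y, y \in s -> S y.2) &
                                    x = \sum_(y <- s) y.1 *: y.2].

Definition in_lspan : {pred V} := fun x => `[< lspan x >].

Lemma lspanD x y : lspan x -> lspan y -> lspan (x + y).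
Proof.
move=> [s sS ->] [t tS ->]; exists (s ++ t); last by rewrite big_cat.
by move=> z; rewrite mem_cat => /orP[/sS|/tS].
Qed.

Lemma lspanZ a x : lspan x -> lspan (a *: x).
Proof.
move=> [s sS ->]; exists [seq (a * y.1, y.2) | y <- s].
  by move=> z /mapP[y /sS yS ->].
by rewrite big_map scaler_sumr; apply: eq_bigr => y _; rewrite scalerA.
Qed.

Lemma in_lspan_zmod_closed : zmod_closed in_lspan.
Proof.
split; first by apply/asboolP; exists [::] => //; rewrite big_nil.
move=> x y /asboolP xS /asboolP yS; apply/asboolP.
by apply: lspanD => //; rewrite -scaleN1r; exact: lspanZ.
Qed.

HB.instance Definition _ := GRing.isZmodClosed.Build V in_lspan
  in_lspan_zmod_closed.

(* The quotient of V by the submodule generated by S. *)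
Definition lquot : Type := Quotient.quot in_lspan.

HB.instance Definition _ := GRing.Zmodule.on lquot.
HB.instance Definition _ := Quotient.on lquot.
HB.instance Definition _ : EqQuotient V (Quotient.equiv in_lspan) lquot :=
  EqQuotient.on lquot.
HB.instance Definition _ := ZmodQuotient.on lquot.

Definition lquot_scale (a : K) : lquot -> lquot :=
  lift_op1 lquot (fun x : V => a *: x).

Lemma pi_lquot_scale a (x : V) : lquot_scale a (\pi_lquot x) = \pi_lquot (a *: x).
Proof.
unlock lquot_scale; apply/eqP; rewrite -Quotient.idealrBE -scalerBr.
apply/asboolP/lspanZ/asboolP.
by rewrite -[X in is_true X]/(_ - _ \in in_lspan) Quotient.idealrBE reprK.
Qed.

Fact lquot_scaleA a b x :
  lquot_scale a (lquot_scale b x) = lquot_scale (a * b) x.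
Proof. by rewrite -[x]reprK !pi_lquot_scale scalerA. Qed.

Fact lquot_scale1 : left_id 1 lquot_scale.
Proof. by move=> x; rewrite -[x]reprK pi_lquot_scale scale1r. Qed.

Fact lquot_scaleDr : right_distributive lquot_scale +%R.
Proof.
move=> a x y; rewrite -[x]reprK -[y]reprK -raddfD !pi_lquot_scale.
by rewrite scalerDr raddfD.
Qed.

Fact lquot_scaleDl x : {morph lquot_scale^~ x : a b / a + b}.
Proof.
by move=> a b; rewrite -[x]reprK !pi_lquot_scale scalerDl raddfD.
Qed.

HB.instance Definition _ := GRing.Zmodule_isLmodule.Build K lquot
  lquot_scaleA lquot_scale1 lquot_scaleDr lquot_scaleDl.

End LinearSpan.

Section DivisibleScale.
Variable V : zmodType.
Hypothesis divV : forall (n : nat) (x : V), exists y, y *+ n.+1 = x.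
Hypothesis tfV : forall (n : nat) (x : V), x *+ n.+1 = 0 -> x = 0.

Lemma divisible_scale_ex (a : rat) (x : V) :
  exists y, y *~ denq a = x *~ numq a.
Proof.
have := denq_gt0 a; case: (denq a) => // -[|n] // _.
exact: divV.
Qed.

(* The unique Q-vector space structure of a uniquely divisible group: a *: x is
   the y such that (denq a) y = (numq a) x. *)
Definition divisible_scale (a : rat) (x : V) : V :=
  sval (cid (divisible_scale_ex a x)).

Lemma divisible_scaleP a x : divisible_scale a x *~ denq a = x *~ numq a.
Proof. by rewrite /divisible_scale; case: cid. Qed.

Lemma mulrz_injl (m : int) : m != 0 -> injective (fun x : V => x *~ m).
Proof.
move=> m0 x y /= /eqP; rewrite -subr_eq0 -mulrzBl => /eqP xy.
apply/eqP; rewrite -subr_eq0; apply/eqP.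
case: m m0 xy => [[|n]|n] // _; first exact: tfV.
by rewrite NegzE mulrNz => /eqP; rewrite oppr_eq0 => /eqP; exact: tfV.
Qed.

Lemma divisible_scale_frac a (m n : int) x : n != 0 -> a * n%:~R = m%:~R ->
  divisible_scale a x *~ n = x *~ m.
Proof.
move=> n0 am; apply: (@mulrz_injl (denq a)); first exact: denq_neq0.
rewrite /= mulrzAC divisible_scaleP -!mulrzA; congr (_ *~ _).
apply: (@intr_inj rat); rewrite !intrM -am numqE.
by rewrite mulrAC.
Qed.

Lemma divisible_scaleE a (m n : int) x y : n != 0 -> a * n%:~R = m%:~R ->
  y *~ n = x *~ m -> y = divisible_scale a x.
Proof.
by move=> n0 am yx; apply: (mulrz_injl n0); rewrite /= yx (divisible_scale_frac _ n0 am).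
Qed.

Fact divisible_scaleA a b x :
  divisible_scale a (divisible_scale b x) = divisible_scale (a * b) x.
Proof.
apply: (@divisible_scaleE _ (numq a * numq b) (denq a * denq b)).
- by rewrite mulf_neq0 ?denq_neq0.
- by rewrite !intrM !numqE mulrACA.
- by rewrite mulrzA divisible_scaleP mulrzAC divisible_scaleP mulrzA mulrzAC.
Qed.

Fact divisible_scale1 : left_id 1 divisible_scale.
Proof. by move=> x; apply/esym/(@divisible_scaleE _ 1 1); rewrite ?mul1r. Qed.

Fact divisible_scaleDr : right_distributive divisible_scale +%R.
Proof.
move=> a x y; apply/esym/(@divisible_scaleE _ (numq a) (denq a)).
- exact: denq_neq0.
- by rewrite -numqE.
- by rewrite !mulrzDl !divisible_scaleP.
Qed.

Fact divisible_scaleDl x : {morph divisible_scale^~ x : a b / a + b}.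
Proof.
move=> a b; apply/esym.
apply: (@divisible_scaleE _ (numq a * denq b + numq b * denq a)
          (denq a * denq b)).
- by rewrite mulf_neq0 ?denq_neq0.
- rewrite rmorphD /= !intrM mulrDl !numqE; congr (_ + _); first by rewrite mulrA.
  by rewrite mulrCA mulrC -!mulrA.
- rewrite mulrzDl mulrzDr !mulrzA divisible_scaleP; congr (_ + _).
  by rewrite mulrzAC divisible_scaleP.
Qed.

End DivisibleScale.

(* The multiplicative group of a field, written additively. *)
Definition mulgroup (C : fieldType) : Type := {x : C | x != 0}.

Section MulGroup.
Variable C : fieldType.

HB.instance Definition _ := Choice.on (mulgroup C).
HB.instance Definition _ := SubType.on (mulgroup C).

Definition mulgroup_zero : mulgroup C := exist _ 1 (oner_neq0 C).
Definition mulgroup_opp (x : mulgroup C) : mulgroup C :=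
  exist _ (sval x)^-1 (invr_neq0 (svalP x)).
Definition mulgroup_add (x y : mulgroup C) : mulgroup C :=
  exist _ (sval x * sval y) (mulf_neq0 (svalP x) (svalP y)).

Fact mulgroup_addA : associative mulgroup_add.
Proof. by move=> x y z; apply: val_inj; rewrite /= mulrA. Qed.
Fact mulgroup_addC : commutative mulgroup_add.
Proof. by move=> x y; apply: val_inj; rewrite /= mulrC. Qed.
Fact mulgroup_add0 : left_id mulgroup_zero mulgroup_add.
Proof. by move=> x; apply: val_inj; rewrite /= mul1r. Qed.
Fact mulgroup_addN : left_inverse mulgroup_zero mulgroup_opp mulgroup_add.
Proof. by case=> x x0; apply: val_inj; rewrite /= mulVf. Qed.

HB.instance Definition _ := GRing.isZmodule.Build (mulgroup C)
  mulgroup_addA mulgroup_addC mulgroup_add0 mulgroup_addN.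

Lemma val_mulgroupMn (x : mulgroup C) n : sval (x *+ n) = sval x ^+ n.
Proof. by elim: n => // n IHn; rewrite mulrS exprS -IHn. Qed.

End MulGroup.

Section ModAlgebraic.
Variables (k : fieldType) (C : closedFieldType) (i : {rmorphism k -> C}).

Definition is_algebraic : {pred mulgroup C} :=
  fun x => `[< algebraicOver i (sval x) >].

Lemma is_algebraic_zmod_closed : zmod_closed is_algebraic.
Proof.
split; first exact/asboolP/algebraic1.
move=> x y /asboolP ax /asboolP ay; apply/asboolP.
exact: algebraic_div.
Qed.

HB.instance Definition _ := GRing.isZmodClosed.Build (mulgroup C) is_algebraic
  is_algebraic_zmod_closed.

(* C^* / kbar^*, written additively, where kbar is the algebraic closure of k
   in C. *)
Definition mod_algebraic : Type := Quotient.quot is_algebraic.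

HB.instance Definition _ := GRing.Zmodule.on mod_algebraic.
HB.instance Definition _ := Quotient.on mod_algebraic.
HB.instance Definition _ :
  EqQuotient (mulgroup C) (Quotient.equiv is_algebraic) mod_algebraic :=
  EqQuotient.on mod_algebraic.
HB.instance Definition _ := ZmodQuotient.on mod_algebraic.

Lemma mod_algebraic_div n (x : mod_algebraic) : exists y, y *+ n.+1 = x.
Proof.
rewrite -[x]reprK; case: (repr x) => {}x x0.
have [y] := @solve_monicpoly C n.+1 (fun j => if j is 0%N then x else 0) isT.
rewrite big_ord_recl /= mulr1 big1 ?addr0 => [|j _]; last by rewrite mul0r.
move=> yx; have y0 : y != 0.
  by apply: contraNneq x0 => y0; rewrite -yx y0 expr0n.
exists (\pi_mod_algebraic (exist _ y y0 : mulgroup C)).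
rewrite -raddfMn; congr (\pi _); apply: val_inj.
by rewrite [LHS]val_mulgroupMn /= yx.
Qed.

Lemma mod_algebraic_tf n (x : mod_algebraic) : x *+ n.+1 = 0 -> x = 0.
Proof.
rewrite -[x]reprK; move: (repr x) => {}x.
have pi0 (y : mulgroup C) : (\pi_mod_algebraic y = 0) <-> algebraicOver i (sval y).
  have -> : 0 = \pi_mod_algebraic 0 by rewrite raddf0.
  split=> [/eqP|ay].
    by rewrite -Quotient.idealrBE subr0 => /asboolP.
  by apply/eqP; rewrite -Quotient.idealrBE subr0; exact/asboolP.
rewrite -raddfMn pi0 => -[r r0 rx]; apply/pi0.
rewrite val_mulgroupMn in rx.
exists (r \Po 'X^(n.+1)).
  rewrite -size_poly_eq0 -lt0n; apply: leq_trans (_ : 0 < size r)%N _.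
    by rewrite size_poly_gt0.
  have -> : size (r \Po 'X^(n.+1)) = ((size r).-1 * n.+1).+1.
    rewrite -[LHS]prednK ?size_comp_poly ?size_polyXn//.
    by rewrite size_poly_gt0 comp_poly_eq0 // size_polyXn.
  by rewrite -[X in (X <= _)%N]prednK ?size_poly_gt0// ltnS leq_pmulr.
by rewrite map_comp_poly map_polyXn /root horner_comp hornerXn.
Qed.

HB.instance Definition _ := GRing.Zmodule_isLmodule.Build rat mod_algebraic
  (divisible_scaleA mod_algebraic_div mod_algebraic_tf) (divisible_scale1 mod_algebraic_div mod_algebraic_tf)
  (divisible_scaleDr mod_algebraic_div mod_algebraic_tf) (divisible_scaleDl mod_algebraic_div mod_algebraic_tf).

End ModAlgebraic.

Record absolute_value (R : realType) (K : fieldType) := AbsoluteValue {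
  absv :> K -> R;
  absv_ge0 : forall x, 0 <= absv x;
  absv0 : absv 0 = 0;
  absv_eq0 : forall x, absv x = 0 -> x = 0;
  absvM : forall x y, absv (x * y) = absv x * absv y;
  absvD : forall x y, absv (x + y) <= absv x + absv y
}.

(* K as a metric space for the distance |x - y|. *)
Definition metric_of (R : realType) (K : fieldType) (N : absolute_value R K) :
  Type := K.

Section MetricOf.
Variables (R : realType) (K : fieldType) (N : absolute_value R K).

HB.instance Definition _ := GRing.Field.on (metric_of N).
HB.instance Definition _ := isPointed.Build (metric_of N) 0.

Let dist (x y : metric_of N) : R := N (x - y).

Let absvN x : N (- x) = N x.
Proof.
suff N1 : N (- 1) = 1 by rewrite -mulN1r absvM N1 mul1r.
have N11 : N 1 = 1.
  apply: (@mulfI _ (N 1)); last by rewrite -absvM !mulr1.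
  by apply/eqP => /absv_eq0/eqP; rewrite oner_eq0.
apply/eqP; rewrite -(@eqrXn2 _ 2) ?absv_ge0 ?ler01//.
by rewrite expr1n expr2 -absvM mulrNN mulr1 N11.
Qed.

Let distxx x : dist x x = 0.
Proof. by rewrite /dist subrr absv0. Qed.

Let dist_positivity x y : dist x y = 0 -> x = y.
Proof. by move=> /absv_eq0/eqP; rewrite subr_eq0 => /eqP. Qed.

Let dist_sym x y : dist x y = dist y x.
Proof. by rewrite /dist -opprB absvN. Qed.

Let dist_triangle y x z : dist x z <= dist x y + dist y z.
Proof. by rewrite /dist -(subrKA y) absvD. Qed.

HB.instance Definition _ := isMetric.Build R (metric_of N)
  distxx dist_positivity dist_sym dist_triangle.

End MetricOf.

Definition is_complete (R : realType) (K : fieldType) (N : absolute_value R K) :=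
  forall G : set_system (metric_of N), ProperFilter G -> cauchy G -> cvg G.

Definition is_completion (R : realType) (K L : fieldType) (NK : K -> R)
    (NL : absolute_value R L) (f : {rmorphism K -> L}) :=
  [/\ forall x, NL (f x) = NK x,
      dense (range f : set (metric_of NL)) &
      is_complete NL].

Section VadicValuation.
Variables (F : finFieldType) (v : {poly F}).
Local Notation q := #|F|.

Definition pdeg (a : {poly F}) : nat := (size a).-1.

(* For a != 0, the exponent of v in a; the bound size a is harmless because
   v is not constant. *)
Definition vord (a : {poly F}) : nat :=
  (\max_(e < size a | (v ^+ e %| a)%R) e)%N.

Definition vadic_abs (R : realType) (x : {fraction {poly F}}) : R :=
  if x == 0 then 0
  else (q%:R ^+ pdeg v) ^ ((vord \d_(repr x))%:Z - (vord \n_(repr x))%:Z).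

Definition Dv (i : nat) : {poly F} :=
  \prod_(a : {poly_i.+1 F} |
         [&& (a : {poly F}) \is monic, pdeg a == i & ~~ (v %| (a : {poly F}))])
    (a : {poly F}).

End VadicValuation.

(* d is the sequence of q-adic digits of z, seen in Z_p: for all n,
   z = \sum_(i < n) d i * q ^ i modulo q ^ n, the remainder being p-integral
   (q is a power of p). *)
Definition qadic_expansion (q : nat) (z : rat) (d : nat -> nat) : Prop :=
  (forall i, (d i < q)%N) /\
  forall n, exists2 w : rat, coprime q `|denq w|%N &
    z = (\sum_(i < n) d i * q ^ i)%N%:R + q%:R ^+ n * w.

(* The digits exist and are unique when z is p-integral. *)
Definition qadic_digits (q : nat) (z : rat) : nat -> nat :=
  xget (fun=> 0%N) [set d | qadic_expansion q z d].

Section Gamma.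
Variables (R : realType) (F : finFieldType) (v : {poly F}).
Variables (kv : fieldType) (N : absolute_value R kv).
Variable (iota : {rmorphism {fraction {poly F}} -> kv}).

(* Gamma_{ari,v} (z + 1), where the p-adic integer z is given by its sequence of
   q-adic digits. *)
Definition ari_gamma_succ (z : nat -> nat) : kv :=
  lim ((fun n => \prod_(i < n) (- iota (FracField.tofrac (Dv v i))) ^+ z i
         : metric_of N) @ \oo).

(* Gamma_{ari,v} at a p-integral rational number. *)
Definition ari_gamma (x : rat) : kv :=
  ari_gamma_succ (qadic_digits #|F| (x - 1)).

End Gamma.

Definition fracpart (z : rat) : rat := z - (Num.floor z)%:~R.

(* Z_(p) / Z, each class being represented by its fractional part. *)
Definition ZpmodZ (p : nat) : Type :=
  {z : rat | (0 <= z < 1) && ~~ (p %| `|denq z|)%N}.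

HB.instance Definition _ (p : nat) := Choice.on (ZpmodZ p).
HB.instance Definition _ (p : nat) := SubType.on (ZpmodZ p).

Section AriDistribution.
Variables (p q : nat).

Definition AQ : Type := {freeg (ZpmodZ p) / rat}.

HB.instance Definition _ := GRing.Lmodule.on AQ.

(* The basis symbol [z mod Z] for z in Z_(p) (and 0 for the other rational
   numbers, where it is never used). *)
Definition symb (z : rat) : AQ :=
  if insub (fracpart z) is Some c then << c >> else 0.

Definition Rari_gen (l : nat) : set AQ :=
  [set x | exists z : rat, exists d : nat -> nat,
     [/\ z * (q ^ l - 1)%N%:R \is a Num.int,
         forall i, (d i < q)%N,
         \sum_(i < l) (d i * q ^ i)%N%:R / (q ^ l - 1)%N%:R = fracpart (- z) &
         x = symb z - \sum_(i < l) (d i)%:R *: symb (q%:R ^+ i / (1 - q%:R ^+ l))]].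

Definition Rari_level (l : nat) : set AQ := lspan (Rari_gen l).

Definition Rari : set AQ := \bigcup_(l in [set l | (0 < l)%N]) Rari_level l.

(* Rari is a subspace (the Rari_level l are directed by divisibility of l), so
   that this is the quotient by Rari itself. *)
Definition Uari : Type := lquot Rari.

HB.instance Definition _ := GRing.Lmodule.on Uari.
HB.instance Definition _ := Quotient.on Uari.

Definition is_mult_order (a n r : nat) : Prop :=
  [/\ (0 < r)%N, (a ^ r = 1 %[mod n])%N &
      forall s, (0 < s)%N -> (a ^ s = 1 %[mod n])%N -> (r <= s)%N].

(* The classes of \sum_(i < r) [q ^ (i d) z] for z in (1/n)Z, p not dividing n
   and r the order of q ^ d modulo n. *)
Definition orbit_sums (d : nat) : set Uari :=
  [set u | exists n r : nat, exists z : rat,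
     [/\ (0 < n)%N, ~~ (p %| n)%N, is_mult_order (q ^ d) n r,
         z * n%:R \is a Num.int &
         u = \pi_Uari (\sum_(i < r) symb (q%:R ^+ (i * d) * z))]].

End AriDistribution.

Arguments orbit_sums : clear implicits.

Section GammaDistribution.
Variables (R : realType) (p : nat) (F : finFieldType) (v : {poly F}).
Variables (kv : fieldType) (N : absolute_value R kv).
Variable (iota : {rmorphism {fraction {poly F}} -> kv}).
Variables (C : closedFieldType) (j : {rmorphism kv -> C}).

Definition ari_gamma_tilde (z : ZpmodZ p) : kv :=
  ari_gamma v N iota (1 - fracpart (- val z)).

(* The class of x in C^* / kbar^*; the values of Gamma_{ari,v} are nonzero, and
   0 is sent to the neutral element. *)
Definition mod_algebraic_class (x : C) : mod_algebraic (j \o iota) :=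
  \pi_(mod_algebraic (j \o iota)) (insubd (0 : mulgroup C) x).

Definition ari_gamma_lin : AQ p -> mod_algebraic (j \o iota) :=
  fglift (fun z => mod_algebraic_class (j (ari_gamma_tilde z))).

(* The map induced by ari_gamma_lin, which vanishes on Rari. *)
Definition ari_gamma_hat : Uari p #|F| -> mod_algebraic (j \o iota) :=
  lift_fun1 (Uari p #|F|) ari_gamma_lin.

End GammaDistribution.

(* Main.v *)
(* Write [n] = theta^(q^n) - theta, let d = deg v, and for a sequence c of natural
   numbers let G(c) be the infinite product of the u_n^(c n), where u_n = -D_{n,v}, so
   that the gamma values are the G(c) for the periodic sequences c of digits.

   The relation between D_{n,v}, v and the Carlitz products D_n = [n] D_{n-1}^q shows
   that [n-d] u_n = [n] u_{n-1}^q for n > d. If c is d-periodic, this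
   telescopes to G(c) = x G(c(. + 1))^q with x algebraic, because theta^(q^(dM))
   converges to a Teichmuller representative; after d steps, G(c) = y G(c)^(q^d) with y
   algebraic. Hence G(c) is algebraic, and the orbit sums are in the kernel.

   Conversely let c be l-periodic, with d dividing l, and G(c) algebraic. Then the
   logarithmic derivative of G(c) is algebraic. Up to an element of k it is the limit of
   the sums of -(c n - c (n + d)) / [n]. As an algebraic element satisfies an Ore
   equation, its images under the iterates of the Cartier operator eventually repeat with
   some period P; on the other hand the Cartier operators rotate the powers theta^(q^u)
   in theta^(q^u) / [n], u modulo n. Expanding at a root of v, this shows that, for s
   large, the sum over the divisors n of s of (c n - c (n + d)) Res_n is P-periodic in s,
   where Res_n depends only on n modulo d and is nonzero. Primes congruent to 1 modulo
   l P then force c n = c (n + d) modulo p. Dividing the digits by p and iterating,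
   c is d-periodic, and linear algebra gives the kernel. *)

From HB Require Import structures.
From mathcomp Require Import all_boot all_order all_algebra all_solvable all_field.
From mathcomp Require Import all_classical all_reals topology.
From mathcomp Require Import fraction ring zify.
From mathcomp.multinomials Require Import freeg.
Require Import Defs.

Set Implicit Arguments.
Unset Strict Implicit.
Unset Printing Implicit Defensive.

Import Order.TTheory GRing.Theory Num.Theory.

Local Open Scope ring_scope.
Local Notation "a %:F" := (FracField.tofrac a).

(** * Frobenius powers and Carlitz polynomials *)

(** The Cartier operator fixes each 1/[n], so iterating it on the logarithmic derivative itself
    gives no information about the individual indices. Multiplied by theta, the n-th term acquires
    an orbit of length n, and reading one well-chosen coefficient after s steps selects the n
    dividing s + d + 1: this is where the divisor sums come from. The operator is defined on k,
    whereas the gamma value lies in k_v. Periodicity is therefore proved for approximations in k,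
    with control of their orders at v; as the operator divides orders by q, the precision required
    grows with the number of steps. The logarithmic derivative kills p-th powers, so one pass only
    sees the sequence modulo p, which is the reason for the iteration. Sequences of arbitrary
    natural numbers replace digits below q because they are closed under addition: after clearing
    denominators, a rational relation between the basic symbols becomes the algebraicity of a single
    product. *)

Section Frobenius.
Variables (F : finFieldType) (p : nat).
Hypothesis pcharF : p \in [pchar F].
Local Notation q := #|F|.

Lemma card_finField_pnat : p.-nat q.
Proof.
have := fin_ring_pchar_abelem pcharF; move=> /abelem_pgroup.
by rewrite /pgroup cardsT.
Qed.

Lemma card_finField_gt1 : (1 < q)%N.
Proof. exact: finNzRing_gt1. Qed.

Lemma card_finField_gt0 : (0 < q)%N.
Proof. exact: ltnW card_finField_gt1. Qed.

Lemma pchar_dvd_card : (p %| q)%N.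
Proof.
have pp := pcharf_prime pcharF.
case/p_natP: card_finField_pnat card_finField_gt1 => // -[|n] ->//.
by rewrite expnS dvdn_mulr.
Qed.

Section Ring.
Variables (R : comNzRingType).
Hypothesis pcharR : p \in [pchar R].

Lemma expq_pnat n : [pchar R].-nat (q ^ n)%N.
Proof.
by rewrite (eq_pnat _ (pcharf_eq pcharR)) pnatX card_finField_pnat.
Qed.

Lemma exprqD n (x y : R) : (x + y) ^+ (q ^ n) = x ^+ (q ^ n) + y ^+ (q ^ n).
Proof. exact/exprDn_pchar/expq_pnat. Qed.

Lemma exprqN n (x : R) : (- x) ^+ (q ^ n) = - x ^+ (q ^ n).
Proof.
apply/eqP; rewrite -subr_eq0 opprK -exprqD addNr expr0n.
by rewrite expn_eq0 -leqn0 leqNgt card_finField_gt0.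
Qed.

Lemma exprqB n (x y : R) : (x - y) ^+ (q ^ n) = x ^+ (q ^ n) - y ^+ (q ^ n).
Proof. by rewrite exprqD exprqN. Qed.

Lemma exprq_sum n (I : Type) (r : seq I) (P : pred I) (G : I -> R) :
  (\sum_(i <- r | P i) G i) ^+ (q ^ n) = \sum_(i <- r | P i) G i ^+ (q ^ n).
Proof.
apply: (big_morph (fun x => x ^+ (q ^ n)) (exprqD n)).
by rewrite expr0n expn_eq0 -leqn0 leqNgt card_finField_gt0.
Qed.
End Ring.

Lemma exprD_q (R : comNzRingType) (pcharR : p \in [pchar R]) (x y : R) :
  (x + y) ^+ q = x ^+ q + y ^+ q.
Proof. by have := exprqD pcharR 1 x y; rewrite expn1. Qed.

Lemma exprB_q (R : comNzRingType) (pcharR : p \in [pchar R]) (x y : R) :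
  (x - y) ^+ q = x ^+ q - y ^+ q.
Proof. by have := exprqB pcharR 1 x y; rewrite expn1. Qed.

Lemma expf_cardn n (x : F) : x ^+ (q ^ n) = x.
Proof. by elim: n => [|n IH]; rewrite ?expr1// expnSr exprM IH expf_card. Qed.

Lemma pchar_polyF : p \in [pchar {poly F}].
Proof. by rewrite pchar_poly. Qed.

Lemma deriv_natq_eq0 n : (0 < n)%N -> (q ^ n)%:R = 0 :> {poly F}.
Proof.
case: n => // n _; apply/eqP; rewrite -(dvdn_pcharf pchar_polyF).
by rewrite expnS dvdn_mulr// pchar_dvd_card.
Qed.

Lemma deriv_expq n (a : {poly F}) : (0 < n)%N -> (a ^+ (q ^ n))^`() = 0.
Proof. by move=> n0; rewrite deriv_exp -mulr_natr deriv_natq_eq0 ?mulr0. Qed.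

End Frobenius.

(** * Carlitz's linear polynomials and products of monic polynomials *)

Section Carlitz.
Variables (F : finFieldType) (p : nat).
Hypothesis pcharF : p \in [pchar F].
Local Notation q := #|F|.
Local Notation A := {poly F}.
Let pA := pchar_polyF pcharF.
Let q_gt1 := card_finField_gt1 F.
Let q_gt0 := card_finField_gt0 F.

Definition bracket n : A := 'X^(q ^ n) - 'X.

Fixpoint carlitzD n : A :=
  if n is m.+1 then bracket n * carlitzD m ^+ q else 1.

(** Carlitz's F-linear polynomial, whose roots are the polynomials of degree less than [n]
    ([prod_sub_npoly]). The recursion gives its linearity and its behaviour under theta without the
    product. *)
Fixpoint carlitzE n (x : A) : A :=
  if n is m.+1 then carlitzE m x ^+ q - carlitzD m ^+ q.-1 * carlitzE m x
  else x.

Lemma carlitzED n x y : carlitzE n (x + y) = carlitzE n x + carlitzE n y.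
Proof.
by elim: n x y => //= n IH x y; rewrite IH (exprD_q pcharF pA); ring.
Qed.

Lemma carlitzEZ n c x : carlitzE n (c%:P * x) = c%:P * carlitzE n x.
Proof.
elim: n => //= n ->.
by rewrite exprMn -polyC_exp expf_card mulrBr; congr (_ - _); rewrite mulrCA.
Qed.

Lemma bracketS n : bracket n.+1 = bracket n ^+ q + bracket 1.
Proof.
rewrite /bracket expn1 (exprB_q pcharF pA) -exprM -expnSr.
by rewrite addrA subrK.
Qed.

(** Needed to evaluate [carlitzE n] at ['X^n] by induction. The extra terms cancel through [n+2] =
    [n+1]^q + [1] and the recursion of [carlitzD]. *)
Lemma carlitzEX n x :
  carlitzE n.+1 ('X * x) =
  'X * carlitzE n.+1 x + bracket n.+1 * carlitzE n x ^+ q.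
Proof.
elim: n x => [|n IH] x.
  by rewrite /= /bracket expn1 expr1n !mul1r exprMn; ring.
rewrite [LHS]/= -/(carlitzE n.+1 _) IH (exprD_q pcharF pA) (exprMn _ 'X) (exprMn _ (bracket _)).
rewrite [carlitzE n.+2 x]/= -/(carlitzE n.+1 _) [bracket n.+2]bracketS.
set D := carlitzD n.+1; set e := carlitzE n.+1 x; set e1 := carlitzE n x.
set B := bracket n.+1; set B1 := bracket 1.
have eE : e = e1 ^+ q - carlitzD n ^+ q.-1 * e1 by [].
have DE : D ^+ q.-1 * B = B ^+ q * (carlitzD n ^+ q.-1) ^+ q.
  have -> : B ^+ q = B ^+ q.-1 * B by rewrite -exprSr prednK.
  by rewrite /D /= -/B exprMn exprAC; ring.
have -> : 'X * ((e ^+ q) - D ^+ q.-1 * e) + (B ^+ q + B1) * e ^+ q =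
   'X ^+ q * e ^+ q + B ^+ q * e ^+ q - 'X * (D ^+ q.-1 * e).
  by rewrite /B1 /bracket expn1; ring.
have -> : B ^+ q * e ^+ q = B ^+ q * e1 ^+ q ^+ q - D ^+ q.-1 * B * e1 ^+ q.
  have -> : e ^+ q = e1 ^+ q ^+ q - (carlitzD n ^+ q.-1) ^+ q * e1 ^+ q.
    by rewrite eE [LHS](exprB_q pcharF pA) exprMn.
  by rewrite DE; ring.
ring.
Qed.

Lemma carlitzE_Xn n : carlitzE n 'X^n = carlitzD n.
Proof.
elim: n => // n IH; rewrite exprS carlitzEX IH /= IH.
(* The first term vanishes: [carlitzE n.+1 'X^n] is D_n^q - D_n^(q-1) D_n. *)
by rewrite -exprSr prednK// subrr mulr0 add0r.
Qed.

Lemma big_npolyS (R : Type) (idx : R) (op : Monoid.com_law idx) n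
    (G : A -> R) :
  \big[op/idx]_(a : {poly_n.+1 F}) G a =
  \big[op/idx]_(c : F) \big[op/idx]_(b : {poly_n F}) G (c *: 'X^n + val b).
Proof.
rewrite pair_big /=.
pose h (x : F * {poly_n F}) : {poly_n.+1 F} := npolyp n.+1 (x.1 *: 'X^n + val x.2).
pose h' (a : {poly_n.+1 F}) : F * {poly_n F} := ((a : A)`_n, npolyp n (a : A)).
have hE x : val (h x) = x.1 *: 'X^n + val x.2.
  rewrite /= npolypK// (leq_trans (size_polyD _ _))// geq_max.
  rewrite (leq_trans (size_scale_leq _ _)) ?size_polyXn//=.
  by rewrite (leq_trans (size_npoly _)).
have h'K : cancel h' h.
  move=> a; apply/val_inj; rewrite hE; apply/polyP => i /=.
  rewrite coefD coefZ coefXn coef_npolyp.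
  case: (ltngtP i n) => [in_|in_|->]; rewrite ?mulr0 ?add0r ?mulr1 ?addr0//.
  by rewrite big_coef_npoly.
have hK : cancel h h'.
  move=> [c b]; rewrite /h'; congr pair.
    rewrite (congr1 (fun a : A => a`_n) (hE (c, b))) /=.
    by rewrite coefD coefZ coefXn eqxx mulr1 big_coef_npoly ?addr0.
  apply/val_inj/polyP => i; rewrite /= coef_npolyp (congr1 (fun a : A => a`_i) (hE (c, b))) /=.
  rewrite coefD coefZ coefXn.
  case: ltngtP => in_; rewrite ?mulr0 ?add0r//.
    by rewrite big_coef_npoly// ltnW.
  by rewrite in_ big_coef_npoly.
rewrite (reindex h) /=; last by exists h' => x _.
by apply: eq_bigr => x _; congr (G _); exact: hE.
Qed.

(** Homogeneous form of the factorisation of X^q - X over F: for nonzero [y], it is that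
    factorisation at x / y in the fraction field. *)
Lemma prod_subF (x y : A) : \prod_(c : F) (x - c *: y) = x ^+ q - y ^+ q.-1 * x.
Proof.
have [->|y0] := eqVneq y 0.
  have -> : 0 ^+ q.-1 = 0 :> A by rewrite expr0n -subn1 subn_eq0 leqNgt q_gt1.
  under eq_bigr do rewrite scaler0 subr0.
  by rewrite mul0r subr0 prodr_const.
pose phi := (@FracField.tofrac A \o polyC : {rmorphism F -> {fraction A}}).
have y0' : FracField.tofrac y != 0 by rewrite tofrac_eq0.
have [z xE] : exists z, FracField.tofrac x = z * FracField.tofrac y.
  by exists (FracField.tofrac x / FracField.tofrac y); rewrite divfK.
have zE : \prod_c (z - phi c) = z ^+ q - z.
  have := congr1 (fun P => (map_poly phi P).[z]) (finField_genPoly F).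
  rewrite rmorphB rmorph_prod /= map_polyXn map_polyX hornerD hornerN hornerXn.
  rewrite hornerX horner_prod => ->; apply: eq_bigr => c _.
  by rewrite rmorphB /= map_polyX map_polyC hornerD hornerN hornerX hornerC.
apply/eqP; rewrite -tofrac_eq; apply/eqP.
rewrite rmorph_prod rmorphB rmorphM !rmorphXn /=.
under eq_bigr do rewrite -mul_polyC rmorphB rmorphM /= xE -mulrBl.
rewrite big_split /= zE prodr_const xE exprMn mulrBl; congr (_ - _).
by rewrite mulrCA -exprSr prednK.
Qed.

Lemma prod_sub_npoly n (x : A) :
  \prod_(a : {poly_n F}) (x - val a) = carlitzE n x.
Proof.
elim: n x => [|n IH] x.
  have npoly0 (a : {poly_0 F}) : val a = 0.
    by apply/eqP; rewrite -size_poly_leq0; exact: size_npoly.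
  rewrite /= (eq_bigr (fun=> x)) => [|a _]; last by rewrite npoly0 subr0.
  by rewrite prodr_const card_npoly expn0 expr1.
rewrite (big_npolyS _ n (fun a => x - a)) /=.
rewrite -carlitzE_Xn -prod_subF; apply: eq_bigr => c _.
under eq_bigr do rewrite opprD addrA.
rewrite IH -mulN1r -mul_polyC carlitzED.
by rewrite -[- 1]/(- 1%:P) -polyCN mulrA -polyCM carlitzEZ polyCM polyCN mulN1r mulNr mul_polyC.
Qed.

Lemma big_monic_npoly (R : Type) (idx : R) (op : Monoid.com_law idx) n
    (G : A -> R) :
  \big[op/idx]_(a : {poly_n.+1 F} | (val a \is monic) && (pdeg (val a) == n))
     G (val a) =
  \big[op/idx]_(b : {poly_n F}) G ('X^n + val b).
Proof.
rewrite big_mkcond /=.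
rewrite (big_npolyS _ n
  (fun a => if (a \is monic) && (pdeg a == n) then G a else idx)) /=.
rewrite (bigD1 1) //= [X in op _ X]big1 ?Monoid.mulm1 => [|c c1]; last first.
  rewrite big1 // => b _; case: ifP => // /andP[/monicP mon /eqP].
  rewrite /pdeg /lead_coef in mon * => dn; move: mon c1; rewrite dn coefD coefZ.
  by rewrite coefXn eqxx mulr1 big_coef_npoly// addr0 => ->; rewrite eqxx.
apply: eq_bigr => b _; rewrite scale1r ifT//.
have sX : (size (val b) < size ('X^n : A))%N.
  by rewrite size_polyXn ltnS (size_npoly b).
by rewrite monicE lead_coefDl// lead_coefXn eqxx /pdeg size_polyDl// size_polyXn /= eqxx.
Qed.

(** Up to the sign of the lower part, the factors are the X^n - a with deg a < n, so the product is
    [carlitzE n 'X^n]. *)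
Lemma prod_monic_npoly n :
  \prod_(a : {poly_n.+1 F} | (val a \is monic) && (pdeg (val a) == n)) val a =
  carlitzD n.
Proof.
rewrite (big_monic_npoly _ n id) -carlitzE_Xn -prod_sub_npoly.
by rewrite (reindex_inj (@oppr_inj {poly_n F})).
Qed.

Lemma card_monic_npoly n :
  #|[pred a : {poly_n.+1 F} | (val a \is monic) && (pdeg (val a) == n)]| =
  (q ^ n)%N.
Proof. by rewrite -sum1_card (big_monic_npoly _ n (fun=> 1%N)) sum1_card card_npoly. Qed.

Lemma carlitzD_neq0 n : carlitzD n != 0.
Proof.
rewrite -prod_monic_npoly; apply/prodf_neq0 => a /andP[/monic_neq0 //].
Qed.

Lemma bracket_neq0 n : (0 < n)%N -> bracket n != 0.
Proof.
move=> n0; rewrite subr_eq0; apply/eqP => /(congr1 (fun a : A => size a)).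
have q1 : (1 < q ^ n)%N by rewrite -(expn0 q) ltn_exp2l.
by rewrite size_polyXn size_polyX => -[E]; rewrite E in q1.
Qed.

Lemma deriv_bracket n : (0 < n)%N -> (bracket n)^`() = - 1.
Proof.
by move=> n0; rewrite derivB derivX (deriv_expq pcharF) // sub0r.
Qed.

Lemma deriv_carlitzD n : (carlitzD n.+1)^`() * bracket n.+1 = - carlitzD n.+1.
Proof.
rewrite /= derivM deriv_bracket// -{2}(expn1 q) (deriv_expq pcharF)// mulr0 addr0.
ring.
Qed.

End Carlitz.

(** * The factors of the gamma product *)

Lemma finField_wilson (K : finFieldType) : \prod_(x : K | x != 0) x = - 1.
Proof.
have : 'X * ('X^(#|K|.-1) - 1) = 'X * \prod_(x : K | x != 0) ('X - x%:P).
  have := finField_genPoly K; rewrite (bigD1 0) //= polyC0 subr0 => <-.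
  by rewrite mulrBr mulr1 -exprS prednK// card_finField_gt0.
move=> /(mulfI (negbT (polyX_eq0 K))) /(congr1 (fun P => P.[0])).
rewrite hornerD hornerXn hornerN hornerC expr0n horner_prod.
have -> : (#|K|.-1 == 0)%N = false.
  by rewrite -subn1 subn_eq0 leqNgt card_finField_gt1.
(* Replacing x by -x absorbs the sign (-1)^(#|K| - 1) without a distinction of parity. *)
rewrite sub0r => ->; rewrite (reindex_inj oppr_inj) /=.
by apply: eq_big => x; rewrite ?oppr_eq0// hornerXsubC sub0r.
Qed.

Lemma size_monic_pdeg (F : finFieldType) (a : {poly F}) :
  a \is monic -> size a = (pdeg a).+1.
Proof. by move=> a_monic; rewrite /pdeg prednK// size_poly_gt0 monic_neq0. Qed.

Section VadicPart.
Variables (F : finFieldType) (p : nat).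
Hypothesis pcharF : p \in [pchar F].
Variable v : {poly F}.
Hypotheses (v_monic : v \is monic) (v_irr : irreducible_poly v).
Local Notation q := #|F|.
Local Notation A := {poly F}.
Local Notation d := (pdeg v).
Let pA := pchar_polyF pcharF.
Let q_gt1 := card_finField_gt1 F.
Let q_gt0 := card_finField_gt0 F.
Let vI : monic_irreducible_poly v := (v_irr, v_monic).
Local Notation kappa := {poly %/ v with vI}.

Lemma pdeg_irr_gt0 : (0 < d)%N.
Proof. by case: v_irr; rewrite /pdeg; case: (size v) => [|[]]. Qed.

Let size_v : size v = d.+1 := size_monic_pdeg v_monic.

Lemma in_qpoly_eq0 (a : A) : (in_qpoly v a == 0) = (v %| a).
Proof.
rewrite -val_eqE /= (mk_monicE vI) /dvdp.
by rewrite -Pdiv.IdomainMonic.modpE.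
Qed.

Lemma dvdp_bracket_deg : v %| bracket F d.
Proof.
rewrite -in_qpoly_eq0 rmorphB rmorphXn /= subr_eq0.
have <- : #|kappa| = (q ^ d)%N by rewrite card_qfpoly.
by apply/eqP; exact: (@expf_card kappa).
Qed.

Lemma irr_coprimep (a : A) : coprimep v a = ~~ (v %| a).
Proof. exact: irreducible_poly_coprime. Qed.

Lemma coprimep_Dv n : coprimep v (Dv v n).
Proof.
rewrite /Dv; elim/big_rec: _ => [|a x /and3P[_ _ va] vx].
  exact: coprimep1.
by rewrite coprimepMr irr_coprimep va.
Qed.

Lemma Dv_small n : (n < d)%N -> Dv v n = carlitzD F n.
Proof.
move=> nd; rewrite -(prod_monic_npoly pcharF) /Dv; apply: eq_bigl => a.
rewrite andbA; apply: andb_idr => /andP[a_monic /eqP an]; apply/negP => va.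
have := dvdp_leq (monic_neq0 a_monic) va; rewrite size_v.
by rewrite (size_monic_pdeg a_monic) an ltnS leqNgt nd.
Qed.

(** The monic multiples of v of degree d + m are the products of v with the q^m monic polynomials of
    degree m. *)
Lemma prod_monic_dvd m :
  \prod_(a : {poly_(d + m).+1 F} |
     ((val a \is monic) && (pdeg (val a) == d + m)%N) && (v %| val a)) val a =
  v ^+ (q ^ m) * carlitzD F m.
Proof.
pose h (b : {poly_m.+1 F}) : {poly_(d + m).+1 F} := npolyp _ (v * val b).
pose h' (a : {poly_(d + m).+1 F}) : {poly_m.+1 F} := npolyp _ (val a %/ v).
have v0 : v != 0 by exact: monic_neq0.
have hE b : val (h b) = v * val b.
  rewrite /= npolypK//; have [->|b0] := eqVneq (val b) 0.
    by rewrite mulr0 size_poly0.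
  rewrite size_mul// size_v addSn /= -addnS leq_add2l.
  exact: (size_npoly b).
have h'E a : val (h' a) = val a %/ v.
  rewrite /= npolypK// size_divp// size_v /= leq_subLR addnS.
  exact: (size_npoly a).
rewrite (reindex_onto h h') => [|a /andP[_ va]]; last first.
  by apply/val_inj; rewrite hE h'E mulrC divpK.
have monicE b : ((val (h b) \is monic) && (pdeg (val (h b)) == d + m)%N &&
    (v %| val (h b))) && (h' (h b) == b) =
    (val b \is monic) && (pdeg (val b) == m).
  have -> : h' (h b) == b.
    by apply/eqP/val_inj; rewrite h'E hE mulrC mulpK.
  rewrite hE dvdp_mulr// !andbT monicMl//.
  case: (boolP (val b \is monic)) => //= b_monic.
  rewrite /pdeg size_Mmonic ?monic_neq0// size_v addSn /=.
  rewrite -(prednK (n := size (val b))) ?size_poly_gt0 ?monic_neq0//.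
  by rewrite addnS /= eqn_add2l.
rewrite (eq_bigl _ _ monicE) (eq_bigr (fun b => v * val b)) => [|b _]; last first.
  exact: hE.
rewrite big_split /= (prod_monic_npoly pcharF); congr (_ * _).
by rewrite prodr_const card_monic_npoly.
Qed.

Lemma carlitzD_Dv m :
  carlitzD F (d + m) = Dv v (d + m) * (v ^+ (q ^ m) * carlitzD F m).
Proof.
rewrite -prod_monic_dvd -(prod_monic_npoly pcharF (d + m)).
rewrite (bigID (fun a => v %| val a)) /= mulrC; congr (_ * _).
by rewrite /Dv; apply: eq_bigl => a; rewrite andbA.
Qed.

(* The factor -D_{n,v} of the gamma product. *)
Definition ugam n : A := - Dv v n.

Lemma coprimep_ugam n : coprimep v (ugam n).
Proof. by rewrite /ugam -scaleN1r coprimepZr ?coprimep_Dv// oppr_eq0 oner_eq0. Qed.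

Lemma ugam_neq0 n : ugam n != 0.
Proof.
apply: contraTneq (coprimep_ugam n) => ->.
by rewrite coprimep0 -size_poly_eq1 size_v eqSS -lt0n pdeg_irr_gt0.
Qed.

Lemma v_neq0 : v != 0. Proof. exact: monic_neq0. Qed.

(** Compare [carlitzD_Dv] at m + 1 with its q-th power at m, through D_(d+m+1) = [d+m+1] D_(d+m)^q:
    the powers of v and of D_m cancel. No division by [m+1] is made, as v may divide it. *)
Lemma bracket_ugam m :
  bracket F m.+1 * ugam (d + m.+1) = bracket F (d + m.+1) * ugam (d + m) ^+ q.
Proof.
have E0 := carlitzD_Dv m; have E1 := carlitzD_Dv m.+1.
have nz : (v ^+ (q ^ m) * carlitzD F m) ^+ q != 0.
  by rewrite expf_neq0// mulf_neq0 ?expf_neq0 ?v_neq0 ?(carlitzD_neq0 pcharF).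
apply: (mulIf nz); rewrite /ugam.
have -> : (- Dv v (d + m)) ^+ q = - Dv v (d + m) ^+ q.
  by have := exprqN pcharF pA 1 (Dv v (d + m)); rewrite expn1.
have -> : bracket F m.+1 * - Dv v (d + m.+1) * (v ^+ (q ^ m) * carlitzD F m) ^+ q
   = - (Dv v (d + m.+1) * (v ^+ (q ^ m.+1) * carlitzD F m.+1)).
  by rewrite exprMn -exprM -expnSr /=; ring.
by rewrite -E1 addnS /= E0 exprMn; ring.
Qed.

(** The size [n] is a variable so that it can be substituted in the type [{poly_n F}], which then
    becomes the carrier of the residue field, where Wilson's theorem applies. *)
Lemma prod_in_qpoly n : n = (size (mk_monic v)).-1 ->
  \prod_(b : {poly_n F} | val b != 0) in_qpoly v (val b) = - 1.
Proof.
move=> ->; rewrite -(finField_wilson kappa) /=.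
apply: eq_big => // b _.
by apply/val_inj; rewrite [LHS]in_qpoly_small// size_mk_monic.
Qed.

(** A monic polynomial of degree d is v + b with deg b < d, and v divides it only for b = 0. The
    other b run through the nonzero residues, so D_(d,v) is -1 modulo v by Wilson's theorem. *)
Lemma ugam_wilson : v %| ugam d - 1.
Proof.
rewrite -dvdpNr opprB /ugam opprK -in_qpoly_eq0 rmorphD rmorph1.
have -> : Dv v d = \prod_(a : {poly_d.+1 F} |
    (val a \is monic) && (pdeg (val a) == d))
      (if ~~ (v %| val a) then val a else 1).
  by rewrite -big_mkcondr /Dv; apply: eq_bigl => a; rewrite andbA.
rewrite (big_monic_npoly _ d (fun a => if ~~ (v %| a) then a else 1)).
pose r : {poly_d F} := npolyp d (v - 'X^d).
have rE : val r = v - 'X^d.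
  rewrite /= npolypK//; apply/leq_sizeP => j dj; rewrite coefB coefXn.
  move: dj; rewrite leq_eqVlt => /orP[/eqP <-|dj].
    by move/monicP: v_monic; rewrite /lead_coef eqxx => ->; rewrite subrr.
  by rewrite nth_default ?size_v// gtn_eqF// subrr.
rewrite (reindex_inj (addIr r)) /= rmorph_prod /=.
rewrite (eq_bigr (fun b : {poly_d F} =>
  if val b != 0 then in_qpoly v (val b) else 1)) => [|b _]; last first.
  have -> : 'X^d + val (b + r) = v + val b.
    have -> : val (b + r) = val b + val r by [].
    by rewrite rE; ring.
  have -> : v %| v + val b = (val b == 0).
    rewrite dvdp_addr//; apply/idP/eqP => [|->]; last exact: dvdp0.
    apply: contraTeq => b0; apply/negP => /(dvdp_leq b0).
    by rewrite size_v leqNgt ltnS (size_npoly b).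
  case: eqP => _ /=; first exact: rmorph1.
  rewrite rmorphD /=; have /eqP -> : in_qpoly v v == 0 by rewrite in_qpoly_eq0.
  exact: add0r.
by rewrite -big_mkcond prod_in_qpoly ?(mk_monicE vI)// subrr.
Qed.

(** [m] has derivative -1, hence is squarefree: dividing by it costs at most one factor v. *)
Lemma bracket_cancel m k (y : A) : (0 < m)%N ->
  v ^+ k.+1 %| bracket F m * y -> v ^+ k %| y.
Proof.
move=> m0; have [vm|vm] := boolP (v %| bracket F m); last first.
  rewrite Gauss_dvdpr ?coprimep_pexpl ?irr_coprimep//.
  by apply: dvdp_trans; rewrite dvdp_exp2l.
move: vm => /dvdpP[w wE]; rewrite wE mulrAC exprSr dvdp_mul2r ?v_neq0//.
rewrite Gauss_dvdpr// coprimep_expl// irr_coprimep.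
apply/negP => /dvdpP[w' w'E].
have : v %| (bracket F m)^`().
  rewrite wE w'E derivM; apply: dvdp_add; first exact: dvdp_mull.
  exact/dvdp_mulr/dvdp_mull.
rewrite (deriv_bracket pcharF)// dvdpNr dvdp1 size_v eqSS.
by rewrite -leqn0 leqNgt pdeg_irr_gt0.
Qed.

Lemma bracketD m n : bracket F (m + n) = bracket F m ^+ (q ^ n) + bracket F n.
Proof.
rewrite /bracket (exprqB pcharF pA) -exprM -expnD.
by rewrite addrA subrK.
Qed.

Lemma dvd_bracket_shift m : v ^+ (q ^ m) %| bracket F (d + m) - bracket F m.
Proof. by rewrite bracketD addrK dvdp_exp2r// dvdp_bracket_deg. Qed.

(** Source of the convergence of the gamma products. The induction writes [m+1] (u_(d+m+1) - 1) as
    [d+m+1] (u_(d+m) - 1)^q plus [d]^(q^(m+1)). When v divides [m+1], the factor lost in the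
    division is regained from [d+m+1]. Wilson's theorem starts the induction, whence [maxn 1 m]. *)
Lemma ugam_eq1 m : v ^+ maxn 1 m %| ugam (d + m) - 1.
Proof.
elim: m => [|m IH]; first by rewrite addn0 expr1 ugam_wilson.
have m1E : maxn 1 m.+1 = m.+1 by rewrite maxnC; apply/maxn_idPl.
have E : bracket F m.+1 * (ugam (d + m.+1) - 1) =
    bracket F (d + m.+1) * (ugam (d + m) - 1) ^+ q +
    (bracket F (d + m.+1) - bracket F m.+1).
  rewrite mulrBr bracket_ugam (exprB_q pcharF pA) expr1n.
  ring.
have d1 : v ^+ m.+1 %| (ugam (d + m) - 1) ^+ q.
  apply: dvdp_trans (dvdp_exp2r q IH); rewrite -exprM dvdp_exp2l//.
  by move: q_gt1; nia.
have d2 : v ^+ m.+2 %| bracket F (d + m.+1) - bracket F m.+1.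
  apply: dvdp_trans (dvd_bracket_shift _); rewrite dvdp_exp2l//.
  by rewrite ltn_expl.
rewrite m1E; have [vm|vm] := boolP (v %| bracket F m.+1).
  apply: (@bracket_cancel m.+1) => //; rewrite E dvdp_addr//.
  rewrite exprS dvdp_mul// -[bracket F _](subrK (bracket F m.+1)).
  rewrite dvdp_addr//; apply: dvdp_trans d2; rewrite exprS dvdp_mulr//.
have : v ^+ m.+1 %| bracket F m.+1 * (ugam (d + m.+1) - 1).
  rewrite E dvdp_add// ?dvdp_mull//; apply: dvdp_trans d2.
  by rewrite dvdp_exp2l.
by rewrite Gauss_dvdpr// coprimep_expl// irr_coprimep.
Qed.

End VadicPart.

(** * Orders and logarithmic derivatives *)

Local Open Scope quotient_scope.

Section Fractions.
Variable R : idomainType.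

Lemma frac_numden (x : {fraction R}) : x = (\n_(repr x))%:F / (\d_(repr x))%:F.
Proof.
rewrite -[LHS]reprK; set r := repr x; unlock FracField.tofrac.
rewrite -[X in _ * X]FracField.pi_inv -[RHS]FracField.pi_mul.
rewrite /FracField.mulf /FracField.invf !numden_Ratio ?oner_neq0 ?denom_ratioP//.
by rewrite mulr1 mul1r Ratio_numden.
Qed.

Lemma frac_ex (x : {fraction R}) : exists a b : R, b != 0 /\ x = a%:F / b%:F.
Proof.
exists (\n_(repr x)), (\d_(repr x)); split; [exact: denom_ratioP|exact: frac_numden].
Qed.

Lemma frac_lift (K : fieldType) (f : {rmorphism R -> K}) : injective f ->
  exists g : {rmorphism {fraction R} -> K}, forall a, g a%:F = f a.
Proof.
move=> f_inj; have f_neq0 a : a != 0 -> f a != 0.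
  by rewrite -(rmorph0 f) (inj_eq f_inj).
pose g (x : {fraction R}) := f \n_(repr x) / f \d_(repr x).
have gE a b : b != 0 -> g (a%:F / b%:F) = f a / f b.
  move=> b0; rewrite /g; set r := repr _.
  have /eqP := frac_numden (a%:F / b%:F); rewrite -/r.
  rewrite eqr_div ?tofrac_eq0 ?denom_ratioP// -!rmorphM tofrac_eq => /eqP E.
  by apply/eqP; rewrite eqr_div ?f_neq0 ?denom_ratioP// -!rmorphM E.
have g_zmod : zmod_morphism g.
  move=> x y; have [a [b [b0 ->]]] := frac_ex x; have [a' [b' [b'0 ->]]] := frac_ex y.
  have -> : a%:F / b%:F - a'%:F / b'%:F = (a * b' - a' * b)%:F / (b * b')%:F.
    by rewrite -[- (_ / b'%:F)]mulNr addf_div ?tofrac_eq0// mulNr rmorphB !rmorphM.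
  rewrite !gE ?mulf_neq0//.
  by rewrite -[- (_ / f b')]mulNr addf_div ?f_neq0// mulNr rmorphB !rmorphM.
have g_mon : monoid_morphism g.
  split; first by rewrite -[1 in LHS]divr1 -tofrac1 gE ?oner_eq0// rmorph1 divr1.
  move=> x y; have [a [b [b0 ->]]] := frac_ex x; have [a' [b' [b'0 ->]]] := frac_ex y.
  by rewrite mulf_div -!rmorphM /= !gE ?mulf_neq0// !rmorphM mulf_div.
pose gZ := GRing.isZmodMorphism.Build _ _ g g_zmod.
pose gM := GRing.isMonoidMorphism.Build _ _ g g_mon.
pose G : {rmorphism {fraction R} -> K} := HB.pack g gZ gM.
exists G => a; rewrite -[a%:F]divr1 -tofrac1.
by rewrite [LHS]gE ?oner_eq0// rmorph1 divr1.
Qed.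

End Fractions.

(* For coprime [b] and [pi] the order of [pi ^+ m * a / b] at [pi] is at least
   [m]. *)
Section LocalOrder.
Variables (K : fieldType) (pi : {poly K}).
Implicit Types x y : {fraction {poly K}}.

Definition ord_ge m x := exists a b : {poly K},
  [/\ coprimep pi b, b != 0 & x = (pi ^+ m * a)%:F / b%:F].

Lemma ord_ge_poly m a : pi ^+ m %| a -> ord_ge m a%:F.
Proof.
move=> /dvdpP[c ->]; exists c, 1; split; rewrite ?oner_eq0 ?coprimep1//.
by rewrite tofrac1 divr1 mulrC.
Qed.

Lemma ord_ge0_poly a : ord_ge 0 a%:F.
Proof. by apply: ord_ge_poly; rewrite expr0 dvd1p. Qed.

Lemma ord_ge_polyP m a : ord_ge m a%:F -> pi ^+ m %| a.
Proof.
move=> [c [b [pib b0 /eqP]]]; rewrite -[a%:F]divr1 -tofrac1.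
rewrite eqr_div ?tofrac_eq0 ?oner_eq0// -!rmorphM tofrac_eq mulr1 => /eqP E.
have : pi ^+ m %| a * b by rewrite E dvdp_mulr.
by rewrite Gauss_dvdpl// coprimep_expl.
Qed.

Lemma ord_ge_zero m : ord_ge m 0.
Proof. by rewrite -tofrac0; apply: ord_ge_poly; rewrite dvdp0. Qed.

Lemma ord_ge_le m n x : (n <= m)%N -> ord_ge m x -> ord_ge n x.
Proof.
move=> nm [a [b [pib b0 ->]]]; exists (pi ^+ (m - n) * a), b; split=> //.
by rewrite mulrA -exprD subnKC.
Qed.

Lemma ord_geD m x y : ord_ge m x -> ord_ge m y -> ord_ge m (x + y).
Proof.
move=> [a [b [pib b0 ->]]] [a' [b' [pib' b'0 ->]]].
exists (a * b' + a' * b), (b * b'); split.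
- by rewrite coprimepMr pib.
- by rewrite mulf_neq0.
rewrite addf_div ?tofrac_eq0// -!rmorphM -rmorphD; congr (_%:F / _).
ring.
Qed.

Lemma ord_geM m n x y : ord_ge m x -> ord_ge n y -> ord_ge (m + n) (x * y).
Proof.
move=> [a [b [pib b0 ->]]] [a' [b' [pib' b'0 ->]]].
exists (a * a'), (b * b'); split.
- by rewrite coprimepMr pib.
- by rewrite mulf_neq0.
by rewrite mulf_div -!rmorphM; congr (_%:F / _); rewrite exprD; ring.
Qed.

Lemma ord_ge_mull m x y : ord_ge 0 x -> ord_ge m y -> ord_ge m (x * y).
Proof. exact: ord_geM. Qed.

Lemma ord_ge_mulr m x y : ord_ge m x -> ord_ge 0 y -> ord_ge m (x * y).
Proof. by rewrite mulrC => xm y0; apply: ord_ge_mull. Qed.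

Lemma ord_geN m x : ord_ge m x -> ord_ge m (- x).
Proof.
rewrite -mulN1r -tofrac1 -rmorphN; apply: ord_ge_mull; exact: ord_ge0_poly.
Qed.

Lemma ord_geB m x y : ord_ge m x -> ord_ge m y -> ord_ge m (x - y).
Proof. by move=> xm ym; apply/ord_geD/ord_geN. Qed.

Lemma ord_ge_sum m (I : eqType) (r : seq I) (P : pred I) (G : I -> _) :
  (forall i, i \in r -> P i -> ord_ge m (G i)) ->
  ord_ge m (\sum_(i <- r | P i) G i).
Proof.
move=> Gm; rewrite big_seq_cond; apply: big_ind; first exact: ord_ge_zero.
  exact: ord_geD.
by move=> i /andP[]; exact: Gm.
Qed.

Lemma ord_geV b : coprimep pi b -> b != 0 -> ord_ge 0 (b%:F)^-1.
Proof. by move=> pib b0; exists 1, b; rewrite mulr1 expr0 tofrac1 mul1r. Qed.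

End LocalOrder.

Lemma div_opp_inv (K : fieldType) (x y z : K) :
  y != 0 -> z != 0 -> x * z = - y -> x / y = - z^-1.
Proof. by move=> y0 z0 xz; rewrite -(mulfK z0 x) xz mulrAC mulNr divff// mulN1r. Qed.

Section Dlog.
Variables (F : finFieldType) (p : nat).
Hypothesis pcharF : p \in [pchar F].
Local Notation q := #|F|.
Local Notation A := {poly F}.

Definition dlog (a : A) : {fraction A} := (a^`())%:F / a%:F.

Lemma dlogM a b : a != 0 -> b != 0 -> dlog (a * b) = dlog a + dlog b.
Proof.
move=> a0 b0; rewrite /dlog derivM rmorphD !rmorphM /= addf_div ?tofrac_eq0//.
by congr (_ / _); rewrite mulrC [b%:F * _]mulrC addrC mulrC addrC [_ * b^`()%:F]mulrC.
Qed.

Lemma dlog1 : dlog 1 = 0.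
Proof. by rewrite /dlog derivC rmorph0 mul0r. Qed.

Lemma dlogN a : dlog (- a) = dlog a.
Proof. by rewrite /dlog derivN !rmorphN invrN mulrNN. Qed.

Lemma dlogX a n : a != 0 -> dlog (a ^+ n) = dlog a *+ n.
Proof.
move=> a0; elim: n => [|n IH]; first by rewrite dlog1.
by rewrite exprS dlogM ?expf_neq0// IH mulrS.
Qed.

Lemma dlog_prod (I : Type) (r : seq I) (G : I -> A) : (forall i, G i != 0) ->
  dlog (\prod_(i <- r) G i) = \sum_(i <- r) dlog (G i).
Proof.
move=> G0; elim: r => [|i r IH]; first by rewrite !big_nil dlog1.
rewrite !big_cons dlogM ?IH//; apply: (big_ind (fun x => x != 0)) => // [|x y].
  exact: oner_neq0.
exact: mulf_neq0.
Qed.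

(** Logarithmic derivative of D_n = [n] D_(n-1)^q, computed from [n]' = -1. The value at 0, where
    [0] = 0, is that of D_0 = 1. *)
Definition polar n : {fraction A} := if n is 0 then 0 else - ((bracket F n)%:F)^-1.

Lemma dlog_carlitzD n : dlog (carlitzD F n) = polar n.
Proof.
case: n => [|n]; first exact: dlog1.
have D0 : (carlitzD F n.+1)%:F != 0 by rewrite tofrac_eq0 (carlitzD_neq0 pcharF).
have B0 : (bracket F n.+1)%:F != 0 by rewrite tofrac_eq0 bracket_neq0.
have E : (carlitzD F n.+1)^`()%:F * (bracket F n.+1)%:F = - (carlitzD F n.+1)%:F.
  by rewrite -rmorphM (deriv_carlitzD pcharF) rmorphN.
exact: div_opp_inv D0 B0 E.
Qed.

Variable v : A.
Hypotheses (v_monic : v \is monic) (v_irr : irreducible_poly v).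
Local Notation d := (pdeg v).

(** The factor v^(q^m) of D_(d+m) contributes q^m times the logarithmic derivative of v, which
    survives in characteristic p only for m = 0. *)
Lemma dlog_ugam n : dlog (ugam v n) =
  polar n - (if (d <= n)%N then polar (n - d) + (if n == d then dlog v else 0) else 0).
Proof.
rewrite /ugam dlogN; case: ltnP => [nd|dn].
  by rewrite (Dv_small pcharF)// dlog_carlitzD subr0.
move: dn => /subnKC; set m := (n - d)%N => <-.
have D0 : Dv v (d + m) != 0.
  by have := ugam_neq0 v_monic v_irr (d + m); rewrite oppr_eq0.
have := dlog_carlitzD (d + m); rewrite (carlitzD_Dv pcharF v_monic).
rewrite !dlogM ?mulf_neq0 ?expf_neq0 ?(carlitzD_neq0 pcharF) ?D0 ?monic_neq0//.
rewrite dlogX ?monic_neq0// dlog_carlitzD => <-.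
have -> : (d + m == d)%N = (m == 0)%N by rewrite -{2}[d]addn0 eqn_add2l.
have -> : dlog v *+ (q ^ m) = if (m == 0)%N then dlog v else 0.
  case: m {D0} => // m; rewrite -mulr_natr -(rmorph_nat (@FracField.tofrac A)).
  by rewrite (deriv_natq_eq0 pcharF)// rmorph0 mulr0.
ring.
Qed.

End Dlog.

(** * The Cartier operator *)

Lemma iter_collision (T : finType) (f : nat -> T) :
  exists s P, (0 < P)%N /\ f s = f (s + P)%N.
Proof.
pose g (i : 'I_#|T|.+1) := f i.
have /injectivePn[i [j ij gij]] : ~~ injectiveb g.
  apply/negP => /injectiveP /leq_card; rewrite card_ord.
  by rewrite ltnn.
wlog lt_ij : i j ij gij / (i < j)%N.
  move=> W; case: (ltngtP i j) => [|ji|/val_inj E]; first exact: W.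
    by apply: (W j i); rewrite // eq_sym.
  by rewrite E eqxx in ij.
by exists i, (j - i)%N; rewrite subn_gt0 subnKC ?(ltnW lt_ij).
Qed.

Section Cartier.
Variables (F : finFieldType) (p : nat).
Hypothesis pcharF : p \in [pchar F].
Local Notation q := #|F|.
Local Notation A := {poly F}.
Local Notation k := {fraction A}.
Let pA := pchar_polyF pcharF.
Let q_gt1 := card_finField_gt1 F.
Let q_gt0 := card_finField_gt0 F.

(** Cartier operator for the q-power Frobenius: it extracts the exponents congruent to -1 modulo q.
    No root of the coefficients is taken, because this Frobenius fixes F. *)
Definition cartier (a : A) : A := \poly_(i < size a) a`_(q * i + q.-1).

Lemma coef_cartier a i : (cartier a)`_i = a`_(q * i + q.-1).
Proof.
rewrite coef_poly; case: ltnP => // ai; rewrite nth_default//.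
by rewrite (leq_trans ai)// (leq_trans _ (leq_addr _ _))// leq_pmull.
Qed.

Lemma cartierD a b : cartier (a + b) = cartier a + cartier b.
Proof. by apply/polyP => i; rewrite coefD !coef_cartier coefD. Qed.

Lemma cartierZ c a : cartier (c *: a) = c *: cartier a.
Proof. by apply/polyP => i; rewrite coefZ !coef_cartier coefZ. Qed.

Lemma cartier0 : cartier 0 = 0.
Proof. by have := cartierZ 0 0; rewrite !scale0r. Qed.

Lemma cartier_sum (I : Type) (r : seq I) (P : pred I) (G : I -> A) :
  cartier (\sum_(i <- r | P i) G i) = \sum_(i <- r | P i) cartier (G i).
Proof. exact: (big_morph _ cartierD cartier0). Qed.

Lemma cartierMXq a : cartier (a * 'X^q) = cartier a * 'X.
Proof.
apply/polyP => i; rewrite coef_cartier coefMXn coefMX coef_cartier.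
case: i => [|i]; first by rewrite muln0 add0n ltn_predL q_gt0.
by rewrite mulnS -addnA ltnNge leq_addr /= addKn.
Qed.

Lemma cartierMq a b : cartier (a * b ^+ q) = cartier a * b.
Proof.
elim/poly_ind: b a => [|b c IH] a.
  by rewrite expr0n -leqn0 leqNgt q_gt0 !mulr0 cartier0.
rewrite (exprD_q pcharF pA) exprMn -polyC_exp expf_card !mulrDr.
have -> : a * (b ^+ q * 'X^q) = a * b ^+ q * 'X^q by rewrite mulrA.
by rewrite cartierD cartierMXq IH mulrA ![_ * c%:P]mulrC !mul_polyC cartierZ.
Qed.

Lemma cartierXn j : (j < q)%N -> cartier 'X^j = (j == q.-1)%:R.
Proof.
move=> jq; apply/polyP => i; rewrite coef_cartier coefXn coefMn coef1.
case: i => [|i]; first by rewrite muln0 add0n eq_sym.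
rewrite mul0rn gtn_eqF// (leq_trans jq)// mulnS -addnA leq_addr//.
Qed.

Lemma size_cartier (a : A) B : (size a <= q * B)%N -> (size (cartier a) <= B)%N.
Proof.
move=> aB; apply/leq_sizeP => i Bi; rewrite coef_cartier nth_default//.
by rewrite (leq_trans aB)// (leq_trans _ (leq_addr _ _))// leq_pmul2l.
Qed.

(** A suitable shift moves the leading exponent into the class of -1 modulo q. *)
Lemma cartier_neq0 a : a != 0 -> exists j, cartier ('X^j * a) != 0.
Proof.
move=> a0; pose n := (size a).-1; exists (q.-1 - n %% q)%N.
apply/eqP => /(congr1 (fun P : A => P`_(n %/ q))).
rewrite coef0 coef_cartier coefXnM.
have nE : (q * (n %/ q) + q.-1 - (q.-1 - n %% q) = n)%N.
  have := divn_eq n q; have := ltn_pmod n q_gt0; lia.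
rewrite nE ltnNge; have -> : (q.-1 - n %% q <= q * (n %/ q) + q.-1)%N by lia.
by move/eqP; rewrite -/(lead_coef a) lead_coef_eq0 (negbTE a0).
Qed.

(** Extension to fractions by a / b = a b^(q-1) / b^q, as [cartierMq] dictates; [cartierFE] shows
    independence of the representative. *)
Definition cartierF (x : k) : k :=
  (cartier (\n_(repr x) * (\d_(repr x)) ^+ q.-1))%:F / (\d_(repr x))%:F.

Lemma cartierFE a b : b != 0 ->
  cartierF (a%:F / b%:F) = (cartier (a * b ^+ q.-1))%:F / b%:F.
Proof.
move=> b0; rewrite /cartierF; set r := repr _.
have r0 : \d_r != 0 by exact: denom_ratioP.
have /eqP := frac_numden (a%:F / b%:F); rewrite -/r.
rewrite eqr_div ?tofrac_eq0// -!rmorphM tofrac_eq => /eqP E.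
apply/eqP; rewrite eqr_div ?tofrac_eq0// -!rmorphM tofrac_eq; apply/eqP.
have expqE (c : A) : c ^+ q = c ^+ q.-1 * c by rewrite -exprSr prednK.
rewrite -!cartierMq !expqE; congr cartier.
transitivity ((\n_r * b) * b ^+ q.-1 * \d_r ^+ q.-1); first by ring.
by rewrite -E; ring.
Qed.

Lemma cartierF_poly a : cartierF a%:F = (cartier a)%:F.
Proof.
by rewrite -[a%:F]divr1 -tofrac1 cartierFE ?oner_eq0// expr1n mulr1 tofrac1 divr1.
Qed.

Lemma cartierF0 : cartierF 0 = 0.
Proof. by rewrite -tofrac0 cartierF_poly cartier0. Qed.

Lemma cartierFD x y : cartierF (x + y) = cartierF x + cartierF y.
Proof.
have [a [b [b0 ->]]] := frac_ex x; have [a' [b' [b'0 ->]]] := frac_ex y.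
rewrite addf_div ?tofrac_eq0// -!rmorphM -rmorphD !cartierFE ?mulf_neq0//.
rewrite addf_div ?tofrac_eq0// -!rmorphM -rmorphD; congr (_%:F / _).
rewrite -!cartierMq -cartierD; congr cartier.
have expqE (c : A) : c ^+ q = c ^+ q.-1 * c by rewrite -exprSr prednK.
by rewrite !expqE exprMn; ring.
Qed.

Lemma cartierFMq x y : cartierF (x * y ^+ q) = cartierF x * y.
Proof.
have [a [b [b0 ->]]] := frac_ex x; have [a' [b' [b'0 ->]]] := frac_ex y.
rewrite expr_div_n mulf_div -!rmorphXn -!rmorphM !cartierFE ?mulf_neq0 ?expf_neq0//.
rewrite mulf_div -rmorphM.
apply/eqP; rewrite eqr_div ?tofrac_eq0 ?mulf_neq0 ?expf_neq0//.
rewrite -!rmorphM tofrac_eq; apply/eqP.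
rewrite -!cartierMq; congr cartier.
have expqE (c : A) : c ^+ q = c ^+ q.-1 * c by rewrite -exprSr prednK.
rewrite !exprMn [(b' ^+ q) ^+ q.-1]exprAC [in RHS](expqE (b' ^+ q)).
by rewrite [(b' ^+ q) ^+ q.-1]exprAC (expqE b); ring.
all: by rewrite tofrac_eq0.
Qed.

Lemma cartierFZ c x : cartierF (c%:P%:F * x) = c%:P%:F * cartierF x.
Proof.
have -> : c%:P%:F = c%:P%:F ^+ q :> k.
  by rewrite -rmorphXn -polyC_exp expf_card.
by rewrite mulrC cartierFMq -rmorphXn -polyC_exp expf_card mulrC.
Qed.

Lemma cartierF_sum (I : Type) (r : seq I) (P : pred I) (G : I -> k) :
  cartierF (\sum_(i <- r | P i) G i) = \sum_(i <- r | P i) cartierF (G i).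
Proof. exact: (big_morph _ cartierFD cartierF0). Qed.

Lemma cartierFN x : cartierF (- x) = - cartierF x.
Proof. by apply/eqP; rewrite -addr_eq0 -cartierFD addNr cartierF0. Qed.

Lemma cartierFB x y : cartierF (x - y) = cartierF x - cartierF y.
Proof. by rewrite cartierFD cartierFN. Qed.

Lemma ord_ge_cartierF (v : A) m x : ord_ge v (q * m) x -> ord_ge v m (cartierF x).
Proof.
move=> [a [b [vb b0 ->]]]; rewrite cartierFE//.
exists (cartier (a * b ^+ q.-1)), b; split=> //.
have -> : v ^+ (q * m) * a * b ^+ q.-1 = a * b ^+ q.-1 * (v ^+ m) ^+ q.
  by rewrite -exprM mulnC -mulrA mulrC.
by rewrite cartierMq [_ * v ^+ m]mulrC.
Qed.

(** Expand (X - z^q)^q / (X - z^q) as a geometric sum: its coefficients are q-th powers and only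
    X^(q-1) has exponent -1 modulo q. This is why 1/[n] is fixed by the operator. *)
Lemma cartier_geom (z : A) : cartier (('X - z ^+ q) ^+ q.-1) = 1.
Proof.
have nz : 'X - z ^+ q != 0.
  apply/eqP => /eqP; rewrite subr_eq0 => /eqP /(congr1 (fun a : A => (size a).-1)).
  have := size_exp z q; rewrite size_polyX /= => -> /eqP.
  rewrite eq_sym muln_eq1 => /andP[_ /eqP q1].
  by move: q_gt1; rewrite q1.
have -> : ('X - z ^+ q) ^+ q.-1 = \sum_(i < q) 'X^(q.-1 - i) * (z ^+ i) ^+ q.
  apply: (mulfI nz); rewrite -exprS prednK// (exprB_q pcharF pA) subrXX.
  by congr (_ * _); apply: eq_bigr => i _; rewrite exprAC.
rewrite cartier_sum (eq_bigr (fun i : 'I_q => if i == 0%N :> nat then 1 else 0)).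
  by rewrite -big_mkcond /= (big_pred1 (Ordinal q_gt0)).
move=> i _; rewrite cartierMq cartierXn; last by move: q_gt0; lia.
have -> : (q.-1 - i == q.-1)%N = (i == 0%N :> nat).
  by have := ltn_ord i; lia.
by case: eqP => [->|]; rewrite ?mul0r ?mul1r.
Qed.

Lemma polarE n : (0 < n)%N -> polar F n = ('X - 'X^(q ^ n))%:F^-1.
Proof. by case: n => // n _; rewrite /polar -invrN -rmorphN opprB. Qed.

Lemma XsubXq_neq0 n : (0 < n)%N -> 'X - 'X^(q ^ n) != 0 :> A.
Proof. by move=> n0; rewrite -opprB oppr_eq0 bracket_neq0. Qed.

Lemma cartier_polarS n u : (0 < n)%N ->
  cartierF ('X^(q ^ u.+1)%:F * polar F n) = 'X^(q ^ u)%:F * polar F n.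
Proof.
case: n => // n _; rewrite polarE// expnSr exprM rmorphXn mulrC cartierFMq mulrC.
congr (_ * _); rewrite -[_^-1]mul1r -tofrac1 cartierFE ?XsubXq_neq0//.
by rewrite mul1r expnSr exprM cartier_geom.
Qed.

(** With m = n + 1, X / (X - X^(q^m)) is 1 plus X^(q^m) / (X - X^(q^m)), and the operator kills 1.
    The exponent index thus wraps around from 0 to m - 1. *)
Lemma cartier_polar0 n : cartierF ('X%:F * polar F n.+1) = 'X^(q ^ n)%:F * polar F n.+1.
Proof.
rewrite polarE// cartierFE ?XsubXq_neq0//; congr (_%:F * _).
rewrite expnSr exprM; set z := 'X^(q ^ n).
have -> : 'X * ('X - z ^+ q) ^+ q.-1 =
    1 * ('X - z ^+ q) ^+ q + ('X - z ^+ q) ^+ q.-1 * z ^+ q.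
  have -> : ('X - z ^+ q) ^+ q = ('X - z ^+ q) ^+ q.-1 * ('X - z ^+ q).
    by rewrite -exprSr prednK.
  by ring.
rewrite cartierD !cartierMq cartier_geom -[1](expr0 'X) cartierXn// mul1r.
have -> : (0 == q.-1)%N = false by lia.
by rewrite mul0r add0r.
Qed.

(** Each step lowers u by one modulo n, so u is the residue of -s. *)
Lemma iter_cartier_polar n s : (0 < n)%N -> exists u,
  [/\ (u < n)%N, (n %| u + s)%N &
      iter s cartierF ('X%:F * polar F n) = 'X^(q ^ u)%:F * polar F n].
Proof.
move=> n0; elim: s => [|s [u [un nus E]]].
  by exists 0%N; split; rewrite ?dvdn0// expn0 expr1.
rewrite iterS E; case: u un nus {E} => [|u] un nus.
  case: n n0 un nus => // n _ _ ns; exists n; split=> //.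
    by rewrite addnS -addSn dvdn_addr.
  by rewrite expn0 expr1 cartier_polar0.
exists u; split; first exact: ltnW.
  by rewrite addnS -addSn.
by rewrite cartier_polarS.
Qed.

End Cartier.

(** * Ore equations *)

Lemma ore_norm_aux (K : fieldType) (al X z : K) N : z != 0 ->
  al * X / z ^+ 2 + - al * z ^+ N * (X / z ^+ (N + 2)) = 0.
Proof.
move=> z0; have zN : z ^+ N != 0 by rewrite expf_neq0.
by rewrite exprD; move: zN; set y := z ^+ N => y0; field; rewrite z0 y0.
Qed.

Section Ore.
Variables (F : finFieldType) (p : nat).
Hypothesis pcharF : p \in [pchar F].
Variable v : {poly F}.
Hypotheses (v_monic : v \is monic) (v_irr : irreducible_poly v).
Local Notation q := #|F|.
Local Notation A := {poly F}.
Local Notation k := {fraction A}.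
Let q_gt1 := card_finField_gt1 F.
Let q_gt0 := card_finField_gt0 F.

Lemma irr_factor (a : A) : a != 0 -> exists e b, coprimep v b /\ a = v ^+ e * b.
Proof.
have [n] := ubnP (size a); elim: n a => // n IH a sa a0.
have [va|va] := boolP (v %| a); last first.
  by exists 0%N, a; rewrite expr0 mul1r (irr_coprimep v_irr).
have /dvdpP[c aE] := va; have c0 : c != 0.
  by apply: contra_neq a0 => c0; rewrite aE c0 mul0r.
have [|//|e [b [vb cE]]] := IH c.
  move: sa; rewrite aE size_Mmonic// (size_monic_pdeg v_monic) addnS /=.
  have := pdeg_irr_gt0 v_irr; lia.
by exists e.+1, b; split=> //; rewrite aE cE exprSr; ring.
Qed.

Lemma ord_ge_div (a : A) : a != 0 ->
  exists e, forall m y, ord_ge v (m + e) y -> ord_ge v m (y / a%:F).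
Proof.
move=> a0; have [e [b [vb aE]]] := irr_factor a0.
have b0 : b != 0 by apply: contra_neq a0 => b0; rewrite aE b0 mulr0.
exists e => m y [c [c' [vc' c'0 ->]]]; exists c, (c' * b); split.
- by rewrite coprimepMr vc'.
- by rewrite mulf_neq0.
have v0 : v ^+ e != 0 by rewrite expf_neq0 ?monic_neq0.
apply/eqP; rewrite -[_ / _ / _]mulrA -invfM -rmorphM.
rewrite eqr_div ?tofrac_eq0 ?mulf_neq0// -!rmorphM tofrac_eq aE exprD.
by apply/eqP; ring.
Qed.

Variables (h : nat) (a : nat -> A).
Hypothesis a_neq0 : a 0 != 0.

Definition ore_eval (x : k) : k := \sum_(i < h.+1) (a i)%:F * x ^+ (q ^ i).

(** For g = x / a_0 the equation reads g = [ore_eval x] / a_0^2 + the sum of the b_i g^(q^i) over i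
    > 0. The substitution gives g the coefficient 1 and keeps the b_i polynomial, since q^i >= 2 for
    i > 0. *)
Let b i : A := - a i * a 0 ^+ (q ^ i - 2).

(** Effect of the Cartier operator on a combination of the g^(q^i): c_0 g is expanded by the
    normalised equation, then every exponent of q drops by one. *)
Let step (c : nat -> A) i : A :=
  if (i < h)%N then cartier (c 0 * b i.+1 + c i.+1) else 0.

Let state s : nat -> A := iter s step (fun i => if i == 0%N then 'X * a 0 else 0).

Let ev (c : nat -> A) (g : k) : k := \sum_(i < h.+1) (c i)%:F * g ^+ (q ^ i).

Lemma ore_norm (x : k) :
  x / (a 0)%:F = ore_eval x / (a 0 ^+ 2)%:F +
    \sum_(i < h) (b i.+1)%:F * (x / (a 0)%:F) ^+ (q ^ i.+1).
Proof.
have a0F : (a 0)%:F != 0 by rewrite tofrac_eq0.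
rewrite /ore_eval big_ord_recl expn0 expr1 mulrDl -addrA.
rewrite mulr_suml -big_split /= big1 => [|i _]; last first.
  have q2 : (2 <= q ^ i.+1)%N.
    by rewrite (leq_trans q_gt1)// -[X in (X <= _)%N]expn1 leq_exp2l.
  have := ore_norm_aux (a i.+1)%:F (x ^+ (q ^ i.+1)) (q ^ i.+1 - 2) a0F.
  rewrite subnK// /bump /= add1n expr_div_n => <-.
  by rewrite [(b i.+1)%:F]rmorphM rmorphN !rmorphXn.
by rewrite addr0 rmorphXn /= expr2 invfM mulrA [_ * x]mulrC mulfK.
Qed.

Lemma cartierF_ev c (x : k) :
  cartierF (ev c (x / (a 0)%:F)) =
  ev (step c) (x / (a 0)%:F) +
  cartierF ((c 0)%:F * (ore_eval x / (a 0 ^+ 2)%:F)).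
Proof.
set g := x / _; rewrite {1}/ev big_ord_recl expn0 expr1.
rewrite {1}/g ore_norm -/g mulrDr -addrA addrC (cartierFD pcharF).
congr (_ + _); rewrite mulr_sumr -big_split /= (cartierF_sum pcharF).
rewrite /ev big_ord_recr /= /step ltnn rmorph0 mul0r addr0.
apply: eq_bigr => i _; rewrite ltn_ord mulrA -rmorphM -mulrDl -rmorphD.
by rewrite expnSr exprM (cartierFMq pcharF) (cartierF_poly pcharF).
Qed.

Let statebound : nat := maxn (size ('X * a 0)) (\max_(i < h) size (b i.+1)).

(** The operator divides degrees by q >= 2, which absorbs the multiplication by b_i: a product of
    two polynomials of size at most B has size at most 2 B, and its image size at most B. *)
Lemma size_state s i : (size (state s i) <= statebound)%N.
Proof.
elim: s i => [|s IH] i.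
  by rewrite /state /=; case: eqP => _; rewrite ?size_poly0// leq_maxl.
rewrite /state iterS -/(state s) /step; case: ltnP => [ih|]; last by rewrite size_poly0.
apply: size_cartier; rewrite (leq_trans (size_polyD _ _))// geq_max.
have q2 : (statebound * 2 <= q * statebound)%N by rewrite mulnC leq_mul2r q_gt1 orbT.
rewrite (leq_trans (size_polyMleq _ _)) /=; last first.
  have bi : (size (b i.+1) <= statebound)%N.
    rewrite leq_max; apply/orP; right.
    exact: (@leq_bigmax _ (fun i : 'I_h => size (b i.+1)) (Ordinal ih)).
  by rewrite (leq_trans (leq_pred _))// (leq_trans _ q2)// muln2 -addnn leq_add.
by rewrite (leq_trans (IH _))// leq_pmull.
Qed.

Lemma state_out s i : (h < i)%N -> state s i = 0.
Proof.
case: s => [|s] hi; first by rewrite /state /=; case: i hi.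
by rewrite /state iterS -/(state s) /step ltnNge ltnW.
Qed.

Lemma state_periodic : exists s0 P, (0 < P)%N /\
  forall s, (s0 <= s)%N -> state (s + P) = state s.
Proof.
pose code s := [ffun i : 'I_h.+1 => npolyp statebound (state s i)].
have [s0 [P [P0 codeE]]] := iter_collision code.
exists s0, P; split=> // s.
suff E : state (s0 + P) = state s0.
  move=> /subnK <-; rewrite -addnA.
  have stateD n m : state (n + m) = iter n step (state m) by rewrite /state iterD.
  by rewrite !(stateD (s - s0)%N) E.
apply/funext => i; case: (ltnP h i) => [hi|ih]; first by rewrite !state_out.
have ih' : (i < h.+1)%N by [].
have := congr1 (fun f : {ffun 'I_h.+1 -> _} => val (f (Ordinal ih'))) codeE.
by rewrite !ffunE /= !npolypK ?size_state.
Qed.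

(** The value [ore_eval x] need only be small. Each application of the operator divides orders by q,
    so the precision M depends on s and m, but it is uniform in x. *)
Lemma iter_cartier_state s m : exists M, forall x : k,
  ord_ge v M (ore_eval x) ->
  ord_ge v m (iter s (@cartierF F) ('X%:F * x) - ev (state s) (x / (a 0)%:F)).
Proof.
elim: s m => [|s IH] m.
  exists 0%N => x _; rewrite /= /ev big_ord_recl big1 => [|i _]; last first.
    by rewrite /state /= rmorph0 mul0r.
  rewrite /state /= expn0 expr1 addr0 rmorphM -mulrA [_ * (x / _)]mulrC divfK.
    by rewrite subrr; exact: ord_ge_zero.
  by rewrite tofrac_eq0.
have [M1 HM1] := IH (q * m)%N.
have [e He] := ord_ge_div (expf_neq0 2 a_neq0).
exists (maxn M1 (q * m + e)) => x xM.
rewrite iterS; set y := iter s _ _ in HM1 *.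
have -> : cartierF y - ev (state s.+1) (x / (a 0)%:F) =
  cartierF (y - ev (state s) (x / (a 0)%:F)) +
  cartierF ((state s 0)%:F * (ore_eval x / (a 0 ^+ 2)%:F)).
  by rewrite (cartierFB pcharF) cartierF_ev opprD -[state s.+1]/(step (state s)); ring.
apply: ord_geD; apply: (ord_ge_cartierF pcharF).
  by apply/HM1/ord_ge_le/xM; rewrite leq_maxl.
apply: ord_ge_mull; first exact: ord_ge0_poly.
by apply/He/ord_ge_le/xM; rewrite leq_maxr.
Qed.

(* The iterates only depend on a state of bounded size, so on finitely many states. *)
Lemma iter_cartier_periodic : exists s0 P, (0 < P)%N /\
  forall s, (s0 <= s)%N -> forall m, exists M, forall x : k,
  ord_ge v M (ore_eval x) ->
  ord_ge v m (iter s (@cartierF F) ('X%:F * x) -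
              iter (s + P) (@cartierF F) ('X%:F * x)).
Proof.
have [s0 [P [P0 stE]]] := state_periodic.
exists s0, P; split=> // s s0s m.
have [M1 H1] := iter_cartier_state s m; have [M2 H2] := iter_cartier_state (s + P) m.
exists (maxn M1 M2) => x xM.
have {}H1 := H1 x (ord_ge_le (leq_maxl _ _) xM).
have {}H2 := H2 x (ord_ge_le (leq_maxr _ _) xM).
have := ord_geB H1 H2; rewrite stE//.
by rewrite opprB addrA subrK.
Qed.

End Ore.

Section OreLower.
Variables (F : finFieldType) (p : nat).
Hypothesis pcharF : p \in [pchar F].
Variable v : {poly F}.
Local Notation q := #|F|.
Local Notation A := {poly F}.
Local Notation k := {fraction A}.

(* Each Cartier operator lowers by one all the exponents of [q]. *)
Lemma ore_separable (X : nat -> k) i0 h (a : nat -> A) : a 0 != 0 ->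
  (forall m, exists N0, forall N, (N0 <= N)%N ->
     ord_ge v m (\sum_(i < h.+1) (a i)%:F * X N ^+ (q ^ (i + i0)))) ->
  exists a' : nat -> A, a' 0 != 0 /\
  (forall m, exists N0, forall N, (N0 <= N)%N -> ord_ge v m (ore_eval h a' (X N))).
Proof.
elim: i0 a => [|i0 IH] a a0 H.
  exists a; split=> // m; have [N0 HN] := H m; exists N0 => N /HN.
  by rewrite /ore_eval; under eq_bigr do rewrite addn0.
(* Multiplication by X^j prevents the operator from killing the lowest coefficient. *)
have [j aj] := cartier_neq0 pcharF a0.
apply: (IH (fun i => cartier ('X^j * a i))) => // m.
have [N0 HN] := H (q * m)%N; exists N0 => N /HN HN'.
have := ord_ge_mull (ord_ge0_poly v 'X^j) HN'.
move=> /(ord_ge_cartierF pcharF); rewrite mulr_sumr (cartierF_sum pcharF).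
congr ord_ge; apply: eq_bigr => i _.
by rewrite addnS expnSr exprM mulrA -rmorphM (cartierFMq pcharF) (cartierF_poly pcharF).
Qed.

End OreLower.

Local Close Scope quotient_scope.

(** * Sums over divisors *)

Lemma Cyclotomic_root0 n : (0 < n)%N -> exists c, ('Phi_n).[0] * c = 1.
Proof.
move=> n0; have /(congr1 (fun P : {poly int} => P.[0])) := prod_Cyclotomic n0.
rewrite hornerD hornerXn hornerN hornerC expr0n (gtn_eqF n0) sub0r.
rewrite (big_rem n) ?divisors_id//= hornerM => E.
by exists (- (\prod_(y <- rem n (divisors n)) 'Phi_y).[0]); rewrite mulrN E opprK.
Qed.

Lemma prod_Cyclotomic_proper n m : (0 < n)%N -> (m %| n)%N -> m != n ->
  exists Q : {poly int}, 'X^n - 1 = ('X^m - 1) * 'Phi_n * Q.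
Proof.
move=> n0 mn m_neq; have m0 : (0 < m)%N by exact: dvdn_gt0 mn.
rewrite -!prod_Cyclotomic// (big_rem n) ?divisors_id//=.
rewrite (bigID (fun d => d %| m)%N) /=.
exists (\prod_(i <- rem n (divisors n) | ~~ (i %| m)%N) 'Phi_i).
rewrite mulrA [_ * 'Phi_n]mulrC; congr (_ * _ * _).
rewrite -big_filter; apply: perm_big; apply: uniq_perm.
- by rewrite filter_uniq ?rem_uniq ?divisors_uniq.
- exact: divisors_uniq.
move=> d; rewrite mem_filter mem_rem_uniq ?divisors_uniq// !inE -!dvdn_divisors//.
case dm : (d %| m)%N => //=; rewrite (dvdn_trans dm mn) andbT.
apply: contra m_neq => /eqP dn; rewrite eqn_dvd mn -dn dm//.
Qed.

(* Any prime divisor of ['Phi_n].[x] will do, for [x] divisible by [n * B.+1`!]. *)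
Lemma prime_eq1_mod n B : (0 < n)%N -> exists2 r, prime r & (B < r)%N && (n %| r.-1)%N.
Proof.
move=> n0; pose N := (n * B.+1`!)%N.
have N0 : (0 < N)%N by rewrite muln_gt0 n0 fact_gt0.
(* Where S does not vanish, Phi_n is not 0, 1 or -1, so its value has a prime divisor. *)
pose Phi : {poly int} := 'Phi_n; pose S := Phi * (Phi - 1) * (Phi + 1).
have sPhi : (1 < size Phi)%N by rewrite size_Cyclotomic ltnS totient_gt0.
have nzPhi c : (size (c : {poly int}) <= 1)%N -> Phi + c != 0.
  move=> sc; rewrite -size_poly_eq0 size_polyDl; last exact: leq_ltn_trans sPhi.
  by case: (size Phi) sPhi.
have S0 : S != 0.
  have z0 : Phi != 0 by have := nzPhi 0; rewrite addr0; apply; rewrite size_poly0.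
  have z1 : Phi - 1 != 0 by apply: nzPhi; rewrite size_polyN size_poly1.
  have z2 : Phi + 1 != 0 by apply: nzPhi; rewrite size_poly1.
  by rewrite /S mulf_neq0// mulf_neq0.
have [x xN xS] : exists2 x : nat, (N %| x)%N & ~~ root S x%:Z.
  pose s := [seq (N * i)%N%:Z | i <- iota 0 (size S)].
  have us : uniq s.
    rewrite map_inj_uniq ?iota_uniq// => i j [] /eqP.
    by rewrite eqn_pmul2l// => /eqP.
  have : ~~ all (root S) s.
    apply/negP => /(max_poly_roots S0) /(_ us).
    by rewrite size_map size_iota ltnn.
  rewrite -has_predC => /hasP[y /mapP[i _ ->] /= Sy].
  by exists (N * i)%N; [exact: dvdn_mulr|exact: Sy].
have Phix : (1 < `|Phi.[x%:Z]|)%N.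
  move: xS; rewrite /root /S !hornerM hornerD hornerN hornerD hornerC.
  rewrite !mulf_eq0 !negb_or => /andP[/andP[z0 z1] z2].
  move: z0 z1 z2; move: Phi.[_] => z; lia.
pose r := pdiv `|Phi.[x%:Z]|; have r_prime : prime r by rewrite pdiv_prime.
have rPhi : (r %| Phi.[x%:Z])%Z by apply: pdiv_dvd.
have rx : ~~ (r %| x)%N.
  apply/negP => rx.
  have : (r %| Phi.[0])%Z.
    have [Q QE] : exists Q : {poly int}, Phi = Q * 'X + Phi.[0]%:P.
      have : root (Phi - Phi.[0]%:P) 0 by rewrite /root hornerD hornerN hornerC subrr.
      by move/factor_theorem => [Q]; rewrite subr0 => QE; exists Q; rewrite -QE subrK.
    move: rPhi; rewrite {1}QE hornerD hornerM hornerX hornerC.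
    by rewrite rpredDl//; apply: dvdz_mull; exact: rx.
  have [c c1] := Cyclotomic_root0 n0; move=> /(dvdz_mulr c); rewrite c1.
  move=> r1; have : (r %| 1)%N by exact: r1.
  by rewrite dvdn1 => /eqP r1E; move: r_prime; rewrite r1E.
have rN : ~~ (r %| N)%N by apply: contra rx => rN; exact: dvdn_trans xN.
have rB : (B < r)%N.
  rewrite ltnNge; apply: contra rN => rB; rewrite dvdn_mull// dvdn_fact//.
  by rewrite prime_gt0//= (leq_trans rB).
exists r; rewrite // rB /=.
pose X : 'F_r := x%:R.
have char_r : r \in [pchar 'F_r] by rewrite pchar_Fp.
have X0 : X != 0 by rewrite /X -(dvdn_pcharf char_r).
pose f : {rmorphism int -> 'F_r} := intr.
have fE : f x = X by [].
have fPhi : (map_poly f Phi).[X] = 0.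
  rewrite -fE horner_map /=; case/dvdzP: rPhi => z ->.
  by rewrite rmorphM /= -[r%:~R]/(r%:R : 'F_r) (pcharf0 char_r) mulr0.
have Xn : X ^+ n = 1.
  have [Q] : exists Q : {poly int}, 'X^n - 1 = Phi * Q.
    by rewrite -prod_Cyclotomic// (big_rem n) ?divisors_id//=; eexists.
  move=> /(congr1 (fun P : {poly int} => (map_poly f P).[X])).
  rewrite rmorphM rmorphB /= map_polyXn rmorph1 hornerM fPhi mul0r.
  by rewrite hornerD hornerXn hornerN hornerC => /eqP; rewrite subr_eq0 => /eqP.
have [m m_prim mn] := prim_order_exists n0 Xn.
have [<-|m_neq] := eqVneq m n.
  rewrite (prim_order_dvd m_prim).
  apply/eqP/(mulfI X0); rewrite mulr1 -exprS prednK ?prime_gt0//.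
  by have := expf_card X; rewrite card_Fp.
(* If the order m of x modulo r were a proper divisor of n, x would be a root of both X^m - 1 and
   Phi_n, hence a double root of X^n - 1; the derivative n X^(n-1) then forces r to divide n. *)
have [Q] := prod_Cyclotomic_proper n0 mn m_neq.
move=> /(congr1 (fun P : {poly int} => ((map_poly f P)^`()).[X])).
rewrite !rmorphM !rmorphB /= !map_polyXn rmorph1 -/Phi.
rewrite !derivM derivB derivXn derivC subr0 !hornerE /= fPhi.
rewrite -/Phi (prim_expr_order m_prim) subrr !(mul0r, mulr0, add0r, addr0).
move=> /eqP; rewrite hornerMn hornerXn -mulr_natr mulf_eq0 expf_eq0 (negbTE X0) andbF /=.
rewrite -(dvdn_pcharf char_r) => rn; case/negP: rN.
by rewrite dvdn_mulr.
Qed.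

(** The second list consists of the divisors in which r has the maximal exponent j + 1. *)
Lemma divisors_pfactor (r a j : nat) : prime r -> ~~ (r %| a)%N -> (0 < a)%N ->
  perm_eq (divisors (a * r ^ j.+1)%N)
          (divisors (a * r ^ j)%N ++ [seq (m * r ^ j.+1)%N | m <- divisors a]).
Proof.
move=> r_prime ra a0; have r0 := prime_gt0 r_prime.
have rj i : (0 < r ^ i)%N by rewrite expn_gt0 r0.
apply: uniq_perm; first exact: divisors_uniq.
  rewrite cat_uniq divisors_uniq map_inj_uniq ?divisors_uniq ?andbT /=.
    apply/hasPn => _ /mapP[m _ ->]; rewrite -dvdn_divisors ?muln_gt0 ?a0 ?rj//.
    apply/negP => H; case/negP: ra; have := dvdn_trans (dvdn_mull m (dvdnn _)) H.
    by rewrite expnS dvdn_pmul2r.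
  by move=> x y /eqP; rewrite eqn_pmul2r// => /eqP.
move=> m; rewrite mem_cat -!dvdn_divisors ?muln_gt0 ?a0 ?rj//.
apply/idP/orP => [mr|[mr|/mapP[m']]]; last 2 first.
- by apply: dvdn_trans mr _; rewrite dvdn_mul// dvdn_exp2l.
- by rewrite -dvdn_divisors// => m'a ->; rewrite dvdn_mul.
have m0 : (0 < m)%N by apply: dvdn_gt0 mr; rewrite muln_gt0 a0 rj.
have [c rc mE] := pfactor_coprime r_prime m0.
have ca : (c %| a)%N.
  have : (c %| a * r ^ j.+1)%N by apply: dvdn_trans mr; rewrite mE dvdn_mulr.
  by rewrite Gauss_dvdl// coprimeXr// coprime_sym.
have [lj|jl] := leqP (logn r m) j.
  by left; rewrite mE dvdn_mul// dvdn_exp2l.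
right; apply/mapP; exists c; first by rewrite -dvdn_divisors.
rewrite {1}mE; congr (_ * _ ^ _)%N; apply/eqP; rewrite eqn_leq jl andbT.
have := dvdn_leq_log r _ mr; rewrite muln_gt0 a0 rj => /(_ isT).
have la : logn r a = 0%N by rewrite lognE r_prime a0 (negbTE ra).
by rewrite lognM// pfactorK// la.
Qed.

Lemma nat_periodic_mul (T : Type) (c : nat -> T) l n k :
  (forall n, c (n + l)%N = c n) -> c (n + k * l)%N = c n.
Proof.
by move=> cl; elim: k => [|k IH]; rewrite ?addn0// mulSn addnCA addnC cl.
Qed.

Section DivisorSums.
Variables (V : zmodType) (y : nat -> V) (l : nat).
Hypotheses (l_gt0 : (0 < l)%N) (yl : forall n, y (n + l)%N = y n).

Lemma periodic_mul1 m r : (0 < r)%N -> (l %| r.-1)%N -> y (m * r)%N = y m.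
Proof.
case: r => // r _ /dvdnP[k /= ->]; rewrite mulnS mulnA.
exact: nat_periodic_mul.
Qed.

Lemma periodic_mulX m r i : (0 < r)%N -> (l %| r.-1)%N -> y (m * r ^ i)%N = y m.
Proof.
move=> r0 lr; elim: i => [|i IHi]; first by rewrite muln1.
by rewrite expnSr mulnA periodic_mul1.
Qed.

(* Let H(a) be the sum of [y m] over all the divisors [m] of [a]. For a prime [r]
   congruent to 1 modulo [l] and prime to [a], H(a r^j) = (j + 1) H(a). If [r] is
   moreover large and congruent to 1 modulo [P], the hypothesis relates a r to a and
   gives H(a) = 0 for large [a], hence for all [a] by comparing a r and a r^2. *)
Lemma divisor_sum_vanish n1 s0 P : (0 < P)%N ->
  (forall s, (s0 <= s)%N -> \sum_(m <- divisors (s + P) | (n1 <= m)%N) y m =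
                            \sum_(m <- divisors s | (n1 <= m)%N) y m) ->
  forall n, (0 < n)%N -> y n = 0.
Proof.
move=> P0 T_per; pose H a := \sum_(m <- divisors a) y m.
have T_mul s k : (s0 <= s)%N -> \sum_(m <- divisors (s + k * P) | (n1 <= m)%N) y m =
    \sum_(m <- divisors s | (n1 <= m)%N) y m.
  move=> s0s; elim: k => [|k IH]; first by rewrite addn0.
  by rewrite mulSn addnCA addnC T_per ?IH// (leq_trans s0s)// leq_addr.
have H_pfactor r a j : prime r -> ~~ (r %| a)%N -> (0 < a)%N -> (l %| r.-1)%N ->
    H (a * r ^ j.+1)%N = H (a * r ^ j)%N + H a.
  move=> r_prime ra a0 lr; rewrite /H (perm_big _ (divisors_pfactor j r_prime ra a0)).
  rewrite big_cat big_map /=; congr (_ + _); apply: eq_bigr => m _.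
  exact: periodic_mulX (prime_gt0 r_prime) lr.
have big_H a : (0 < a)%N -> (s0 <= a)%N -> H a = 0.
  move=> a0 s0a; have Pl0 : (0 < P * l)%N by rewrite muln_gt0 P0.
  have [r r_prime /andP[rB rP]] := prime_eq1_mod (maxn a n1) Pl0.
  move: rB; rewrite gtn_max => /andP[ar n1r].
  have ra : ~~ (r %| a)%N by rewrite gtnNdvd.
  have lr : (l %| r.-1)%N := dvdn_trans (dvdn_mull P (dvdnn l)) rP.
  have PrP : (P %| r.-1)%N := dvdn_trans (dvdn_mulr l (dvdnn P)) rP.
  have [k kE] := dvdnP PrP.
  have := T_mul a (a * k)%N s0a.
  have -> : (a + a * k * P = a * r ^ 1)%N.
    by rewrite -mulnA -kE -mulnS prednK ?prime_gt0// expn1.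
  have pE := divisors_pfactor 0 r_prime ra a0.
  rewrite (perm_big _ pE) big_cat /= big_map muln1.
  move=> /eqP; rewrite eq_sym addrC -subr_eq subrr => /eqP E.
  rewrite /H [RHS]E [RHS]big_mkcond /=; apply: eq_big_seq => m.
  rewrite -dvdn_divisors// => ma; have m0 := dvdn_gt0 a0 ma.
  (* As r > n1, the truncation removes none of the new divisors m r. *)
  rewrite expn1 ifT; last by rewrite (leq_trans (ltnW n1r))// leq_pmull.
  by rewrite periodic_mul1// prime_gt0.
have all_H a : (0 < a)%N -> H a = 0.
  move=> a0; have [r r_prime /andP[rB lr]] := prime_eq1_mod (maxn a s0) l_gt0.
  move: rB; rewrite gtn_max => /andP[ar s0r].
  have ra : ~~ (r %| a)%N by rewrite gtnNdvd.
  have r0 := prime_gt0 r_prime.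
  have H1 := H_pfactor r a 0 r_prime ra a0 lr; have H2 := H_pfactor r a 1 r_prime ra a0 lr.
  move: H2 H1; rewrite muln1 big_H; last 2 first.
  - by rewrite muln_gt0 a0 expn_gt0 r0.
  - rewrite (leq_trans (ltnW s0r))// expnS expn1 mulnCA.
    by rewrite leq_pmulr// muln_gt0 a0.
  move=> /esym/eqP; rewrite big_H; last 2 first.
  - by rewrite muln_gt0 a0 expn_gt0 r0.
  - by rewrite expn1 (leq_trans (ltnW s0r))// leq_pmull.
  by rewrite add0r => /eqP.
(* All divisor sums vanish, so strong induction isolates the term m = n. *)
move=> n; have [N] := ubnP n; elim: N n => // N IH n nN n0.
have := all_H n n0; rewrite /H (big_rem n) ?divisors_id//= big1_seq ?addr0// => m.
rewrite mem_rem_uniq ?divisors_uniq// !inE -dvdn_divisors// => /and3P[_ mn m_dvd].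
apply: IH; last exact: dvdn_gt0 n0 m_dvd.
have mltn : (m < n)%N by rewrite ltn_neqAle mn dvdn_leq.
exact: leq_trans mltn nN.
Qed.

End DivisorSums.

Local Open Scope quotient_scope.

(** * Residues *)

(** A denominator with nonzero derivative at w has at most a simple zero there, which costs one
    order. *)
Lemma ord_ge_divX (L : fieldType) (w : L) (b : {poly L}) m y :
  b != 0 -> (b^`()).[w] != 0 -> ord_ge ('X - w%:P) m.+1 y ->
  ord_ge ('X - w%:P) m (y / b%:F).
Proof.
move=> b0 bw ym; have [rb|rb] := boolP (root b w); last first.
  apply/ord_ge_mulr; first exact: ord_ge_le ym.
  by apply: ord_geV; rewrite // coprimep_sym coprimep_XsubC.
have [c bE] := factor_theorem b w rb.
have cw : ~~ root c w.
  move: bw; rewrite bE derivM derivXsubC mulr1 hornerD hornerM hornerXsubC subrr mulr0 add0r.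
  by rewrite /root.
have c0 : c != 0 by apply: contraNneq cw => ->; exact: root0.
case: ym => [a [a' [ca a'0 ->]]]; exists a, (a' * c); split.
- by rewrite coprimepMr ca coprimep_sym coprimep_XsubC.
- by rewrite mulf_neq0.
have t0 : 'X - w%:P != 0 by rewrite polyXsubC_eq0.
apply/eqP; rewrite -[_ / _ / _]mulrA -invfM -rmorphM.
rewrite eqr_div ?tofrac_eq0 ?mulf_neq0// -!rmorphM tofrac_eq bE exprS.
by apply/eqP; ring.
Qed.

Lemma div_sub_aux (K : fieldType) (x y b : K) : b != 0 -> x * b^-1 - y = (x - y * b) / b.
Proof. by move=> b0; rewrite mulrBl mulfK. Qed.

Lemma residue_term_aux (K : fieldType) (x y z c s : K) :
  z * (c * (s * x)) - c * s * y = c * s * (z * x - y).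
Proof. by ring. Qed.

Lemma tofrac_inj (R : idomainType) : injective (@FracField.tofrac R).
Proof. by move=> x y /eqP; rewrite tofrac_eq => /eqP. Qed.

Section Residue.
Variables (F : finFieldType) (p : nat).
Hypothesis pcharF : p \in [pchar F].
Variable v : {poly F}.
Hypotheses (v_monic : v \is monic) (v_irr : irreducible_poly v).
Local Notation q := #|F|.
Local Notation A := {poly F}.
Local Notation k := {fraction A}.
Local Notation d := (pdeg v).
Let q_gt1 := card_finField_gt1 F.
Let q_gt0 := card_finField_gt0 F.

Variables (L : fieldType) (phi : {rmorphism F -> L}) (w : L).
Local Notation V := (map_poly phi v).
Hypotheses (Vw : root V w) (wd : w ^+ (q ^ d) = w).
Local Notation t := ('X - w%:P).

Let pcharL : p \in [pchar L].
Proof. by rewrite (fmorph_pchar phi). Qed.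

Let pL : p \in [pchar {poly L}].
Proof. by rewrite pchar_poly. Qed.

Lemma horner_map_expq (a : A) (z : L) n :
  (map_poly phi a).[z ^+ (q ^ n)] = (map_poly phi a).[z] ^+ (q ^ n).
Proof.
rewrite !horner_coef (exprq_sum pcharF pcharL); apply: eq_bigr => i _.
by rewrite exprMn coef_map -rmorphXn /= (expf_cardn _ a`_i) exprAC.
Qed.

(** Since theta^(q^n) = w^(q^n) + t^(q^n), this polynomial is a t-adic approximation of V / (theta -
    theta^(q^n)); see [polar_residue]. *)
Definition residue n : {poly L} := V %/ ('X - (w ^+ (q ^ n))%:P).

Lemma residueE n : V = residue n * ('X - (w ^+ (q ^ n))%:P).
Proof.
rewrite divpK// dvdp_XsubCl /root horner_map_expq expf_eq0 (eqP Vw).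
by rewrite eqxx expn_gt0 q_gt0.
Qed.

Lemma size_residue n : size (residue n) = d.
Proof. by rewrite size_divp ?polyXsubC_eq0// size_XsubC size_map_poly subn1. Qed.

Lemma residue_addd n : residue (n + d) = residue n.
Proof. by rewrite /residue addnC expnD exprM wd. Qed.

(** The same polynomial in the coordinate t. *)
Definition tresidue n : {poly L} := residue n \Po ('X + w%:P).

Lemma size_tresidue n : size (tresidue n) = d.
Proof. by rewrite size_comp_poly2 ?size_residue// size_XaddC. Qed.

Lemma tresidue_addd n : tresidue (n + d) = tresidue n.
Proof. by rewrite /tresidue residue_addd. Qed.

Lemma tresidue_coef_neq0 n : exists2 i, (i < d)%N & (tresidue n)`_i != 0.
Proof.
exists d.-1; first by rewrite ltn_predL (pdeg_irr_gt0 v_irr).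
rewrite -{1}(size_tresidue n) -/(lead_coef _) lead_coef_eq0 -size_poly_eq0.
by rewrite size_tresidue -lt0n (pdeg_irr_gt0 v_irr).
Qed.

Lemma ord_ge_map (g : {rmorphism k -> {fraction {poly L}}}) m x :
  (forall a, g a%:F = (map_poly phi a)%:F) -> ord_ge v m x -> ord_ge t m (g x).
Proof.
move=> gE [a [b [vb b0 ->]]].
have tV : t %| V by rewrite dvdp_XsubCl.
rewrite fmorph_div !gE; exists ((V %/ t) ^+ m * map_poly phi a), (map_poly phi b).
split.
- apply: coprimep_dvdr tV _; by rewrite coprimep_map.
- by rewrite map_poly_eq0.
congr (_%:F / _); rewrite rmorphM rmorphXn /= mulrA -exprMn.
by rewrite [t * _]mulrC divpK.
Qed.

Lemma Xq_expand u : 'X^(q ^ u) = (w ^+ (q ^ u))%:P + t ^+ (q ^ u) :> {poly L}.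
Proof. by rewrite (exprqB pcharF pL) -polyC_exp addrC subrK. Qed.

(** The difference is t^(q^n) [residue n] over a denominator of derivative 1, which costs at most
    one order; q^m < q^n leaves room for it. *)
Lemma polar_residue m n : (m < n)%N ->
  ord_ge t (q ^ m) (V%:F * ('X - 'X^(q ^ n))%:F^-1 - (residue n)%:F).
Proof.
move=> mn; have n0 : (0 < n)%N by apply: leq_ltn_trans mn.
pose b : {poly L} := 'X - 'X^(q ^ n).
have bder : b^`() = 1.
  rewrite derivB derivX derivXn -mulr_natr.
  have -> : (q ^ n)%:R = 0 :> {poly L}.
    apply/eqP; rewrite -(dvdn_pcharf pL).
    by case: n n0 {mn b} => // n _; rewrite expnS dvdn_mulr// (pchar_dvd_card pcharF).
  by rewrite mulr0 subr0.
have b0 : b != 0 by apply: contraTneq (oner_neq0 {poly L}) => b0; rewrite -bder b0 derivC eqxx.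
have -> : V%:F * b%:F^-1 - (residue n)%:F = (t ^+ (q ^ n) * residue n)%:F / b%:F.
  have E : V - residue n * b = t ^+ (q ^ n) * residue n.
    have -> : b = 'X - (w ^+ (q ^ n))%:P - t ^+ (q ^ n).
      by rewrite /b Xq_expand opprD addrA.
    by rewrite {1}(residueE n); ring.
  have bF : b%:F != 0 by rewrite tofrac_eq0.
  rewrite -E [(V - _)%:F]rmorphB /= [(residue n * b)%:F]rmorphM; exact: div_sub_aux.
apply: ord_ge_divX => //; first by rewrite bder hornerC oner_neq0.
apply: ord_ge_poly; rewrite dvdp_mulr// dvdp_exp2l//.
by rewrite ltn_exp2l.
Qed.

(** The product lives in degrees [0, d) and [q^u, q^u + d). As d < q^d, the window of u = d + 1
    meets neither the windows of the other u nor the constant part. *)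
Lemma coef_shift_residue n u i : (i < d)%N ->
  (((w ^+ (q ^ u))%:P + 'X^(q ^ u)) * tresidue n)`_(q ^ d.+1 + i) =
  if u == d.+1 then (tresidue n)`_i else 0.
Proof.
move=> id; have dq : (d < q ^ d)%N by exact: ltn_expl.
have q2 : (2 * q ^ d <= q ^ d.+1)%N by rewrite expnS leq_mul2r q_gt1 orbT.
rewrite mulrDl coefD coefCM coefXnM [X in _ * X + _]nth_default; last first.
  rewrite size_tresidue; move: q2 dq; move: (q ^ d)%N (q ^ d.+1)%N => x y; lia.
rewrite mulr0 add0r; case: (ltngtP u d.+1) => [ud|ud|->].
- have qu : (q ^ u <= q ^ d)%N by rewrite leq_exp2l.
  rewrite ltnNge; have -> /= : (q ^ u <= q ^ d.+1 + i)%N.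
    move: qu q2; move: (q ^ u)%N (q ^ d)%N (q ^ d.+1)%N => x y z; lia.
  rewrite nth_default// size_tresidue.
  move: qu q2 dq; move: (q ^ u)%N (q ^ d)%N (q ^ d.+1)%N => x y z; lia.
- have qu : (q ^ d.+2 <= q ^ u)%N by rewrite leq_exp2l.
  have q3 : (2 * q ^ d.+1 <= q ^ d.+2)%N by rewrite [(q ^ d.+2)%N]expnS leq_mul2r q_gt1 orbT.
  have -> // : (q ^ d.+1 + i < q ^ u)%N.
  move: qu q2 q3 dq; move: (q ^ u)%N (q ^ d)%N (q ^ d.+1)%N (q ^ d.+2)%N => x y z x'.
  lia.
by rewrite ltnNge leq_addr /= addKn.
Qed.

(* In the local coordinate [t], the coefficient of [t ^ (q ^ d.+1 + i)] only sees the
   terms with [u n = d.+1]. *)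
Lemma residue_extract (N : nat) (e : nat -> F) (u u' : nat -> nat) i : (i < d)%N ->
  ord_ge v (q ^ d.+2) (\sum_(d.+3 <= n < N)
    (e n)%:P%:F * (('X^(q ^ u n))%:F * polar F n - ('X^(q ^ u' n))%:F * polar F n)) ->
  \sum_(d.+3 <= n < N | u n == d.+1) phi (e n) * (tresidue n)`_i =
  \sum_(d.+3 <= n < N | u' n == d.+1) phi (e n) * (tresidue n)`_i.
Proof.
move=> id H; pose f : {rmorphism A -> {fraction {poly L}}} :=
  @FracField.tofrac {poly L} \o map_poly phi.
have f_inj : injective f by apply: inj_comp; [exact: tofrac_inj|exact: map_poly_inj].
have [g gE] := frac_lift f_inj.
have {}gE a : g a%:F = (map_poly phi a)%:F by rewrite gE.
have gX j : g ('X^j)%:F = ('X^j)%:F by rewrite gE map_polyXn.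
(* Y replaces each polar term by its residue in V times the given sum. The error has order at least
   q^(d+2), beyond the degree q^(d+1) + i to be read. *)
pose Y : {poly L} := \sum_(d.+3 <= n < N)
  (phi (e n))%:P * ('X^(q ^ u n) - 'X^(q ^ u' n)) * residue n.
have YV : ord_ge t (q ^ d.+2) (V%:F * g (\sum_(d.+3 <= n < N) (e n)%:P%:F *
    (('X^(q ^ u n))%:F * polar F n - ('X^(q ^ u' n))%:F * polar F n)) - Y%:F).
  rewrite rmorph_sum mulr_sumr /Y (rmorph_sum (@FracField.tofrac _)) -sumrB /=.
  apply: ord_ge_sum => n; rewrite mem_index_iota => /andP[dn _] _.
  rewrite -mulrBl !rmorphM /= rmorphB /= gE map_polyC !gX.
  rewrite (polarE F (leq_ltn_trans (leq0n _) dn)) fmorphV gE rmorphB /= map_polyX map_polyXn.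
  rewrite -(rmorphB (@FracField.tofrac _)) residue_term_aux.
  apply: ord_ge_mull; last exact: polar_residue.
  by rewrite -rmorphM; exact: ord_ge0_poly.
have {YV}YV : t ^+ (q ^ d.+2) %| Y.
  apply: ord_ge_polyP; have := ord_ge_map gE H.
  move=> /(ord_ge_mull (ord_ge0_poly t V)) => H'.
  by have := ord_geB H' YV; rewrite subKr.
have /dvdpP[Z YZ] := YV.
have comp_t : t \Po ('X + w%:P) = 'X by rewrite comp_polyB comp_polyX comp_polyC addrK.
have Xq_comp j : 'X^(q ^ j) \Po ('X + w%:P) = (w ^+ (q ^ j))%:P + 'X^(q ^ j).
  by rewrite rmorphXn /= comp_polyX (exprqD pcharF pL) -polyC_exp addrC.
have dq : (d < q ^ d)%N by exact: ltn_expl.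
have idx : (q ^ d.+1 + i < q ^ d.+2)%N.
  have q2 : (2 * q ^ d.+1 <= q ^ d.+2)%N by rewrite [(q ^ d.+2)%N]expnS leq_mul2r q_gt1 orbT.
  have q3 : (q ^ d <= q ^ d.+1)%N by rewrite leq_exp2l.
  move: q2 q3 dq; move: (q ^ d)%N (q ^ d.+1)%N (q ^ d.+2)%N => x y z; lia.
have : (Y \Po ('X + w%:P))`_(q ^ d.+1 + i) = 0.
  by rewrite YZ comp_polyM rmorphXn /= comp_t coefMXn idx.
rewrite /Y rmorph_sum coef_sum /=.
rewrite (eq_bigr (fun n => phi (e n) * ((if u n == d.+1 then (tresidue n)`_i else 0) -
    (if u' n == d.+1 then (tresidue n)`_i else 0)))) => [|n _]; last first.
  rewrite !comp_polyM comp_polyC comp_polyB !Xq_comp -mulrA coefCM.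
  by rewrite mulrBl coefB !coef_shift_residue.
under eq_bigr do rewrite mulrBr.
rewrite sumrB => /eqP; rewrite subr_eq0 => /eqP E.
have sumE (u0 : nat -> nat) :
    \sum_(d.+3 <= n < N | u0 n == d.+1) phi (e n) * (tresidue n)`_i =
    \sum_(d.+3 <= n < N) phi (e n) * (if u0 n == d.+1 then (tresidue n)`_i else 0).
  by rewrite [LHS]big_mkcond; apply: eq_bigr => n _; case: eqP; rewrite ?mulr0.
by rewrite !sumE.
Qed.

End Residue.

(** * From an Ore equation for the polar sums to congruences between digits *)

Lemma big_divisors (V : zmodType) (f : nat -> V) s a N : (0 < s)%N -> (s < N)%N ->
  \sum_(a <= n < N | (n %| s)%N) f n = \sum_(n <- divisors s | (a <= n)%N) f n.
Proof.
move=> s0 sN; rewrite -big_filter -[RHS]big_filter; apply: perm_big.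
apply: uniq_perm; rewrite ?filter_uniq ?divisors_uniq ?iota_uniq// => n.
rewrite !mem_filter mem_index_iota -dvdn_divisors//.
by case ns : (n %| s)%N; rewrite ?andbF//= andbT (leq_ltn_trans (dvdn_leq s0 ns) sN) andbT.
Qed.

Section PolarSum.
Variables (F : finFieldType) (p : nat).
Hypothesis pcharF : p \in [pchar F].
Variable v : {poly F}.
Hypotheses (v_monic : v \is monic) (v_irr : irreducible_poly v).
Local Notation q := #|F|.
Local Notation A := {poly F}.
Local Notation k := {fraction A}.
Local Notation d := (pdeg v).

Lemma residue_field_ex : exists (L : fieldType) (phi : {rmorphism F -> L}) (w : L),
  root (map_poly phi v) w /\ w ^+ (q ^ d) = w.
Proof.
pose vI : monic_irreducible_poly v := (v_irr, v_monic).
exists {poly %/ v with vI}.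
exists (qpolyC v : {rmorphism F -> {poly %/ v}}), (in_qpoly v 'X); split.
  rewrite /root; have := in_qpoly_comp_horner v v 'X; rewrite comp_polyXr => <-.
  by rewrite (in_qpoly_eq0 v_monic v_irr).
have <- : #|{poly %/ v with vI}| = (q ^ d)%N by rewrite card_qfpoly.
exact: (@expf_card {poly %/ v with vI}).
Qed.

Variables (c : nat -> nat) (l : nat).
Hypotheses (l_gt0 : (0 < l)%N) (cl : forall n, c (n + l)%N = c n) (dl : (d %| l)%N).

(** Coefficient of [polar F n] in the logarithmic derivative of the partial product of length N: the
    second digit comes from the factor u_(n+d), which is present only if n + d < N. *)
Definition trunc_coef N n : F :=
  (c n)%:R - (if (n < N - d)%N then (c (n + d))%:R else 0).

(** The sum starts at d + 3 because [polar_residue] at precision q^(d+2) requires d + 2 < n. *)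
Definition polar_sum N : k :=
  \sum_(d.+3 <= n < N) (trunc_coef N n)%:P%:F * polar F n.

(** Here [u n] is the residue of -s modulo n and d + 1 < n, so it equals d + 1 exactly when n
    divides s + d + 1. *)
Lemma iter_cartier_polar_sum s N : exists u : nat -> nat,
  (forall n, (d.+3 <= n)%N -> (u n == d.+1) = (n %| s + d.+1)%N) /\
  iter s (@cartierF F) ('X%:F * polar_sum N) =
  \sum_(d.+3 <= n < N) (trunc_coef N n)%:P%:F * (('X^(q ^ u n))%:F * polar F n).
Proof.
have /choice[u uP] : forall n, exists u, (0 < n)%N ->
    [/\ (u < n)%N, (n %| u + s)%N &
      iter s (@cartierF F) ('X%:F * polar F n) = 'X^(q ^ u)%:F * polar F n].
  move=> n; case: (posnP n) => [->|n0]; first by exists 0%N.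
  by have [u uP] := iter_cartier_polar pcharF s n0; exists u.
exists u; split=> [n dn|].
  have n0 : (0 < n)%N by apply: leq_trans dn.
  have [un nus _] := uP n n0; apply/eqP/idP => [<-|nsd]; first by rewrite addnC.
  apply/eqP; rewrite -(modn_small un) -(@modn_small d.+1 n)//; last exact: ltnW.
  by rewrite -(eqn_modDr s) [(d.+1 + s)%N]addnC (eqP nus) eq_sym.
have iterE x : iter s (@cartierF F) (\sum_(d.+3 <= n < N) (trunc_coef N n)%:P%:F * x n) =
    \sum_(d.+3 <= n < N) (trunc_coef N n)%:P%:F * iter s (@cartierF F) (x n).
  elim: s {uP} => //= s IH; rewrite IH (cartierF_sum pcharF); apply: eq_bigr => n _.
  by rewrite (cartierFZ pcharF).
rewrite /polar_sum mulr_sumr; under eq_bigr do rewrite mulrCA.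
rewrite iterE; apply: eq_big_nat => n /andP[dn _].
by have [_ _ ->] := uP n (leq_trans (ltn0Sn _) dn).
Qed.

Lemma polar_sum_ore (h : nat) (a : nat -> A) : a 0 != 0 ->
  (forall m, exists N0, forall N, (N0 <= N)%N -> ord_ge v m (ore_eval h a (polar_sum N))) ->
  forall n, (c n)%:R = (c (n + d))%:R :> F.
Proof.
move=> a0 ore; have [L [phi [w [Vw wd]]]] := residue_field_ex.
suff y0 i n : (i < d)%N -> (0 < n)%N ->
    phi ((c n)%:R - (c (n + d))%:R) * (tresidue v phi w n)`_i = 0.
  (* By periodicity, the index 0 follows from the index l. *)
  suff pos n : (0 < n)%N -> (c n)%:R = (c (n + d))%:R :> F.
    case=> [|n]; last exact: pos.
    by have := pos l l_gt0; rewrite -(cl 0) -(cl (0 + d)) addnAC.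
  move=> n0; have [i id wi] := tresidue_coef_neq0 v_irr phi w n.
  have /eqP := y0 i n id n0; rewrite mulf_eq0 (negbTE wi) orbF fmorph_eq0 subr_eq0.
  by move/eqP.
move=> id; move: n.
pose y n := phi ((c n)%:R - (c (n + d))%:R) * (tresidue v phi w n)`_i.
have yl n : y (n + l)%N = y n.
  rewrite /y cl addnAC cl; congr (_ * _`_i).
  case/dvdnP: dl => j ->; elim: j => [|j IH]; first by rewrite addn0.
  by rewrite mulSn addnCA addnC tresidue_addd.
have [s0 [P [P0 per]]] := iter_cartier_periodic pcharF v_monic v_irr h a0.
apply: (@divisor_sum_vanish _ y l l_gt0 yl d.+3 (s0 + d.+1) P P0).
suff T s : (s0 <= s)%N -> \sum_(m <- divisors (s + d.+1) | (d.+3 <= m)%N) y m =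
    \sum_(m <- divisors (s + P + d.+1) | (d.+3 <= m)%N) y m.
  move=> s s0s; have ds : (d.+1 <= s)%N by rewrite (leq_trans _ s0s)// leq_addl.
  have := T (s - d.+1)%N; rewrite addnAC subnK// => -> //.
  by rewrite leq_subRL// addnC.
move=> s0s; have [M HM] := per s s0s (q ^ d.+2)%N; have [N0 HN] := ore M.
(* N exceeds the threshold N0 of the Ore equation and places every divisor counted below N - d,
   where [trunc_coef] is the full difference of digits. *)
pose N := (N0 + (s + P + d.+1 + d.+1))%N.
have {}HM := HM (polar_sum N) (HN N (leq_addr _ _)).
have [u [uE E]] := iter_cartier_polar_sum s N.
have [u' [uE' E']] := iter_cartier_polar_sum (s + P) N.
have := residue_extract (u := u) (u' := u') pcharF v_monic Vw (N := N) (e := trunc_coef N) id.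
move: HM; rewrite E E' -sumrB; under eq_bigr do rewrite -mulrBr.
move=> HM /(_ HM).
have sumE s1 (u1 : nat -> nat) : (s1 <= s + P)%N ->
    (forall n, (d.+3 <= n)%N -> (u1 n == d.+1) = (n %| s1 + d.+1)%N) ->
    \sum_(d.+3 <= n < N | u1 n == d.+1) phi (trunc_coef N n) * (tresidue v phi w n)`_i =
    \sum_(m <- divisors (s1 + d.+1) | (d.+3 <= m)%N) y m.
  move=> s1s u1E; have s1N : (s1 + d.+1 < N - d)%N by rewrite /N; lia.
  rewrite -(@big_divisors _ y _ _ N) ?addnS//; last first.
    by rewrite -addnS (leq_trans s1N)// leq_subr.
  rewrite big_nat_cond [RHS]big_nat_cond; apply: eq_big => n.
    by apply: andb_id2l => /andP[dn _]; rewrite u1E// addnS.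
  move=> /andP[/andP[dn _]]; rewrite u1E// => /dvdn_leq; rewrite addnS => /(_ isT) ns.
  rewrite /y /trunc_coef ifT//; move: s1N; rewrite addnS; exact: leq_ltn_trans.
by rewrite !(sumE _ _ _ uE, sumE _ _ _ uE')// leq_addr.
Qed.

End PolarSum.

Local Close Scope quotient_scope.
Local Open Scope classical_set_scope.
Local Open Scope ring_scope.

(** * Absolute values and limits *)

Section Limits.
Variables (R : realType) (K : fieldType) (N : absolute_value R K).
Implicit Types (x y : nat -> K) (a b : K).

Lemma absv1 : N 1 = 1.
Proof.
apply: (@mulfI _ (N 1)); last by rewrite -absvM !mulr1.
by apply/eqP => /absv_eq0/eqP; rewrite oner_eq0.
Qed.

Lemma absvX a n : N (a ^+ n) = N a ^+ n.
Proof. by elim: n => [|n IH]; rewrite ?absv1// !exprS absvM IH. Qed.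

Lemma absvN a : N (- a) = N a.
Proof.
suff N1 : N (- 1) = 1 by rewrite -mulN1r absvM N1 mul1r.
apply/eqP; rewrite -(@eqrXn2 _ 2) ?absv_ge0 ?ler01//.
by rewrite expr1n -absvX sqrrN expr1n absv1.
Qed.

Lemma absv_sym a b : N (a - b) = N (b - a).
Proof. by rewrite -absvN opprB. Qed.

Lemma absv_gt0 a : (0 < N a) = (a != 0).
Proof.
rewrite lt_def absv_ge0 andbT; congr negb; apply/eqP/eqP => [|->].
  exact: absv_eq0.
exact: absv0.
Qed.

Lemma absvV a : N a^-1 = (N a)^-1.
Proof.
have [->|a0] := eqVneq a 0; first by rewrite invr0 absv0 invr0.
have Na0 : N a != 0 by rewrite gt_eqF// absv_gt0.
by apply: (mulIf Na0); rewrite -absvM !mulVf// absv1.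
Qed.

(** Sequential convergence for the absolute value; [conv_lim] and [cauchy_conv] relate it to the
    filters of [metric_of]. *)
Definition conv x a :=
  forall e : R, 0 < e -> exists n0, forall n, (n0 <= n)%N -> N (a - x n) < e.

Lemma conv_uniq x a b : conv x a -> conv x b -> a = b.
Proof.
move=> xa xb; apply/eqP; rewrite -subr_eq0; apply/negPn/negP.
rewrite -absv_gt0 => ab; have e0 : 0 < N (a - b) / 2 by rewrite divr_gt0.
have [n1 H1] := xa _ e0; have [n2 H2] := xb _ e0.
have {}H1 := H1 (maxn n1 n2) (leq_maxl _ _); have {}H2 := H2 (maxn n1 n2) (leq_maxr _ _).
have := absvD N (a - x (maxn n1 n2)) (x (maxn n1 n2) - b); rewrite subrKA.
rewrite (absv_sym _ b) leNgt => /negP; apply.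
by rewrite [X in _ < X]splitr ltrD.
Qed.

Lemma conv_cst a : conv (fun=> a) a.
Proof. by move=> e e0; exists 0%N => n _; rewrite subrr absv0. Qed.

Lemma conv_near x y n0 a : (forall n, (n0 <= n)%N -> x n = y n) -> conv x a -> conv y a.
Proof.
move=> xy xa e /xa[n1 H]; exists (maxn n0 n1) => n; rewrite geq_max => /andP[n0n n1n].
by rewrite -xy// H.
Qed.

Lemma conv_shift x n0 a : conv x a -> conv (fun n => x (n + n0)%N) a.
Proof.
by move=> xa e /xa[n1 H]; exists n1 => n n1n; apply: H; rewrite (leq_trans n1n)// leq_addr.
Qed.

Lemma conv_subseq x (f : nat -> nat) a : (forall n, (n <= f n)%N) ->
  conv x a -> conv (x \o f) a.
Proof. by move=> fn xa e /xa[n1 H]; exists n1 => n n1n; apply: H; rewrite (leq_trans n1n). Qed.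

Lemma convD x y a b : conv x a -> conv y b -> conv (fun n => x n + y n) (a + b).
Proof.
move=> xa yb e e0; have e20 : 0 < e / 2 by rewrite divr_gt0.
have [n1 H1] := xa _ e20; have [n2 H2] := yb _ e20.
exists (maxn n1 n2) => n; rewrite geq_max => /andP[n1n n2n].
rewrite opprD addrACA (le_lt_trans (absvD _ _ _))// [X in _ < X]splitr.
by rewrite ltrD ?H1 ?H2.
Qed.

Lemma convM x y a b : conv x a -> conv y b -> conv (fun n => x n * y n) (a * b).
Proof.
move=> xa yb e e0; pose C := 1 + N a + N b.
have C0 : 0 < C by rewrite ltr_wpDr ?absv_ge0// ltr_wpDr ?absv_ge0.
have d0 : 0 < Num.min 1 (e / (2 * C)) by rewrite lt_min ltr01 divr_gt0// mulr_gt0.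
have [n1 H1] := xa _ d0; have [n2 H2] := yb _ d0.
exists (maxn n1 n2) => n; rewrite geq_max => /andP[/H1 + /H2].
rewrite !lt_min => /andP[x1 x2] /andP[y1 y2].
have -> : a * b - x n * y n = (a - x n) * b + x n * (b - y n) by ring.
rewrite (le_lt_trans (absvD _ _ _))// !absvM.
have xC : N (x n) <= C.
  have := absvD N (x n - a) a; rewrite subrK absv_sym => /le_trans; apply.
  by rewrite /C -addrA lerD ?(ltW x1)// lerDl absv_ge0.
have bC : N b <= C by rewrite /C lerDr addr_ge0// absv_ge0.
have -> : e = e / (2 * C) * C + C * (e / (2 * C)).
  by field; rewrite gt_eqF.
apply: ltr_leD.
  by apply: le_lt_trans (ler_wpM2l (absv_ge0 _ _) bC) _; rewrite ltr_pM2r.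
by rewrite ler_pM ?absv_ge0// ltW.
Qed.

Lemma convX x a n : conv x a -> conv (fun m => x m ^+ n) (a ^+ n).
Proof.
move=> xa; elim: n => [|n IH]; first exact: conv_cst.
by move=> e e0; have [n0 H] := convM xa IH e0; exists n0 => m /H; rewrite !exprS.
Qed.

Lemma conv_sum (I : Type) (r : seq I) (X : I -> nat -> K) (A : I -> K) :
  (forall i, conv (X i) (A i)) -> conv (fun n => \sum_(i <- r) X i n) (\sum_(i <- r) A i).
Proof.
move=> XA; elim: r => [|i r IH].
  by move=> e e0; exists 0%N => n _; rewrite !big_nil subrr absv0.
move=> e e0; have [n0 H] := convD (XA i) IH e0.
by exists n0 => n /H; rewrite !big_cons.
Qed.

Lemma conv_lim x a : conv x a ->
  lim ((x : nat -> metric_of N) @ \oo) = a.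
Proof.
move=> xa; apply: cvg_lim; first exact: (@metric_hausdorff R (metric_of N)).
apply/metricType_numDomainType.cvgrPdist_lt => e e0.
have [n0 H] := xa e e0.
by exists n0 => // n /= /H.
Qed.

Lemma cauchy_conv x : is_complete N ->
  (forall e : R, 0 < e -> exists n0, forall n, (n0 <= n)%N -> N (x n0 - x n) < e) ->
  exists a, conv x a.
Proof.
move=> NC xC; have cv : cvg ((x : nat -> metric_of N) @ \oo).
  apply: NC; apply: cauchy_exP => e e0; have [n0 H] := xC e e0.
  exists (x n0); exists n0 => // n /= n0n; rewrite ballEmdist; exact: H.
exists (lim ((x : nat -> metric_of N) @ \oo)) => e e0.
have /metricType_numDomainType.cvgrPdist_lt /(_ e e0) [n0 _ H] := cv.
by exists n0 => n /H.
Qed.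

End Limits.

(** Residues modulo r have at most [size r] coordinates, so one more of them is dependent. Applied
    to the X^(q^i), this yields an Ore polynomial divisible by r. *)
Lemma poly_lin_dep (K : fieldType) (r : {poly K}) (f : nat -> {poly K}) : r != 0 ->
  exists al : nat -> K, (exists2 i, (i <= size r)%N & al i != 0) /\
    r %| \sum_(i < (size r).+1) al i *: f i.
Proof.
move=> r0; pose n := size r.
pose M : 'M[K]_(n.+1, n) := \matrix_i poly_rV (f i %% r).
have : kermx M != 0.
  rewrite -mxrank_eq0 mxrank_ker -lt0n subn_gt0 ltnS; exact: rank_leq_col.
move=> /rowV0Pn[u /sub_kermxP uM u0].
exists (fun i => u 0 (inord i)); split.
  have [i ui] : exists i, u 0 i != 0.
    apply/existsP; apply: contraNT u0; rewrite negb_exists => /forallP ui.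
    by apply/eqP/rowP => i; rewrite mxE; apply/eqP; rewrite -[_ == _]negbK ui.
  by exists i; rewrite ?inord_val// -ltnS.
have /(congr1 (@rVpoly K n)) := uM; rewrite mulmx_sum_row linear_sum linear0 /= => E.
rewrite /dvdp; apply/eqP; rewrite (big_morph _ (modpD r) (mod0p r)) -[RHS]E.
apply: eq_bigr => i _; rewrite modpZl linearZ /= rowK inord_val poly_rV_K//.
by rewrite ltnW// ltn_modp.
Qed.

Lemma frac_common_denom (R : idomainType) (al : nat -> {fraction R}) n :
  exists (D : R) (a : nat -> R), D != 0 /\
    forall i, (i < n)%N -> al i * D%:F = (a i)%:F.
Proof.
elim: n => [|n [D [a [D0 aE]]]]; first by exists 1, (fun=> 0); rewrite oner_eq0.
have [x [y [y0 alE]]] := frac_ex (al n).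
exists (D * y), (fun i => if i == n then x * D else a i * y); split.
  by rewrite mulf_neq0.
move=> i; rewrite ltnS leq_eqVlt; case: eqP => [-> _|_ /= ilt].
  have yF : y%:F != 0 by rewrite tofrac_eq0.
  by rewrite alE !rmorphM /= [D%:F * _]mulrC mulrA divfK.
by rewrite !rmorphM /= mulrA aE.
Qed.

(** * The completion at v: orders, absolute values, Ore equations of algebraic elements *)

Section VadicField.
Variables (R : realType) (F : finFieldType) (p : nat).
Hypothesis pcharF : p \in [pchar F].
Variable v : {poly F}.
Hypotheses (v_monic : v \is monic) (v_irr : irreducible_poly v).
Variables (kv : fieldType) (N : absolute_value R kv).
Variable iota : {rmorphism {fraction {poly F}} -> kv}.
Hypothesis kvP : is_completion (@vadic_abs F v R) N iota.
Local Notation q := #|F|.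
Local Notation A := {poly F}.
Local Notation k := {fraction A}.
Local Notation d := (pdeg v).
Let q_gt1 := card_finField_gt1 F.
Let q_gt0 := card_finField_gt0 F.

Lemma coprimep_irr_neq0 (b : A) : coprimep v b -> b != 0.
Proof.
apply: contraTneq => ->; rewrite coprimep0 -size_poly_eq1 (size_monic_pdeg v_monic).
by rewrite eqSS -lt0n (pdeg_irr_gt0 v_irr).
Qed.

Lemma vord_pow e (b : A) : coprimep v b -> vord v (v ^+ e * b) = e.
Proof.
move=> vb; have b0 := coprimep_irr_neq0 vb.
have v0 : v != 0 by exact: monic_neq0.
apply/eqP; rewrite eqn_leq; apply/andP; split.
  apply/bigmax_leqP => i; rewrite Gauss_dvdpl ?coprimep_expl// dvdp_Pexp2l//.
  by rewrite (size_monic_pdeg v_monic) ltnS (pdeg_irr_gt0 v_irr).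
have elt : (e < size (v ^+ e * b)%R)%N.
  have vX0 : v ^+ e != 0 by rewrite expf_neq0.
  rewrite size_mul//; have : (size (v ^+ e)%R).-1 = (d * e)%N by rewrite size_exp.
  have := pdeg_irr_gt0 v_irr; move: b0 vX0; rewrite -!size_poly_gt0.
  by move: (size b) (size (v ^+ e)) (pdeg v) => x y z; nia.
by apply: (@leq_bigmax_cond _ _ _ (Ordinal elt)); rewrite dvdp_mulr.
Qed.

Definition absv_unif : R := (q%:R ^+ d)^-1.

Lemma absv_unif_gt0 : 0 < absv_unif.
Proof. by rewrite invr_gt0 exprn_gt0// ltr0n. Qed.

Lemma absv_unif_le_half : absv_unif <= 2^-1.
Proof.
rewrite lef_pV2 ?posrE ?exprn_gt0 ?ltr0n// -natrX ler_nat.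
by rewrite (leq_trans q_gt1)// -[X in (X <= _)%N]expn1 leq_exp2l// (pdeg_irr_gt0 v_irr).
Qed.

Lemma absv_unif_lt1 : absv_unif < 1.
Proof. by rewrite (le_lt_trans absv_unif_le_half)// invf_lt1// ltr1n. Qed.

Lemma absv_unif_small (e : R) : 0 < e -> exists m, absv_unif ^+ m < e.
Proof.
move=> e0; pose m := Num.bound e^-1; exists m.
have em : e^-1 < m%:R by apply: archi_boundP; rewrite invr_ge0 ltW.
have m0 : (0 : R) < m%:R by apply: lt_trans em; rewrite invr_gt0.
apply: le_lt_trans (_ : m%:R^-1 < e); last by rewrite invf_plt ?posrE.
apply: le_trans (lerXn2r m _ _ absv_unif_le_half) _; rewrite ?nnegrE ?(ltW absv_unif_gt0) ?invr_ge0//.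
rewrite exprVn lef_pV2 ?posrE ?exprn_gt0// -natrX ler_nat.
exact/ltnW/ltn_expl.
Qed.

Lemma absv_poly e (b : A) : coprimep v b -> N (iota (v ^+ e * b)%:F) = absv_unif ^+ e.
Proof.
move=> vb; have b0 := coprimep_irr_neq0 vb; case: kvP => -> _ _.
have a0 : v ^+ e * b != 0 by rewrite mulf_neq0// expf_neq0// monic_neq0.
rewrite /vadic_abs tofrac_eq0 (negbTE a0); set r := repr _.
have r0 : \d_r != 0 by exact: denom_ratioP.
(* The representative of the fraction need not be reduced: numerator and denominator share a power
   v^f, which cancels in the difference of orders. *)
have [f [de [vde rE]]] := irr_factor pcharF v_monic v_irr r0.
have nE : \n_r = v ^+ (e + f) * (b * de).
  have /eqP := frac_numden (v ^+ e * b)%:F; rewrite -/r.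
  rewrite -[X in X == _]divr1 -tofrac1 eqr_div ?tofrac_eq0 ?oner_eq0//.
  rewrite -!rmorphM tofrac_eq mulr1 => /eqP <-.
  by rewrite rE exprD; ring.
rewrite nE rE !vord_pow ?coprimepMr ?vb//.
have -> : (f%:Z - (e + f)%:Z = - e%:Z)%R by rewrite PoszD opprD addrCA subrr addr0.
by rewrite -exprnN /absv_unif exprVn.
Qed.

Lemma absv_coprime (b : A) : coprimep v b -> N (iota b%:F) = 1.
Proof. by move=> vb; have := absv_poly 0 vb; rewrite expr0 mul1r. Qed.

Lemma ord_geP m x : ord_ge v m x <-> N (iota x) <= absv_unif ^+ m.
Proof.
have k0 := absv_unif_gt0; have k1 := absv_unif_lt1.
split=> [[a [b [vb b0 ->]]]|xm].
  rewrite fmorph_div absvM absvV (absv_coprime vb) invr1 mulr1.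
  have [->|a0] := eqVneq a 0.
    by rewrite mulr0 tofrac0 rmorph0 absv0 exprn_ge0// ltW.
  have [e [c [vc ->]]] := irr_factor pcharF v_monic v_irr a0.
  rewrite mulrA -exprD absv_poly// exprD ler_piMr ?exprn_ge0 ?(ltW k0)//.
  by rewrite exprn_ile1// ltW.
have [x0|x0] := eqVneq x 0; first by rewrite x0; exact: ord_ge_zero.
have [a [b [b0 xE]]] := frac_ex x.
have a0 : a != 0 by apply: contraNneq x0 => a0; rewrite xE a0 tofrac0 mul0r.
have [e [c [vc aE]]] := irr_factor pcharF v_monic v_irr a0.
have [f [g [vg bE]]] := irr_factor pcharF v_monic v_irr b0.
move: xm; rewrite xE fmorph_div absvM absvV aE bE !absv_poly//.
rewrite ler_pdivrMr ?exprn_gt0// -exprD.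
rewrite (ler_iXn2l k0 k1) => mfe.
exists (v ^+ (e - (m + f)) * c), g; split=> //.
  exact: coprimep_irr_neq0.
have v0 : v != 0 by exact: monic_neq0.
have g0 := coprimep_irr_neq0 vg.
apply/eqP; rewrite eqr_div ?tofrac_eq0 ?mulf_neq0 ?expf_neq0// -!rmorphM tofrac_eq.
have -> : v ^+ e = v ^+ (e - (m + f)) * v ^+ m * v ^+ f.
  by rewrite -!exprD -addnA subnK.
by apply/eqP; ring.
Qed.

Lemma conv0_ord (X : nat -> k) : conv N (fun n => iota (X n)) 0 ->
  forall m, exists n0, forall n, (n0 <= n)%N -> ord_ge v m (X n).
Proof.
move=> X0 m; have [n0 H] := X0 _ (exprn_gt0 m absv_unif_gt0); exists n0 => n /H.
by rewrite sub0r absvN => /ltW/ord_geP.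
Qed.

Lemma ord_conv0 (X : nat -> k) :
  (forall m, exists n0, forall n, (n0 <= n)%N -> ord_ge v m (X n)) ->
  conv N (fun n => iota (X n)) 0.
Proof.
move=> H e /absv_unif_small[m me]; have [n0 Hn] := H m; exists n0 => n /Hn /ord_geP.
by rewrite sub0r absvN => /le_lt_trans; apply.
Qed.

(** Some multiple of an annihilating polynomial of x is an Ore polynomial. Its lowest term may have
    an exponent q^i0 > 1; this is repaired on the approximations [X n], which lie in k, by i0
    Cartier operators. *)
Lemma alg_ore (x : kv) (X : nat -> k) : algebraicOver iota x ->
  conv N (fun n => iota (X n)) x ->
  exists h (a : nat -> A), a 0 != 0 /\
    forall m, exists n0, forall n, (n0 <= n)%N -> ord_ge v m (ore_eval h a (X n)).
Proof.
move=> [r r0 rx] Xx.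
have [al [[i i_le ali] /dvdpP[s sE]]] := poly_lin_dep (fun i => 'X^(q ^ i)) r0.
have [D [a [D0 aE]]] := frac_common_denom al (size r).+1.
have ai : a i != 0.
  apply/eqP => ai; have /eqP := aE i i_le.
  by rewrite ai tofrac0 mulf_eq0 (negbTE ali) tofrac_eq0 (negbTE D0).
have sum0 : \sum_(j < (size r).+1) iota (a j)%:F * x ^+ (q ^ j) = 0.
  transitivity (iota D%:F * (map_poly iota (s * r)).[x]); last first.
    by rewrite rmorphM hornerM (eqP rx) !mulr0.
  rewrite -sE rmorph_sum horner_sum mulr_sumr; apply: eq_bigr => j _.
  by rewrite -aE// rmorphM /= map_polyZ map_polyXn hornerZ hornerXn -mulrA mulrCA.
pose P j := a j != 0; have exP : exists j, P j by exists i.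
pose i0 := ex_minn exP.
have [ai0 i0_min] : a i0 != 0 /\ forall j, (j < i0)%N -> a j = 0.
  rewrite /i0; case: ex_minnP => m am m_min; split=> // j jm.
  by apply/eqP; apply: contraTT jm => aj; rewrite -leqNgt m_min.
have i0_le : (i0 <= size r)%N.
  by rewrite leqNgt; apply/negP => lt; rewrite i0_min ?eqxx// in ai; exact: leq_ltn_trans lt.
pose h := (size r - i0)%N.
have hE : ((size r).+1 = i0 + h.+1)%N by rewrite addnS subnKC.
exists h; apply: (@ore_separable F p pcharF v X i0 h (fun j => a (j + i0)%N)) => //.
apply: conv0_ord.
have <- : \sum_(j < h.+1) iota (a (j + i0)%N)%:F * x ^+ (q ^ (j + i0)) = 0.
  rewrite -[RHS]sum0 hE big_split_ord /= [X in _ = X + _]big1.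
    by rewrite add0r; apply: eq_bigr => j _; rewrite addnC.
  by move=> j _; rewrite i0_min// tofrac0 rmorph0 mul0r.
apply: (@conv_near _ _ _ (fun n => \sum_(j < h.+1) iota (a (j + i0)%N)%:F * (iota (X n)) ^+ (q ^ (j + i0))) _ 0).
  move=> n _; rewrite rmorph_sum; apply: eq_bigr => j _.
  by rewrite rmorphM rmorphXn.
apply: conv_sum => j; apply: convM; first exact: conv_cst.
exact: convX.
Qed.

End VadicField.

(** * Algebraicity of gamma values *)

Lemma algebraic_exp (K E : fieldType) (f : {rmorphism K -> E}) x n :
  algebraicOver f x -> algebraicOver f (x ^+ n).
Proof.
move=> ax; elim: n => [|n IH]; first exact: algebraic1.
by rewrite exprS; exact: algebraic_mul.
Qed.

Lemma algebraic_root (K E : fieldType) (f : {rmorphism K -> E}) x n : (0 < n)%N ->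
  algebraicOver f (x ^+ n) -> algebraicOver f x.
Proof.
move=> n0 [r r0 rx]; exists (r \Po 'X^n).
  by rewrite comp_poly_eq0// size_polyXn ltnS.
by rewrite map_comp_poly map_polyXn /root horner_comp hornerXn.
Qed.

Lemma algebraic_sum (K E : fieldType) (f : {rmorphism K -> E}) (I : Type)
    (r : seq I) (X : I -> E) :
  (forall i, algebraicOver f (X i)) -> algebraicOver f (\sum_(i <- r) X i).
Proof.
move=> aX; apply: big_ind => //; [exact: algebraic0|exact: algebraic_add].
Qed.

Lemma algebraic_prod (K E : fieldType) (f : {rmorphism K -> E}) (I : Type)
    (r : seq I) (X : I -> E) :
  (forall i, algebraicOver f (X i)) -> algebraicOver f (\prod_(i <- r) X i).
Proof.
move=> aX; apply: big_ind => //; [exact: algebraic1|exact: algebraic_mul].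
Qed.

Lemma dlog_ore_aux (K : fieldType) (e s x a : K) : a != 0 -> x != 0 ->
  (e - s * x) / (a * x) = e / (a * x) + - s / a.
Proof. by move=> a0 x0; field; rewrite a0 x0. Qed.

Lemma natr_pchar_eq (F : nzRingType) p (m n : nat) : p \in [pchar F] ->
  m%:R = n%:R :> F -> m = n %[mod p].
Proof.
move=> pF; wlog le_mn : m n / (m <= n)%N => [W E|E].
  by case: (leqP m n) => [/W|/ltnW/W]; [apply|move=> /(_ (esym E)) ->].
by apply/eqP; rewrite eq_sym eqn_mod_dvd// (dvdn_pcharf pF) natrB// E subrr.
Qed.

Section Gam.
Variables (R : realType) (F : finFieldType) (p : nat).
Hypothesis pcharF : p \in [pchar F].
Variable v : {poly F}.
Hypotheses (v_monic : v \is monic) (v_irr : irreducible_poly v).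
Variables (kv : fieldType) (N : absolute_value R kv).
Variable iota : {rmorphism {fraction {poly F}} -> kv}.
Hypothesis kvP : is_completion (@vadic_abs F v R) N iota.
Local Notation q := #|F|.
Local Notation A := {poly F}.
Local Notation k := {fraction A}.
Local Notation d := (pdeg v).
Local Notation alg := (algebraicOver iota).
Let q_gt1 := card_finField_gt1 F.
Let q_gt0 := card_finField_gt0 F.
Let ordP := ord_geP pcharF v_monic v_irr kvP.

(* [c] is a sequence of digits, not required to be less than [q]; this makes [Gam]
   a morphism for the addition of sequences. *)
Definition Gn (c : nat -> nat) n : A := \prod_(i < n) ugam v i ^+ c i.
Definition Gam (c : nat -> nat) : kv := ari_gamma_succ v N iota c.

Lemma GnS c n : Gn c n.+1 = Gn c n * ugam v n ^+ c n.
Proof. by rewrite /Gn big_ord_recr. Qed.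

Lemma coprimep_Gn c n : coprimep v (Gn c n).
Proof.
elim: n => [|n IH]; first by rewrite /Gn big_ord0 coprimep1.
by rewrite GnS coprimepMr IH coprimep_expr// coprimep_ugam.
Qed.

Lemma Gn_neq0 c n : Gn c n != 0.
Proof. exact/coprimep_irr_neq0/coprimep_Gn. Qed.

Lemma dvdp_Gn c m n : (d + m <= n)%N -> v ^+ m %| Gn c n - Gn c (d + m).
Proof.
move=> /subnK <-; elim: (n - _)%N => [|j IH]; first by rewrite subrr dvdp0.
rewrite addSn GnS; set n' := (j + _)%N in IH *.
have -> : Gn c n' * ugam v n' ^+ c n' - Gn c (d + m) =
  Gn c n' * (ugam v n' ^+ c n' - 1) + (Gn c n' - Gn c (d + m)) by ring.
rewrite dvdp_add// dvdp_mull// subrX1 dvdp_mulr//.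
have -> : n' = (d + (j + m))%N by rewrite /n' addnCA.
apply: dvdp_trans (ugam_eq1 pcharF v_monic v_irr _).
by rewrite dvdp_exp2l// leq_max leq_addl orbT.
Qed.

Lemma Gam_conv c : conv N (fun n => iota (Gn c n)%:F) (Gam c).
Proof.
have [_ _ NC] := kvP.
have [a xa] : exists a, conv N (fun n => iota (Gn c n)%:F) a.
  apply: cauchy_conv => // e e0.
  have [m me] := absv_unif_small v_irr e0; exists (d + m)%N => n dmn.
  rewrite absv_sym -rmorphB -rmorphB; apply: le_lt_trans me.
  by apply/ordP/ord_ge_poly/dvdp_Gn.
suff -> : Gam c = a by [].
apply: conv_lim; apply: (conv_near (n0 := 0%N)) xa => n _.
rewrite /Gn !rmorph_prod; apply: eq_bigr => i _.
by rewrite !rmorphXn /ugam !rmorphN.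
Qed.

(** All partial products are prime to v, hence of absolute value 1. *)
Lemma Gam_neq0 c : Gam c != 0.
Proof.
apply/eqP => G0; have [n /(_ n (leqnn n))] := Gam_conv c ltr01.
rewrite G0 sub0r absvN (absv_coprime pcharF v_monic v_irr kvP) ?ltxx//.
exact: coprimep_Gn.
Qed.

Lemma GamD c c' : Gam (fun n => c n + c' n)%N = Gam c * Gam c'.
Proof.
apply: conv_uniq (Gam_conv _) _.
apply: (conv_near (n0 := 0%N)) (convM (Gam_conv c) (Gam_conv c')) => n _.
rewrite -!rmorphM /Gn -big_split /=; congr (iota _%:F).
by apply: eq_bigr => i _; rewrite exprD.
Qed.

(* In the derivative of an Ore equation for [Gam c], only the term of exponent
   [q ^ 0] contributes a derivative of [Gn c n]. *)
Lemma dlog_Gn_alg c : alg (Gam c) ->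
  exists2 f, alg f & conv N (fun n => iota (dlog (Gn c n))) f.
Proof.
move=> algG; have [h [a [a0 ore]]] := alg_ore pcharF v_monic v_irr kvP algG (Gam_conv c).
have a0F : iota (a 0)%:F != 0 by rewrite fmorph_eq0 tofrac_eq0.
pose s x := \sum_(i < h.+1) iota (a i)^`()%:F * x ^+ (q ^ i).-1.
exists (- s (Gam c) / iota (a 0)%:F).
  apply: algebraic_mul; last exact/algebraic_inv/algebraic_id.
  apply/algebraic_opp/algebraic_sum => i; apply: algebraic_mul; first exact: algebraic_id.
  exact: algebraic_exp.
pose eps n : A := \sum_(i < h.+1) a i * Gn c n ^+ (q ^ i).
have epsE n : (eps n)%:F = ore_eval h a (Gn c n)%:F.
  by rewrite /eps rmorph_sum; apply: eq_bigr => i _; rewrite rmorphM rmorphXn.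
have epsD n : (eps n)^`() =
    \sum_(i < h.+1) (a i)^`() * Gn c n ^+ (q ^ i) + a 0 * (Gn c n)^`().
  rewrite /eps raddf_sum /= big_ord_recl [in RHS]big_ord_recl expn0 expr1 derivM.
  rewrite [RHS]addrAC; congr (_ + _); apply: eq_bigr => i _.
  by rewrite derivM (deriv_expq pcharF)// mulr0 addr0.
have eps'E n : iota (eps n)^`()%:F = s (iota (Gn c n)%:F) * iota (Gn c n)%:F +
    iota (a 0)%:F * iota (Gn c n)^`()%:F.
  rewrite epsD !rmorphD !rmorphM /=; congr (_ + _).
  rewrite rmorph_sum rmorph_sum /s mulr_suml; apply: eq_bigr => i _.
  rewrite !rmorphM !rmorphXn /= -mulrA -exprSr prednK// expn_gt0 q_gt0//.
have eps0 : conv N (fun n => iota ((eps n)^`()%:F / ((a 0) * Gn c n)%:F)) 0.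
  apply: (ord_conv0 pcharF v_monic v_irr kvP) => m.
  have [e He] := ord_ge_div pcharF v_monic v_irr a0.
  (* The derivative may lose one order at v, and the division by a_0 may lose e. *)
  have [n0 Hn] := ore (m + e).+1; exists n0 => n /Hn; rewrite -epsE => /ord_ge_polyP.
  move=> /dvdpP[w wE].
  have veps : v ^+ (m + e) %| (eps n)^`().
    rewrite wE derivM dvdp_add ?dvdp_mull//.
      by rewrite exprSr dvdp_mulr.
    by rewrite deriv_exp -mulr_natr dvdp_mulr// dvdp_mull.
  rewrite rmorphM invfM mulrA; apply: ord_ge_mulr; first exact/He/ord_ge_poly.
  by apply: ord_geV; [exact: coprimep_Gn|exact: Gn_neq0].
rewrite -[- s _ / _]add0r.
have sG : conv N (fun n => s (iota (Gn c n)%:F)) (s (Gam c)).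
  by apply: conv_sum => i; apply: convM; [exact: conv_cst|exact/convX/Gam_conv].
have := convD eps0 (convM (convM (conv_cst N (- 1)) sG) (conv_cst N (iota (a 0)%:F)^-1)).
rewrite mulN1r; apply: (conv_near (n0 := 0%N)) => n _.
have GF : iota (Gn c n)%:F != 0 by rewrite fmorph_eq0 tofrac_eq0 Gn_neq0.
rewrite mulN1r !fmorph_div !rmorphM /= -dlog_ore_aux// eps'E [X in X - _]addrC addrK.
by rewrite -mulf_div divff// mul1r.
Qed.

(** Each u_i brings the polar terms of indices i and i - d; regrouping by index gives the
    differences c i - c (i + d). The constant rho in k collects the indices below d + 3 and the
    contribution of v; for n >= 2 d + 3 the truncation does not affect them. *)
Lemma dlog_Gn_polar c : exists rho, forall n, (d + d.+3 <= n)%N ->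
  dlog (Gn c n) = polar_sum v c n + rho.
Proof.
pose t i : k := polar F i *+ c i.
pose t' i : k := polar F i *+ c (i + d)%N.
exists (\sum_(0 <= i < d.+3) (t i - t' i) - dlog v *+ c d) => n dn.
have := subnKC (leq_trans (leq_addr _ _) dn); set m := (n - d)%N => nE.
have dm : (d.+3 <= m)%N by rewrite leq_subRL// (leq_trans _ dn)// leq_addr.
have mn : (m <= n)%N by rewrite leq_subr.
have m0 : (0 < m)%N by apply: leq_trans dm.
have dn' : (d <= n)%N by rewrite -nE leq_addr.
have L : dlog (Gn c n) = \sum_(0 <= i < n) t i - \sum_(0 <= i < m) t' i - dlog v *+ c d.
  rewrite /Gn dlog_prod => [|i]; last by rewrite expf_neq0// ugam_neq0.
  rewrite -(big_mkord xpredT (fun i => dlog (ugam v i ^+ c i))).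
  rewrite (eq_bigr (fun i => t i - (if (d <= i)%N then t' (i - d)%N +
      (if i == d then dlog v *+ c d else 0) else 0))) => [|i _]; last first.
    rewrite dlogX ?ugam_neq0// (dlog_ugam pcharF v_monic v_irr) mulrnBl; congr (_ - _).
    case: ltnP => di; first by rewrite mul0rn.
    rewrite mulrnDl /t' subnK//; congr (_ + _).
    by case: eqP => [->|_]; rewrite ?mul0rn.
  rewrite sumrB -addrA -opprD; congr (_ - _).
  rewrite (big_cat_nat _ dn')//= big_nat_cond big1 ?add0r => [|i]; last first.
    by rewrite andbT => /andP[_ id]; rewrite leqNgt id.
  rewrite -{1}[d]add0n big_addn -/m big_nat_cond.
  rewrite (eq_bigr (fun i => t' i + (if i == 0%N then dlog v *+ c d else 0))) => [|i _]; last first.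
    by rewrite leq_addl addnK -{2}[d]add0n eqn_add2r.
  rewrite -big_nat_cond big_split /=; congr (_ + _).
  by rewrite big_ltn//= big_nat_cond big1 ?addr0// => i /andP[/andP[i0 _] _]; rewrite gtn_eqF.
rewrite L addrA; congr (_ - _).
have -> : \sum_(0 <= i < m) t' i = \sum_(0 <= i < n) (if (i < m)%N then t' i else 0).
  rewrite [RHS](big_cat_nat _ mn)//= [X in _ = _ + X]big_nat_cond [X in _ = _ + X]big1 ?addr0.
    by apply: eq_big_nat => i /andP[_ ->].
  by move=> i; rewrite andbT => /andP[mi _]; rewrite ltnNge mi.
rewrite -sumrB (big_cat_nat _ (leq_trans dm mn))//= addrC; congr (_ + _).
  apply: eq_bigr => i _; rewrite /trunc_coef -/m rmorphB rmorphB mulrBl /=; congr (_ - _).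
    by rewrite !rmorph_nat /t mulr_natl.
  by case: ifP => _; rewrite ?rmorph0 ?mul0r// !rmorph_nat /t' mulr_natl.
by apply: eq_big_nat => i /andP[_ id]; rewrite (leq_trans id dm).
Qed.

(** The constant rho lies in k, so removing it preserves algebraicity. The digits are then compared
    in F, hence only modulo p. *)
Lemma Gam_alg_cong c l : (0 < l)%N -> (forall n, c (n + l)%N = c n) -> (d %| l)%N ->
  alg (Gam c) -> forall n, c n = c (n + d)%N %[mod p].
Proof.
move=> l0 cl dl /dlog_Gn_alg[f algf cf] n.
have [rho rhoE] := dlog_Gn_polar c.
have algf' : alg (f - iota rho) by apply: algebraic_sub => //; exact: algebraic_id.
have cf' : conv N (fun n => iota (polar_sum v c n)) (f - iota rho).
  apply: (conv_near (n0 := (d + d.+3)%N)) (convD cf (conv_cst N (- iota rho))) => j dj.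
  by rewrite rhoE// rmorphD addrK.
have [h [a [a0 ore]]] := alg_ore pcharF v_monic v_irr kvP algf' cf'.
exact/natr_pchar_eq/(polar_sum_ore pcharF v_monic v_irr l0 cl dl a0 ore n).
Qed.

(** Product of the relations [bracket_ugam] raised to the powers c (j+1) = c (d+j+1), kept free of
    divisions. *)
Lemma Gn_shift c K : (forall n, c (n + d)%N = c n) ->
  \prod_(j < K) bracket F j.+1 ^+ c j.+1 * Gn c (d + K).+1 * Gn (c \o succn) d ^+ q =
  \prod_(j < K) bracket F (d + j).+1 ^+ c j.+1 * Gn (c \o succn) (d + K) ^+ q *
  Gn c d.+1.
Proof.
move=> cd; elim: K => [|K IH].
  by rewrite !big_ord0 addn0 !mul1r mulrC.
have cK : c (d + K).+1 = c K.+1 by rewrite -addnS addnC cd.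
rewrite !addnS !big_ord_recr /= [Gn c (d + K).+2]GnS [Gn (c \o succn) (d + K).+1]GnS /= cK.
have E : bracket F K.+1 ^+ c K.+1 * ugam v (d + K).+1 ^+ c K.+1 =
    bracket F (d + K).+1 ^+ c K.+1 * (ugam v (d + K) ^+ c K.+1) ^+ q.
  by rewrite exprAC -!exprMn -addnS (bracket_ugam pcharF v_monic).
rewrite exprMn; move: IH E.
set P1 := \prod_(_ < _) _; set P2 := \prod_(_ < _) _.
move: P1 P2 (bracket F K.+1 ^+ _) (Gn c (d + K).+1) (ugam v (d + K).+1 ^+ _) => P1 P2 B G1 U1.
move: (bracket F (d + K).+1 ^+ _) ((ugam v (d + K) ^+ _) ^+ q) => B2 U2.
move: (Gn _ d ^+ q) (Gn _ (d + K) ^+ q) (Gn c d.+1) => G2 G3 G4 IH E.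
have -> : P1 * B * (G1 * U1) * G2 = P1 * G1 * G2 * (B * U1) by ring.
by rewrite IH E; ring.
Qed.

(** For K = d M the two products of brackets overlap, with equal exponents by periodicity. After
    cancellation d brackets remain on each side, a number independent of M, so that M can tend to
    infinity. *)
Lemma Gn_shift_deg c M : (forall n, c (n + d)%N = c n) ->
  \prod_(j < d) bracket F j.+1 ^+ c j.+1 * Gn c (d + d * M).+1 * Gn (c \o succn) d ^+ q =
  \prod_(j < d) bracket F (d * M + j.+1) ^+ c j.+1 *
  Gn (c \o succn) (d + d * M) ^+ q * Gn c d.+1.
Proof.
move=> cd; pose K := (d * M)%N; pose f j := bracket F j.+1 ^+ c j.+1.
have cM n j : c (d * n + j)%N = c j.
  elim: n => [|n IH]; first by rewrite muln0.
  by rewrite mulnS -addnA addnC cd.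
have E := Gn_shift K cd.
have E1 : \prod_(j < d) f j * \prod_(j < K) bracket F (d + j).+1 ^+ c j.+1 =
    \prod_(j < K) f j * \prod_(j < d) bracket F (d * M + j.+1) ^+ c j.+1.
  transitivity (\prod_(j < d + K) f j).
    rewrite big_split_ord /=; congr (_ * _); apply: eq_bigr => j _.
    by rewrite /f -addnS addnC cd.
  rewrite addnC big_split_ord /=; congr (_ * _); apply: eq_bigr => j _.
  by rewrite /f -addnS cM.
have PK : \prod_(j < K) f j != 0.
  apply/prodf_neq0 => j _; rewrite expf_neq0// bracket_neq0//.
apply: (mulfI PK); rewrite -/K.
move: E E1; rewrite -/f.
set P1 := \prod_(_ < K) _; set P2 := \prod_(_ < K) _; set P3 := \prod_(_ < d) _.
set P4 := \prod_(_ < d) _.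
set G1 := Gn c (d + K).+1; set G2 := Gn (c \o succn) d ^+ q.
set G3 := Gn (c \o succn) (d + K) ^+ q; set G4 := Gn c d.+1 => E E1.
clearbody P1 P2 P3 P4 G1 G2 G3 G4.
have -> : P1 * (P3 * G1 * G2) = P3 * (P1 * G1 * G2) by ring.
have -> : P1 * (P4 * G3 * G4) = (P1 * P4) * G3 * G4 by ring.
by rewrite E -E1; ring.
Qed.

Lemma dvdp_bracket_mul n : v %| bracket F (d * n).
Proof.
elim: n => [|n IH]; first by rewrite muln0 /bracket expn0 expr1 subrr dvdp0.
rewrite mulnS (bracketD pcharF) dvdp_add//.
rewrite dvdp_exp ?(dvdp_bracket_deg v_monic v_irr)// expn_gt0 q_gt0//.
Qed.

(** The terms of indices m <= n differ by [d (n - m)]^(q^(d m)), and v divides [d (n - m)]. The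
    limit is fixed by the q^d-power map, hence algebraic. *)
Lemma teichmuller_ex : exists2 w : kv, alg w &
  conv N (fun M => iota ('X^(q ^ (d * M)) : A)%:F) w.
Proof.
have [_ _ NC] := kvP; have d0 := pdeg_irr_gt0 v_irr.
have [w ww] : exists w, conv N (fun M => iota ('X^(q ^ (d * M)) : A)%:F) w.
  apply: cauchy_conv => // e e0.
  have [m me] := absv_unif_small v_irr e0; exists m => n mn.
  rewrite absv_sym -rmorphB -rmorphB; apply: le_lt_trans me.
  apply/ordP/ord_ge_poly.
  have -> : 'X^(q ^ (d * n)) - 'X^(q ^ (d * m)) = bracket F (d * (n - m)) ^+ (q ^ (d * m)).
    rewrite (exprqB pcharF (pchar_polyF pcharF)) -exprM -expnD -mulnDr subnK//.
  apply: dvdp_trans (dvdp_exp2r _ (dvdp_bracket_mul _)); rewrite dvdp_exp2l//.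
  by rewrite (leq_trans (ltnW (ltn_expl m q_gt1)))// leq_exp2l// leq_pmull.
exists w => //; exists ('X^(q ^ d) - 'X).
  have qd1 : (1 < q ^ d)%N by rewrite -(expn0 q) ltn_exp2l.
  by rewrite -size_poly_eq0 size_polyDl size_polyXn// size_polyN size_polyX ltnS.
rewrite rmorphB /= map_polyXn map_polyX /root hornerD hornerN hornerXn hornerX subr_eq0.
apply/eqP; apply: (conv_uniq (convX (q ^ d) ww)).
apply: (conv_near (n0 := 0%N)) (conv_shift 1 ww) => n _.
by rewrite addn1 mulnS addnC expnD exprM !rmorphXn.
Qed.

Lemma Gam_shift c : (forall n, c (n + d)%N = c n) ->
  exists2 x, alg x & Gam c = x * Gam (c \o succn) ^+ q.
Proof.
move=> cd; have [w algw ww] := teichmuller_ex; set b := c \o succn.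
have d0 := pdeg_irr_gt0 v_irr.
(* Limit of the remaining brackets [d M + j + 1] when M tends to infinity. *)
pose Z := \prod_(j < d) (w ^+ (q ^ j.+1) - iota ('X : A)%:F) ^+ c j.+1.
pose P := \prod_(j < d) bracket F j.+1 ^+ c j.+1.
have algZ : alg Z.
  apply: algebraic_prod => j; apply/algebraic_exp/algebraic_sub.
    exact: algebraic_exp.
  exact: algebraic_id.
have convZ : conv N (fun M => iota (\prod_(j < d) bracket F (d * M + j.+1) ^+ c j.+1)%:F) Z.
  have fac (j : nat) : conv N (fun M => iota (bracket F (d * M + j.+1) ^+ c j.+1)%:F)
      ((w ^+ (q ^ j.+1) - iota ('X : A)%:F) ^+ c j.+1).
    have := convX (c j.+1) (convD (convX (q ^ j.+1) ww) (conv_cst N (- iota ('X : A)%:F))).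
    apply: (conv_near (n0 := 0%N)) => M _.
    by rewrite !rmorphXn /bracket !rmorphB /= expnD exprM !rmorphXn.
  rewrite /Z; elim: (index_enum _) => [|j r IH].
    apply: (conv_near (n0 := 0%N)) (conv_cst N _) => M _.
    by rewrite !big_nil !rmorph1.
  rewrite big_cons; apply: (conv_near (n0 := 0%N)) (convM (fac j) IH) => M _.
  by rewrite big_cons !rmorphM.
have leM M : (M <= d + d * M)%N by rewrite (leq_trans (leq_pmull M d0))// leq_addl.
have conv1 := conv_subseq (f := fun M => (d + d * M).+1) (fun M => leqW (leM M)) (Gam_conv c).
have conv2 := conv_subseq (f := fun M => (d + d * M)%N) leM (Gam_conv b).
have E : iota P%:F * Gam c * iota (Gn b d ^+ q)%:F = Z * Gam b ^+ q * iota (Gn c d.+1)%:F.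
  apply: (conv_uniq (convM (convM (conv_cst N _) conv1) (conv_cst N _))).
  apply: (conv_near (n0 := 0%N)) (convM (convM convZ (convX q conv2)) (conv_cst N _)) => M _.
  by rewrite /= -!rmorphXn -!rmorphM /= -Gn_shift_deg.
have P0 : iota P%:F != 0.
  by rewrite fmorph_eq0 tofrac_eq0; apply/prodf_neq0 => j _; rewrite expf_neq0// bracket_neq0.
have G0 : iota (Gn b d ^+ q)%:F != 0 by rewrite fmorph_eq0 tofrac_eq0 expf_neq0// Gn_neq0.
exists (Z * iota (Gn c d.+1)%:F / (iota P%:F * iota (Gn b d ^+ q)%:F)).
  apply: algebraic_div; apply: algebraic_mul => //; exact: algebraic_id.
apply: (mulIf (mulf_neq0 P0 G0)); rewrite mulrAC divfK ?mulf_neq0//.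
by rewrite mulrCA mulrA E mulrAC.
Qed.

Lemma Gam_periodic_alg c : (forall n, c (n + d)%N = c n) -> alg (Gam c).
Proof.
move=> cd; have d0 := pdeg_irr_gt0 v_irr.
have shift i : exists2 x, alg x & Gam c = x * Gam (fun n => c (n + i)%N) ^+ (q ^ i).
  elim: i => [|i [x algx E]].
    exists 1; first exact: algebraic1.
    rewrite expn0 expr1 mul1r; congr Gam; apply/funext => n; by rewrite addn0.
  have [|y algy Ey] := @Gam_shift (fun n => c (n + i)%N).
    by move=> n; rewrite addnAC cd.
  exists (x * y ^+ (q ^ i)); first by apply: algebraic_mul => //; exact: algebraic_exp.
  rewrite E Ey exprMn mulrA -exprM -expnS; congr (_ * Gam _ ^+ _).
  by apply/funext => n /=; rewrite addSnnS.
have [x algx E] := shift d.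
have {}E : Gam c = x * Gam c ^+ (q ^ d).
  by rewrite {1}E; congr (_ * Gam _ ^+ _); apply/funext => n; rewrite cd.
have qd1 : (1 < q ^ d)%N by rewrite -(expn0 q) ltn_exp2l.
apply: (@algebraic_root _ _ _ _ (q ^ d).-1); first by rewrite -ltnS prednK// ltnW.
have -> : Gam c ^+ (q ^ d).-1 = x^-1.
  have G0 := Gam_neq0 c.
  have x0 : x != 0 by apply: contraNneq G0 => x0; rewrite E x0 mul0r.
  apply: (mulIf G0); rewrite -exprSr prednK ?(ltnW qd1)//.
  by rewrite {2}E mulKf.
exact: algebraic_inv.
Qed.

End Gam.

(** * Digits *)

Lemma denq_dvd (w : rat) (m : nat) : w * m%:R \is a Num.int -> (`|denq w| %| m)%N.
Proof.
move=> /intrP[a aE].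
have E : numq w * m%:Z = a * denq w.
  apply: (@intr_inj rat); rewrite !rmorphM /= -aE numqE -pmulrn.
  by rewrite mulrAC.
have : (denq w %| numq w * m)%Z by rewrite E dvdz_mull.
rewrite Gauss_dvdzr; first by [].
by rewrite coprimez_sym; exact: coprime_num_den.
Qed.

Lemma coprime_denq (q m : nat) (w : rat) : coprime q m -> w * m%:R \is a Num.int ->
  coprime q `|denq w|.
Proof. by move=> qm /denq_dvd wm; exact: coprime_dvdr wm qm. Qed.

Section Digits.
Variable q : nat.
Hypothesis q_gt1 : (1 < q)%N.
Let q_gt0 : (0 < q)%N := ltnW q_gt1.

Lemma expn_sub1_gt0 l : (0 < l)%N -> (0 < q ^ l - 1)%N.
Proof. by move=> l0; rewrite subn_gt0 -(expn0 q) ltn_exp2l. Qed.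

Lemma coprime_expn_sub1 l : (0 < l)%N -> coprime q (q ^ l - 1).
Proof.
move=> l0; have E : (q ^ l - 1).+1 = (q ^ l)%N by rewrite subn1 prednK// expn_gt0 q_gt0.
by have := coprimenS (q ^ l - 1); rewrite E coprime_sym coprime_pexpl.
Qed.

Definition digit_val (l : nat) (c : nat -> nat) : nat := (\sum_(i < l) c i * q ^ i)%N.

Definition digit_frac (l : nat) (c : nat -> nat) : rat :=
  (digit_val l c)%:R / (q ^ l - 1)%N%:R.

Lemma digit_val_shift l c : (forall n, c (n + l)%N = c n) ->
  (q * digit_val l (fun n => c n.+1) = digit_val l c + c 0 * (q ^ l - 1))%N.
Proof.
move=> cl; rewrite /digit_val big_distrr /=.
have E : (\sum_(i < l) q * (c i.+1 * q ^ i) + c 0 = \sum_(i < l) c i * q ^ i + c l * q ^ l)%N.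
  transitivity (\sum_(i < l.+1) c i * q ^ i)%N; last by rewrite big_ord_recr.
  rewrite big_ord_recl /= muln1 addnC; congr addn.
  by apply: eq_bigr => i _; rewrite /bump /= add1n expnS mulnCA.
have ql : (0 < q ^ l)%N by rewrite expn_gt0 q_gt0.
have cl0 : c l = c 0 by rewrite -[l]add0n cl.
rewrite cl0 in E; rewrite mulnBr muln1.
have c0l : (c 0 <= c 0 * q ^ l)%N by rewrite leq_pmulr.
by move: E c0l; move: (\sum_(i < l) _)%N (\sum_(i < l) _)%N (_ * _)%N => x y z; lia.
Qed.

Lemma digit_frac_shift l c : (0 < l)%N -> (forall n, c (n + l)%N = c n) ->
  q%:R * digit_frac l (fun n => c n.+1) = digit_frac l c + (c 0)%:R.
Proof.
move=> l0 cl; have m0 : (q ^ l - 1)%N%:R != 0 :> rat.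
  by rewrite pnatr_eq0 -lt0n expn_sub1_gt0.
rewrite /digit_frac mulrA -natrM (digit_val_shift cl) natrD natrM mulrDl mulfK//.
Qed.

(** Periodic digits sum to a geometric series of ratio q^l. The remainder after n digits is the same
    expression for the shifted sequence, and its denominator divides q^l - 1, which is prime to
    q. *)
Lemma qadic_periodic l c : (0 < l)%N -> (forall n, c (n + l)%N = c n) ->
  (forall n, (c n < q)%N) -> qadic_expansion q (- digit_frac l c) c.
Proof.
move=> l0 cl cq; split=> // n.
have m0 : (q ^ l - 1)%N%:R != 0 :> rat.
  by rewrite pnatr_eq0 -lt0n expn_sub1_gt0.
exists (- digit_frac l (fun i => c (i + n)%N)).
  apply: (coprime_denq (coprime_expn_sub1 l0)).
  by rewrite mulNr /digit_frac divfK// rpredN natr_int.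
elim: n => [|n IH].
  rewrite big_ord0 add0r expr0 mul1r; congr (- digit_frac l _).
  by apply/funext => i; rewrite addn0.
rewrite IH big_ord_recr /= natrD -addrA; congr (_ + _).
have -> : digit_frac l (fun i => c (i + n)%N) =
    q%:R * digit_frac l (fun i => c (i + n.+1)%N) - (c n)%:R.
  have cln i : c (i + l + n)%N = c (i + n)%N by rewrite addnAC cl.
  rewrite -[LHS](addrK (c n)%:R); congr (_ - _).
  have := @digit_frac_shift l (fun i => c (i + n)%N) l0 cln; rewrite /= add0n => <-.
  by congr (_ * digit_frac l _); apply/funext => i; rewrite addSnnS.
by rewrite natrM natrX exprSr; ring.
Qed.

(** At a first difference, c n - c' n = q (w' - w). The denominator of w' - w is prime to q and
    divides q, so two digits below q would differ by a multiple of q. *)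
Lemma qadic_expansion_uniq z c c' :
  qadic_expansion q z c -> qadic_expansion q z c' -> c = c'.
Proof.
move=> [cq cE] [c'q c'E]; apply/funext => n.
have [N] := ubnP n; elim: N n => // N IH n nN.
have [w wq wE] := cE n.+1; have [w' w'q w'E] := c'E n.+1.
have S : (\sum_(i < n) c i * q ^ i = \sum_(i < n) c' i * q ^ i)%N.
  apply: eq_bigr => i _; rewrite IH//; exact: leq_trans (ltn_ord i) nN.
have qn0 : q%:R ^+ n != 0 :> rat by rewrite expf_neq0// pnatr_eq0 -lt0n.
have E : (c n)%:R - (c' n)%:R = q%:R * (w' - w) :> rat.
  apply: (mulfI qn0); move: wE w'E; rewrite !big_ord_recr /= S !natrD !natrM !natrX.
  by move=> -> /eqP; rewrite -subr_eq0 => /eqP H; apply/eqP; rewrite -subr_eq0 -[X in _ == X]H exprSr; apply/eqP; ring.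
have ww_int : w' - w \is a Num.int.
  have d1 : coprime q `|denq (w' - w)|.
    apply: (@coprime_denq _ (`|denq w'| * `|denq w|)%N); first by rewrite coprimeMr w'q wq.
    have absd (x : rat) : (`|denq x|%N%:R : rat) = (denq x)%:~R.
      by rewrite -[in RHS](gez0_abs (ltW (denq_gt0 x))).
    rewrite natrM !absd.
    have -> : (w' - w) * ((denq w')%:~R * (denq w)%:~R) =
      w' * (denq w')%:~R * (denq w)%:~R - w * (denq w)%:~R * (denq w')%:~R by ring.
    rewrite -!numqE -!intrM -intrB; exact: intr_int.
  have d2 : (`|denq (w' - w)| %| q)%N.
    by apply: denq_dvd; rewrite mulrC -E rpredB// natr_int.
  have d3 : `|denq (w' - w)|%N = 1%N.
    by move: d1; rewrite /coprime; move/gcdn_idPr: d2 => -> /eqP.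
  rewrite -[w' - w]divq_num_den -[denq _]gez0_abs ?(ltW (denq_gt0 _))// d3 divr1.
  exact: intr_int.
move: ww_int => /intrP[a aE]; move: E; rewrite aE => /eqP.
rewrite !pmulrn -intrB -intrM eqr_int => /eqP E.
have := cq n; have := c'q n; move: E; move: (c n) (c' n) => x y E.
have [a0|a0|a0] := ltgtP a 0.
- have : (q%:Z * a <= q%:Z * -1)%R by rewrite ler_pM2l ?ltz_nat//; lia.
  lia.
- have : (q%:Z * 1 <= q%:Z * a)%R by rewrite ler_pM2l ?ltz_nat//; lia.
  lia.
by move: E; rewrite a0 mulr0; lia.
Qed.

Lemma qadic_digitsE z c : qadic_expansion q z c -> qadic_digits q z = c.
Proof.
move=> zc; apply: xget_unique => // c' zc'; exact: qadic_expansion_uniq zc' zc.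
Qed.

Lemma digit_val_le l c : (forall n, (c n < q)%N) -> (digit_val l c <= q ^ l - 1)%N.
Proof.
move=> cq; elim: l => [|l IH]; first by rewrite /digit_val big_ord0.
rewrite /digit_val big_ord_recr /= -/(digit_val l c).
have : (c l * q ^ l <= q.-1 * q ^ l)%N by rewrite leq_mul2r -ltnS prednK// cq orbT.
have : (0 < q ^ l)%N by rewrite expn_gt0 q_gt0.
have : (q * q ^ l = q.-1 * q ^ l + q ^ l)%N by rewrite -mulSnr prednK.
rewrite expnS; move: IH; move: (digit_val l c) (c l * q ^ l)%N (q.-1 * q ^ l)%N (q * q ^ l)%N (q ^ l)%N.
move=> x y z t s; lia.
Qed.

Lemma digit_frac_itv l c : (0 < l)%N -> (forall n, (c n < q)%N) ->
  0 <= digit_frac l c <= 1.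
Proof.
move=> l0 cq; have m0 : (0 : rat) < (q ^ l - 1)%N%:R by rewrite ltr0n expn_sub1_gt0.
by rewrite divr_ge0 ?ler0n//= ler_pdivrMr// mul1r ler_nat digit_val_le.
Qed.

Lemma digits_nat l m : (m < q ^ l)%N ->
  digit_val l (fun n => (m %/ q ^ n) %% q)%N = m.
Proof.
move=> ml; rewrite -[RHS](modn_small ml) {ml}; elim: l => [|l IH].
  by rewrite /digit_val big_ord0 modn1.
rewrite /digit_val big_ord_recr /= -/(digit_val l (fun n => (m %/ q ^ n) %% q)%N) IH expnSr.
have ql : (0 < q ^ l)%N by rewrite expn_gt0 q_gt0.
have E : m = ((m %/ q ^ l %/ q) * (q ^ l * q) + ((m %/ q ^ l) %% q * q ^ l + m %% q ^ l))%N.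
  rewrite {1}(divn_eq m (q ^ l)) {1}(divn_eq (m %/ q ^ l) q).
  by rewrite mulnDl -mulnA [(q * q ^ l)%N]mulnC -addnA.
rewrite [in RHS]E modnMDl [RHS]modn_small; first by rewrite addnC.
have -> : (q ^ l * q = q.-1 * q ^ l + q ^ l)%N by rewrite mulnC -mulSnr prednK.
rewrite -addnS leq_add ?ltn_pmod// leq_mul2r -ltnS prednK// ltn_pmod// orbT//.
Qed.

End Digits.

Lemma fracpart_eq (x y : rat) : 0 <= y < 1 -> x - y \is a Num.int -> fracpart x = y.
Proof.
move=> /andP[y0 y1] /intrP[a aE]; rewrite /fracpart.
have -> : Num.floor x = a.
  apply: floor_def; have -> : x = a%:~R + y by rewrite -aE subrK.
  by rewrite lerDl y0/= intrD ltrD2l.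
by rewrite -aE subKr.
Qed.

Lemma fracpart_itv (x : rat) : 0 <= fracpart x < 1.
Proof.
rewrite /fracpart subr_ge0 floor_le ltrBlDl -[1]/(1%:~R) -intrD.
exact: floorD1_gt.
Qed.

Lemma fracpart_int (x : rat) : x - fracpart x \is a Num.int.
Proof. by rewrite /fracpart subKr intr_int. Qed.

Lemma digits_fracpart (q l : nat) (z : rat) : (1 < q)%N -> (0 < l)%N ->
  z * (q ^ l - 1)%N%:R \is a Num.int ->
  exists c, [/\ forall n, c (n + l)%N = c n, forall n, (c n < q)%N &
    digit_frac q l c = fracpart (- z)].
Proof.
move=> q1 l0 zl; have q0 := ltnW q1.
have m0 : (0 : rat) < (q ^ l - 1)%N%:R by rewrite ltr0n expn_sub1_gt0.
pose y := fracpart (- z).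
have yi : y * (q ^ l - 1)%N%:R \is a Num.int.
  rewrite -[y](subKr (- z)) mulrBl rpredB//; first by rewrite mulNr rpredN.
  by rewrite rpredM ?natr_int// fracpart_int.
have /andP[y0 y1] := fracpart_itv (- z).
have [m mE] : exists m : nat, y * (q ^ l - 1)%N%:R = m%:R.
  have : 0 <= y * (q ^ l - 1)%N%:R by rewrite mulr_ge0// ltW.
  move: yi => /intrP[[m|m] ->]; first by exists m.
  by rewrite ler0z.
have ml : (m < q ^ l)%N.
  have : (m%:R : rat) < (q ^ l - 1)%N%:R by rewrite -mE gtr_pMl.
  by rewrite ltr_nat => /leq_trans; apply; rewrite leq_subr.
(* The l base q digits of m, repeated periodically. *)
exists (fun n => (m %/ q ^ (n %% l)) %% q)%N; split.
- by move=> n; rewrite modnDr.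
- by move=> n; rewrite ltn_pmod.
rewrite -/y /digit_frac.
have -> : digit_val q l (fun n => (m %/ q ^ (n %% l)) %% q)%N = m.
  rewrite -[RHS](digits_nat q1 ml); apply: eq_bigr => i _.
  by rewrite (modn_small (ltn_ord i)).
by rewrite -mE mulfK// gt_eqF.
Qed.

Local Open Scope quotient_scope.

(** * The gamma distribution *)

Section ModAlg.
Variables (k : fieldType) (C : closedFieldType) (i : {rmorphism k -> C}).

Lemma pi_mod_algebraic_eq0 (x : mulgroup C) :
  (\pi_(mod_algebraic i) x == 0) <-> algebraicOver i (sval x).
Proof.
have -> : 0 = \pi_(mod_algebraic i) 0 by rewrite raddf0.
rewrite -Quotient.idealrBE subr0; split => [/asboolP//|?]; exact/asboolP.
Qed.

End ModAlg.

(** Lets the algebraicity of gamma values, defined in the large field, be tested in k_v: a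
    polynomial over k vanishes at x exactly when it vanishes at the image of x. *)
Lemma algebraicOver_comp (K L M : fieldType) (f : {rmorphism K -> L})
    (g : {rmorphism L -> M}) x :
  algebraicOver (g \o f) (g x) <-> algebraicOver f x.
Proof.
split=> -[r r0 rx]; exists r => //; move: rx.
  by rewrite map_poly_comp fmorph_root.
by rewrite map_poly_comp fmorph_root.
Qed.

Section Lspan.
Variables (K : nzRingType) (V : lmodType K) (S : set V).

Lemma lspan_mem x : S x -> lspan S x.
Proof.
move=> Sx; exists [:: (1, x)]; last by rewrite big_seq1 scale1r.
by move=> y; rewrite inE => /eqP ->.
Qed.

Lemma lspan0 : lspan S 0.
Proof. by exists [::] => //; rewrite big_nil. Qed.

Lemma lspan_sum (I : Type) (r : seq I) (X : I -> V) :
  (forall i, lspan S (X i)) -> lspan S (\sum_(i <- r) X i).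
Proof. move=> SX; apply: big_ind => //; [exact: lspan0|exact: lspanD]. Qed.

Lemma pi_lquot_eq0 x : (\pi_(lquot S) x = 0) <-> lspan S x.
Proof.
have -> : 0 = \pi_(lquot S) 0 by rewrite raddf0.
split=> [/eqP|Sx]; first by rewrite -Quotient.idealrBE subr0 => /asboolP.
by apply/eqP; rewrite -Quotient.idealrBE subr0; exact/asboolP.
Qed.

Lemma pi_lquotZ a x : \pi_(lquot S) (a *: x) = a *: \pi_(lquot S) x.
Proof. exact/esym/pi_lquot_scale. Qed.

End Lspan.

Lemma fglift_additive (K : choiceType) (M : lmodType rat) (f : K -> M) :
  additive (fglift f).
Proof. exact: lift_is_additive. Qed.

Lemma fgliftZ (K : choiceType) (M : lmodType rat) (f : K -> M) a D :
  fglift f (a *: D) = a *: fglift f D.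
Proof.
pose g : {freeg K / rat} -> M := fglift f.
have gB : additive g by exact: fglift_additive.
pose gA := GRing.isZmodMorphism.Build _ _ g gB.
pose gadd : {additive {freeg K / rat} -> M} := HB.pack g gA.
have gsum (r : seq K) (X : K -> {freeg K / rat}) :
    g (\sum_(z <- r) X z) = \sum_(z <- r) g (X z) := raddf_sum gadd _ _ _.
have gE E : g E = \sum_(z <- dom E) coeff z E *: f z.
  by rewrite -{1}(freeg_sumE E) gsum; apply: eq_bigr => z _; rewrite /g liftU.
rewrite -/(g _) -/(g D) [g D]gE scaler_sumr -[a *: D]/(fgscale a D) gsum.
by apply: eq_bigr => z _; rewrite /g liftU scalerA.
Qed.

Lemma coprime_expn_sub1_exists q m : (0 < m)%N -> coprime q m ->
  exists2 l, (0 < l)%N & (m %| q ^ l - 1)%N.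
Proof.
move=> m0 qm; exists (totient m); first by rewrite totient_gt0.
have [-> //|q0] := posnP q; first by rewrite exp0n ?totient_gt0// dvdn0.
by rewrite -eqn_mod_dvd ?expn_gt0 ?q0// (Euler_exp_totient qm).
Qed.

Section Distribution.
Variables (R : realType) (p : nat) (F : finFieldType).
Hypothesis pcharF : p \in [pchar F].
Variable v : {poly F}.
Hypotheses (v_monic : v \is monic) (v_irr : irreducible_poly v).
Variables (kv : fieldType) (N : absolute_value R kv).
Variable iota : {rmorphism {fraction {poly F}} -> kv}.
Hypothesis kvP : is_completion (@vadic_abs F v R) N iota.
Variables (C : closedFieldType) (j : {rmorphism kv -> C}).
Local Notation q := #|F|.
Local Notation d := (pdeg v).
Local Notation MA := (mod_algebraic (j \o iota)).
Local Notation cls := (mod_algebraic_class iota j).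
Local Notation Gam := (Gam v N iota).
Local Notation lin := (ari_gamma_lin (p := p) v N iota j).
Local Notation hat := (ari_gamma_hat (p := p) v N iota j).
Let q_gt1 := card_finField_gt1 F.
Let q_gt0 := card_finField_gt0 F.

Lemma clsM x y : x != 0 -> y != 0 -> cls (x * y) = cls x + cls y.
Proof.
move=> x0 y0; rewrite /mod_algebraic_class -raddfD; congr (\pi _).
apply: val_inj; rewrite /= !insubdK ?unfold_in ?mulf_neq0//.
Qed.

Lemma cls_eq0 x : x != 0 -> (cls x = 0) <-> algebraicOver (j \o iota) x.
Proof.
move=> x0; rewrite /mod_algebraic_class.
have -> : algebraicOver (j \o iota) x <->
    algebraicOver (j \o iota) (sval (insubd (0 : mulgroup C) x)).
  by rewrite [sval _]insubdK.
by rewrite -pi_mod_algebraic_eq0; split => /eqP.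
Qed.

Definition gcl (c : nat -> nat) : MA := cls (j (Gam c)).

Let jG0 c : j (Gam c) != 0.
Proof. by rewrite fmorph_eq0 (Gam_neq0 pcharF v_monic v_irr kvP). Qed.

Lemma gclD c c' : gcl (fun n => c n + c' n)%N = gcl c + gcl c'.
Proof. by rewrite /gcl (GamD pcharF v_monic v_irr kvP) rmorphM clsM ?jG0. Qed.

Lemma gcl_eq0 c : (gcl c = 0) <-> algebraicOver iota (Gam c).
Proof. by rewrite /gcl cls_eq0 ?jG0// algebraicOver_comp. Qed.

Lemma gcl_periodic c : (forall n, c (n + d)%N = c n) -> gcl c = 0.
Proof. by move=> cd; apply/gcl_eq0/(Gam_periodic_alg pcharF v_monic v_irr kvP). Qed.

Lemma gclMn c m : gcl (fun n => m * c n)%N = gcl c *+ m.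
Proof.
elim: m => [|m IH]; first by rewrite gcl_periodic.
by rewrite mulrS -IH -gclD.
Qed.

Lemma gcl_sum (I : Type) (r : seq I) (X : I -> nat -> nat) :
  gcl (fun n => \sum_(i <- r) X i n)%N = \sum_(i <- r) gcl (X i).
Proof.
elim: r => [|i r IH].
  rewrite big_nil -(@gcl_periodic (fun=> 0%N))//; congr gcl.
  by apply/funext => n; rewrite big_nil.
rewrite big_cons -IH -gclD; congr gcl; apply/funext => n.
by rewrite big_cons.
Qed.

Lemma ari_gammaE c l : (0 < l)%N -> (forall n, c (n + l)%N = c n) ->
  (forall n, (c n < q)%N) -> ari_gamma v N iota (1 - digit_frac q l c) = Gam c.
Proof.
move=> l0 cl cq; rewrite /ari_gamma addrAC subrr add0r.
by rewrite (qadic_digitsE q_gt1 (qadic_periodic q_gt1 l0 cl cq)).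
Qed.

Lemma pndvdn_expn_sub1 l : (0 < l)%N -> ~~ (p %| q ^ l - 1)%N.
Proof.
move=> l0; apply/negP => pl; have pp := pcharf_prime pcharF.
have := coprime_dvdr pl (coprime_dvdl (pchar_dvd_card pcharF) (coprime_expn_sub1 q_gt1 l0)).
by rewrite prime_coprime// dvdnn.
Qed.

Lemma lin_symb_frac c l z : (0 < l)%N -> (forall n, c (n + l)%N = c n) ->
  (forall n, (c n < q)%N) -> digit_frac q l c < 1 -> z + digit_frac q l c \is a Num.int ->
  lin (symb p z) = gcl c.
Proof.
move=> l0 cl cq c1 zc.
have /andP[c0 _] := digit_frac_itv q_gt1 l0 cq.
have m0 : (q ^ l - 1)%N%:R != 0 :> rat by rewrite pnatr_eq0 -lt0n expn_sub1_gt0.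
have fz : (0 <= fracpart z < 1) && ~~ (p %| `|denq (fracpart z)|)%N.
  rewrite fracpart_itv /=; apply: contra (pndvdn_expn_sub1 l0) => pd.
  apply: dvdn_trans pd _; apply: denq_dvd.
  have -> : fracpart z = z + digit_frac q l c - (z - fracpart z) - digit_frac q l c by ring.
  rewrite mulrBl rpredB//; first by rewrite rpredM ?natr_int// rpredB// fracpart_int.
  by rewrite /digit_frac divfK// natr_int.
rewrite /symb insubT /ari_gamma_lin liftU scale1r /gcl; congr (cls (j _)).
rewrite /ari_gamma_tilde SubK -(ari_gammaE l0 cl cq); congr (ari_gamma v N iota (1 - _)).
apply: fracpart_eq; first by rewrite c0.
rewrite -rpredN opprD opprK opprK.
have -> : fracpart z + digit_frac q l c = z + digit_frac q l c - (z - fracpart z) by ring.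
by rewrite rpredB// fracpart_int.
Qed.

(** The value [digit_frac] = 1, when all digits are q - 1, is not a fractional part: z is then an
    integer, whose own digits are 0. Both constant sequences have trivial class by
    [gcl_periodic]. *)
Lemma lin_symb c l z : (0 < l)%N -> (forall n, c (n + l)%N = c n) ->
  (forall n, (c n < q)%N) -> z + digit_frac q l c \is a Num.int ->
  lin (symb p z) = gcl c.
Proof.
move=> l0 cl cq zc; have /andP[c0 c1] := digit_frac_itv q_gt1 l0 cq.
move: c1; rewrite le_eqVlt => /orP[/eqP c1|c1]; last exact: (lin_symb_frac l0 cl cq c1 zc).
have cst : c = fun=> q.-1.
  apply: (qadic_expansion_uniq q_gt1 (z := - 1)).
    by rewrite -c1; exact: qadic_periodic.
  have -> : - 1 = - digit_frac q 1 (fun=> q.-1).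
    rewrite /digit_frac /digit_val big_ord1 expn0 muln1 expn1 subn1 divff//.
    by rewrite pnatr_eq0 -lt0n -subn1 subn_gt0.
  by apply: qadic_periodic => // n; rewrite prednK.
have zero0 : digit_frac q l (fun=> 0%N) = 0.
  by rewrite /digit_frac /digit_val big1 ?mul0r.
rewrite (@lin_symb_frac (fun=> 0%N) l) ?zero0//; last first.
  by rewrite addr0 -[z](addrK 1) -c1 rpredB// c1 rpred1.
by rewrite gcl_periodic// cst gcl_periodic.
Qed.

Lemma linB x y : lin (x - y) = lin x - lin y.
Proof. exact: fglift_additive. Qed.

Lemma linZ a x : lin (a *: x) = a *: lin x.
Proof. exact: fgliftZ. Qed.

Lemma lin0 : lin 0 = 0. Proof. by rewrite -(subrr 0) linB subrr. Qed.
Lemma linD x y : lin (x + y) = lin x + lin y.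
Proof.
rewrite -{1}[y]opprK linB; congr (_ + _).
by rewrite -[- y]sub0r linB lin0 sub0r opprK.
Qed.

Lemma lin_sum (I : Type) (r : seq I) (X : I -> AQ p) :
  lin (\sum_(i <- r) X i) = \sum_(i <- r) lin (X i).
Proof. exact: (big_morph _ linD lin0). Qed.

Definition basic l i : AQ p := symb p (q%:R ^+ i / (1 - q%:R ^+ l)).

(** The negative of the argument is q^i / (q^l - 1), with a single digit 1 in each period, at place
    i. *)
Lemma lin_basic l i : (0 < l)%N -> (i < l)%N ->
  lin (basic l i) = gcl (fun n => (n %% l == i)%N : nat).
Proof.
move=> l0 il; apply: (lin_symb l0) => [n|n|]; first by rewrite modnDr.
  by case: eqP => _; rewrite /= ?q_gt1.
rewrite /digit_frac /digit_val (bigD1 (Ordinal il))//= modn_small// eqxx mul1n.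
rewrite big1 => [|i' ii']; last first.
  by rewrite modn_small// -[i]/(val (Ordinal il)) (inj_eq val_inj) (negbTE ii').
rewrite addn0 natrX natrB ?expn_gt0 ?q_gt0// natrX -[1 - _]opprB invrN mulrN addNr.
exact: rpred0.
Qed.

(** The relation decomposes the digit sequence of -z into multiples of the indicators of residue
    classes modulo l, and [gcl] is additive in the sequence. *)
Lemma lin_Rari_gen l x : (0 < l)%N -> Rari_gen q l x -> lin x = 0.
Proof.
move=> l0 [z [e [zl eq_ eE ->]]].
rewrite linB lin_sum (@lin_symb (fun n => e (n %% l)%N) l)//; first last.
- have -> : digit_frac q l (fun n => e (n %% l)%N) = fracpart (- z).
    rewrite -eE /digit_frac /digit_val natr_sum mulr_suml; apply: eq_bigr => i _.
    by rewrite modn_small.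
  by rewrite -rpredN opprD fracpart_int.
- by move=> n; rewrite modnDr.
apply/eqP; rewrite subr_eq0; apply/eqP.
transitivity (gcl (fun n => \sum_(i < l) e i * (n %% l == i)%N)%N).
  congr gcl; apply/funext => n; rewrite (bigD1 (Ordinal (ltn_pmod n l0)))//= eqxx muln1.
  rewrite big1 ?addn0// => i ni.
  rewrite (_ : (n %% l == i)%N = false) ?muln0//; apply/negbTE.
  by apply: contra ni => /eqP E; apply/eqP/val_inj; rewrite /= E.
rewrite gcl_sum; apply: eq_bigr => i _.
by rewrite linZ -/(basic l i) lin_basic// gclMn scaler_nat.
Qed.

Lemma lin_Rari x : lspan (Rari (p := p) q) x -> lin x = 0.
Proof.
move=> [s sR ->]; rewrite lin_sum big_seq big1 // => -[a y] /sR [l /= l0 [t tR ->]].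
rewrite linZ lin_sum big_seq big1 ?scaler0// => -[b w] /tR wl.
by rewrite linZ (lin_Rari_gen l0 wl) scaler0.
Qed.

Lemma hat_pi x : hat (\pi_(Uari p q) x) = lin x.
Proof.
rewrite /ari_gamma_hat; unlock; apply/eqP; rewrite -subr_eq0 -linB; apply/eqP.
apply: lin_Rari; apply/asboolP.
by rewrite -[X in is_true X]/(_ - _ \in in_lspan _) Quotient.idealrBE reprK.
Qed.

End Distribution.

(** * The kernel as the span of the orbit sums *)

Lemma big_ord_mul (V : nmodType) (f : nat -> V) r d :
  \sum_(i < r * d) f i = \sum_(t < r) \sum_(a < d) f (t * d + a)%N.
Proof.
elim: r => [|r IH]; first by rewrite !big_ord0.
by rewrite mulSnr big_split_ord big_ord_recr /= IH.
Qed.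

Section Kernel.
Variables (R : realType) (p : nat) (F : finFieldType).
Hypothesis pcharF : p \in [pchar F].
Variable v : {poly F}.
Hypotheses (v_monic : v \is monic) (v_irr : irreducible_poly v).
Variables (kv : fieldType) (N : absolute_value R kv).
Variable iota : {rmorphism {fraction {poly F}} -> kv}.
Hypothesis kvP : is_completion (@vadic_abs F v R) N iota.
Variables (C : closedFieldType) (j : {rmorphism kv -> C}).
Local Notation q := #|F|.
Local Notation d := (pdeg v).
Local Notation Gam := (Gam v N iota).
Local Notation gcl := (gcl v N iota j).
Local Notation lin := (ari_gamma_lin (p := p) v N iota j).
Local Notation hat := (ari_gamma_hat (p := p) v N iota j).
Local Notation orb := (orbit_sums p q d).
Let q_gt1 := card_finField_gt1 F.
Let q_gt0 := card_finField_gt0 F.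
Let d_gt0 := pdeg_irr_gt0 v_irr.

Definition piU (x : AQ p) : Uari p q := \pi_(Uari p q) x.

Lemma piUD x y : piU (x + y) = piU x + piU y.
Proof. exact: (raddfD (\pi_(lquot (Rari (p := p) q)))). Qed.

Lemma piUB x y : piU (x - y) = piU x - piU y.
Proof. exact: (raddfB (\pi_(lquot (Rari (p := p) q)))). Qed.

Lemma piU_sum (I : Type) (r : seq I) (X : I -> AQ p) :
  piU (\sum_(i <- r) X i) = \sum_(i <- r) piU (X i).
Proof. exact: (raddf_sum (\pi_(lquot (Rari (p := p) q)))). Qed.

Lemma piUZ a x : piU (a *: x) = a *: piU x.
Proof. exact: pi_lquotZ. Qed.

Lemma piU_ex u : exists x, u = piU x.
Proof. by exists (repr u); rewrite /piU reprK. Qed.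

Lemma piU_eq0 x : Rari q x -> piU x = 0.
Proof. by move=> Rx; apply/pi_lquot_eq0/lspan_mem. Qed.

Lemma hat_piU x : hat (piU x) = lin x.
Proof. exact: hat_pi. Qed.

Lemma hatD u w : hat (u + w) = hat u + hat w.
Proof.
have [x ->] := piU_ex u; have [y ->] := piU_ex w.
by rewrite -piUD !hat_piU linD.
Qed.

Lemma hatZ a u : hat (a *: u) = a *: hat u.
Proof. by have [x ->] := piU_ex u; rewrite -piUZ !hat_piU linZ. Qed.

Lemma hat0 : hat 0 = 0.
Proof. by rewrite -(scale0r 0) hatZ scale0r. Qed.

Lemma hat_sum (I : Type) (r : seq I) (X : I -> Uari p q) :
  hat (\sum_(i <- r) X i) = \sum_(i <- r) hat (X i).
Proof. exact: (big_morph _ hatD hat0). Qed.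

(** Multiplication by q rotates the digits by one place. For an l-periodic sequence, the shift by l
    - 1 is the shift by -1 written without negative indices. *)
Lemma digit_frac_rot l c z s : (0 < l)%N -> (forall n, c (n + l)%N = c n) ->
  z + digit_frac q l c \is a Num.int ->
  q%:R ^+ s * z + digit_frac q l (fun n => c (n + s * (l - 1))%N) \is a Num.int.
Proof.
move=> l0 cl zc; elim: s => [|s IH].
  rewrite expr0 mul1r (_ : (fun n => _) = c)//; apply/funext => n.
  by rewrite addn0.
set c1 := fun n => c (n + s.+1 * (l - 1))%N.
have c1l n : c1 (n + l)%N = c1 n by rewrite /c1 addnAC cl.
have := digit_frac_shift q_gt1 l0 c1l.
rewrite (_ : (fun n => c1 n.+1) = fun n => c (n + s * (l - 1))%N); last first.
  apply/funext => n; rewrite /c1 -[RHS]cl; congr c.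
  by have := subnK l0; move: (l - 1)%N => t <-; ring.
move=> E; rewrite -[digit_frac q l c1](addrK (c1 0)%:R) -E exprS.
rewrite addrA -mulrA -mulrDr rpredB ?natr_int// rpredM//; exact: natr_int.
Qed.

(** The digit sequences of the q^(i d) z are the rotations by multiples of d, and r d is a period:
    their sum is d-periodic, so its gamma value is algebraic. *)
Lemma hat_orbit u : orb u -> hat u = 0.
Proof.
move=> [n [r [z [n0 pn [r0 qr _] zn ->]]]].
rewrite -/(piU _) hat_piU lin_sum.
pose l := (r * d)%N; have l0 : (0 < l)%N by rewrite muln_gt0 r0.
have nl : (n %| q ^ l - 1)%N.
  by rewrite -eqn_mod_dvd ?expn_gt0 ?q_gt0// /l mulnC expnM; apply/eqP.
have zl : z * (q ^ l - 1)%N%:R \is a Num.int.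
  by case/dvdnP: nl => m ->; rewrite mulnC natrM mulrA rpredM// natr_int.
have [c [cl cq cE]] := digits_fracpart q_gt1 l0 zl.
have zc : z + digit_frac q l c \is a Num.int.
  by rewrite cE -rpredN opprD fracpart_int.
rewrite (eq_bigr (fun i : 'I_r => gcl (fun n => c (n + i * d * (l - 1))%N))) => [|i _].
  rewrite -(gcl_sum pcharF v_monic v_irr kvP).
  apply: (gcl_periodic pcharF v_monic v_irr kvP) => m.
  case: r r0 @l l0 zl cl {qr nl cE zc} => // r _ l l0 _ cl.
  (* A shift by d permutes the rotations cyclically: the index i + 1 becomes i and the index 0
     becomes the last one. *)
  rewrite big_ord_recl [RHS]big_ord_recr /= addnC; congr addn.
    apply: eq_bigr => i _; rewrite /bump /= add1n.
    have E : (m + d + i.+1 * d * (l - 1) = m + i * d * (l - 1) + d * l)%N.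
      by have := subnK l0; move: (l - 1)%N => t <-; ring.
    by rewrite E (nat_periodic_mul _ d cl).
  rewrite mul0n mul0n addn0.
  rewrite -(nat_periodic_mul (m + d) (r * d) cl) -[RHS]cl; congr c.
  suff E l1 t : (t + 1 = l1 -> l1 = r.+1 * d ->
      m + d + r * d * l1 = m + r * d * t + l1)%N by exact: (E _ _ (subnK l0)).
  move=> tl; rewrite mulSn => lE; rewrite [in RHS]lE -tl; ring.
apply: (lin_symb pcharF v_monic v_irr kvP j l0) => [m|m|] //.
  by rewrite addnAC cl.
exact: digit_frac_rot.
Qed.

Lemma hat_span u : lspan orb u -> hat u = 0.
Proof.
move=> [s sS ->]; rewrite hat_sum big_seq big1 // => -[a w] /sS /hat_orbit w0.
by rewrite hatZ w0 scaler0.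
Qed.

Lemma is_mult_order_expn r : (0 < r)%N -> is_mult_order (q ^ d) (q ^ (r * d) - 1) r.
Proof.
move=> r0; have qX i : (0 < q ^ i)%N by rewrite expn_gt0 q_gt0.
split=> //.
  by apply/eqP; rewrite -expnM eqn_mod_dvd// mulnC.
move=> s s0 /eqP; rewrite -expnM eqn_mod_dvd// => /dvdn_leq.
rewrite subn_gt0 -(expn0 q) ltn_exp2l// muln_gt0 d_gt0 s0 => /(_ isT).
by rewrite leq_sub2rE// leq_exp2l// mulnC leq_pmul2l.
Qed.

(** Group the symbols by their index a modulo d: for fixed a they form the orbit sum of z = q^a / (1
    - q^(r d)) with n = q^(r d) - 1, modulo which q^d has order exactly r. *)
Lemma span_periodic r c : (0 < r)%N -> (forall n, c (n + d)%N = c n) ->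
  lspan orb (\sum_(i < r * d) (c i)%:R *: piU (basic p F (r * d) i)).
Proof.
move=> r0 cd; have l0 : (0 < r * d)%N by rewrite muln_gt0 r0.
rewrite (big_ord_mul (fun i => (c i)%:R *: piU (basic p F (r * d) i))) exchange_big /=.
apply: lspan_sum => a.
rewrite (eq_bigr (fun t : 'I_r => (c a)%:R *: piU (basic p F (r * d) (t * d + a)))).
  rewrite -scaler_sumr; apply/lspanZ/lspan_mem.
  exists (q ^ (r * d) - 1)%N, r, (q%:R ^+ a / (1 - q%:R ^+ (r * d))); split.
  - exact: (expn_sub1_gt0 q_gt1).
  - exact: (pndvdn_expn_sub1 pcharF).
  - exact: is_mult_order_expn.
  - have -> : 1 - q%:R ^+ (r * d) = - (q ^ (r * d) - 1)%N%:R :> rat.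
      by rewrite natrB ?expn_gt0 ?q_gt0// natrX opprB.
    rewrite invrN mulrN mulNr divfK ?rpredN ?rpredX ?natr_int//.
    by rewrite pnatr_eq0 -lt0n (expn_sub1_gt0 q_gt1).
  rewrite -piU_sum /piU; congr (\pi _); apply: eq_bigr => t _.
  by rewrite /basic exprD mulrA.
move=> t _; congr (_%:R *: _); rewrite addnC.
by rewrite nat_periodic_mul.
Qed.

Lemma symb_val (z : ZpmodZ p) : symb p (val z) = << z >>.
Proof.
have /andP[/andP[z0 z1] _] := valP z.
rewrite /symb (_ : fracpart (val z) = val z) ?valK//.
by apply: fracpart_eq; rewrite ?z0 ?z1// subrr rpred0.
Qed.

(** Stated for all multiples of L so that the symbols of a linear combination can be written at a
    common level l. *)
Lemma basic_span1 (z : ZpmodZ p) : exists2 L, (0 < L)%N & forall l, (0 < l)%N -> (L %| l)%N ->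
  exists al : nat -> rat, piU << z >> = \sum_(i < l) al i *: piU (basic p F l i).
Proof.
have /andP[_ pz] := valP z; pose n := `|denq (val z)|%N.
have n0 : (0 < n)%N by rewrite absz_gt0 denq_neq0.
have qn : coprime q n.
  have pp := pcharf_prime pcharF.
  case/p_natP: (card_finField_pnat pcharF) => e ->.
  by rewrite coprimeXl// prime_coprime.
have [L L0 nL] := coprime_expn_sub1_exists n0 qn.
exists L => // l l0 /dvdnP[m lE].
have nl : (n %| q ^ l - 1)%N.
  move: nL; rewrite -!eqn_mod_dvd ?expn_gt0 ?q_gt0// => /eqP E.
  by rewrite lE mulnC expnM -modnXm E modnXm exp1n.
have zl : val z * (q ^ l - 1)%N%:R \is a Num.int.
  case/dvdnP: nl => t ->; rewrite mulnC natrM mulrA rpredM ?natr_int//.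
  have -> : n%:R = (denq (val z))%:~R :> rat.
    by rewrite -[in RHS](gez0_abs (ltW (denq_gt0 _))).
  by rewrite -numqE intr_int.
have [c [cl cq cE]] := digits_fracpart q_gt1 l0 zl.
exists (fun i => (c i)%:R); apply/eqP; rewrite -subr_eq0 -symb_val.
have -> : \sum_(i < l) (c i)%:R *: piU (basic p F l i) =
    piU (\sum_(i < l) (c i)%:R *: basic p F l i).
  by rewrite piU_sum; apply: eq_bigr => i _; rewrite piUZ.
rewrite -piUB piU_eq0//; exists l => //; apply: lspan_mem.
exists (val z), c; split=> //.
by rewrite -cE /digit_frac /digit_val natr_sum mulr_suml.
Qed.

Lemma basic_span x : exists2 L, (0 < L)%N & forall l, (0 < l)%N -> (L %| l)%N ->
  exists al : nat -> rat, piU x = \sum_(i < l) al i *: piU (basic p F l i).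
Proof.
rewrite -(freeg_sumE x); elim: (dom x) => [|z s [L1 L10 H1]].
  exists 1%N => // l _ _; exists (fun=> 0); rewrite big_nil.
  rewrite big1 => [|i _]; last by rewrite scale0r.
  by rewrite -(scale0r 0) piUZ scale0r.
have [L2 L20 H2] := basic_span1 z.
exists (L1 * L2)%N => [|l l0 Ll]; first by rewrite muln_gt0 L10.
have [al1 E1] := H1 l l0 (dvdn_trans (dvdn_mulr _ (dvdnn _)) Ll).
have [al2 E2] := H2 l l0 (dvdn_trans (dvdn_mull _ (dvdnn _)) Ll).
exists (fun i => coeff z x * al2 i + al1 i).
rewrite big_cons piUD E1.
have -> : << coeff z x *g z >> = coeff z x *: << z >> :> AQ p.
  by apply/eqP/freeg_eqP => y; rewrite coeffZ !coeffU mul1r.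
rewrite piUZ E2 scaler_sumr -big_split /=; apply: eq_bigr => i _.
by rewrite scalerDl scalerA.
Qed.

(* The digits modulo [p] are [d]-periodic, so they contribute an algebraic factor; the
   remaining factor is the [p]-th power of the gamma value of the digits [c n %/ p]. *)
Lemma Gam_descent l B c : (0 < l)%N -> (d %| l)%N -> (forall n, c (n + l)%N = c n) ->
  (forall n, (c n <= B)%N) -> algebraicOver iota (Gam c) ->
  forall n, c (n + d)%N = c n.
Proof.
move=> l0 dl; have [B'] := ubnP B; elim: B' B c => // B' IH B c BB' cl cB algc n.
have p1 : (1 < p)%N := prime_gt1 (pcharf_prime pcharF).
have cong := Gam_alg_cong pcharF v_monic v_irr kvP l0 cl dl algc.
have [B0|B0] := posnP B.
  by have := cB n; have := cB (n + d)%N; rewrite B0 !leqn0 => /eqP -> /eqP ->.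
pose b n := (c n %% p)%N; pose c' n := (c n %/ p)%N.
have algb : algebraicOver iota (Gam b).
  by apply: (Gam_periodic_alg pcharF v_monic v_irr kvP) => m; rewrite /b -cong.
have cE : c = fun n => (b n + p * c' n)%N.
  by apply/funext => m; rewrite /b /c' addnC mulnC -divn_eq.
have algc' : algebraicOver iota (Gam c').
  have := algc; rewrite -!(gcl_eq0 pcharF v_monic v_irr kvP j) in algb *.
  rewrite cE (gclD pcharF v_monic v_irr kvP) algb add0r (gclMn pcharF v_monic v_irr kvP).
  (* The class of the product for c is p times that for c', and the target is torsion free. *)
  case: p p1 => // p' _; exact: mod_algebraic_tf.
have c'd : c' (n + d)%N = c' n.
  apply: (IH (B %/ p)%N c') => //.
  - exact: leq_trans (ltn_Pdiv p1 B0) BB'.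
  - by move=> m; rewrite /c' cl.
  - by move=> m; rewrite leq_div2r.
by rewrite (divn_eq (c (n + d)%N) p) -/(c' _) c'd -cong -divn_eq.
Qed.

(* A multiple of the sum of all the basic symbols, which is an orbit sum, makes the
   coefficients nonnegative. *)
Lemma hat_ker_span u : hat u = 0 -> lspan orb u.
Proof.
have [x ->] := piU_ex u => ux0.
have [L L0 H] := basic_span x.
have l0 : (0 < L * d)%N by rewrite muln_gt0 L0.
have [al E] := H _ l0 (dvdn_mulr d (dvdnn L)).
(* The level is a multiple of d, as [Gam_descent] and [span_periodic] require. *)
pose l := (L * d)%N; pose e i := piU (basic p F l i).
pose M := (\prod_(i < l) `|denq (al i)|)%N.
have M0 : (0 < M)%N.
  by apply/prodn_gt0 => i; rewrite absz_gt0 denq_neq0.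
have alM i : (i < l)%N -> exists a : int, al i * M%:R = a%:~R.
  move=> il; rewrite /M (bigD1 (Ordinal il))//= natrM mulrA.
  have -> : `|denq (al i)|%N%:R = (denq (al i))%:~R :> rat.
    by rewrite -[in RHS](gez0_abs (ltW (denq_gt0 _))).
  rewrite -numqE pmulrn -intrM; by eexists.
have /choice[a aE] : forall i, exists a : int, (i < l)%N -> al i * M%:R = a%:~R.
  move=> i; case: (ltnP i l) => il; last by exists 0.
  by have [b bE] := alM i il; exists b.
pose K := (\sum_(i < l) `|a i|)%N.
pose c n := `|(a (n %% l)%N + K%:Z)%R|%N.
have cE i : (i < l)%N -> (c i)%:R = al i * M%:R + K%:R :> rat.
  move=> il; rewrite aE// pmulrn [in RHS]pmulrn -intrD /c modn_small// gez0_abs//.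
  have : (`|a i| <= K)%N by rewrite /K (bigD1 (Ordinal il))//= leq_addr.
  lia.
have cl n : c (n + l)%N = c n by rewrite /c modnDr.
pose w := \sum_(i < l) (c i)%:R *: e i.
have span1 : lspan orb (\sum_(i < l) e i).
  have := @span_periodic L (fun=> 1%N) L0 (fun=> erefl).
  by under eq_bigr do rewrite scale1r.
have wE : w = M%:R *: piU x + K%:R *: \sum_(i < l) e i.
  rewrite E !scaler_sumr -big_split /=; apply: eq_bigr => i _.
  by rewrite cE// mulrC scalerDl scalerA.
have w0 : hat w = 0 by rewrite wE hatD !hatZ ux0 (hat_span span1) !scaler0 addr0.
have cd : forall n, c (n + d)%N = c n.
  apply: (@Gam_descent l (\max_(i < l) c i)%N) => //; first exact: dvdn_mull.
    move=> n; have -> : c n = c (n %% l)%N by rewrite /c modn_mod.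
    exact: (@leq_bigmax _ (fun i : 'I_l => c i) (Ordinal (ltn_pmod n l0))).
  apply/(gcl_eq0 pcharF v_monic v_irr kvP j); rewrite -w0 /w hat_sum.
  rewrite [in LHS](_ : c = fun n => (\sum_(i < l) c i * (n %% l == i))%N).
    rewrite (gcl_sum pcharF v_monic v_irr kvP); apply: eq_bigr => i _.
    rewrite hatZ hat_piU (lin_basic pcharF v_monic v_irr kvP)//.
    by rewrite (gclMn pcharF v_monic v_irr kvP) scaler_nat.
  apply/funext => n; rewrite (bigD1 (Ordinal (ltn_pmod n l0)))//= eqxx muln1.
  rewrite big1 => [|i ni]; first by rewrite addn0 /c modn_mod.
  rewrite (_ : (n %% l == i)%N = false) ?muln0//; apply/negbTE.
  by apply: contra ni => /eqP nE; apply/eqP/val_inj; rewrite /= nE.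
have wspan : lspan orb w by exact: span_periodic.
have -> : piU x = M%:R^-1 *: (w + (- K%:R) *: \sum_(i < l) e i).
  rewrite wE scaleNr addrK scalerA mulVf ?scale1r// pnatr_eq0 -lt0n//.
by apply/lspanZ/lspanD => //; exact: lspanZ.
Qed.

End Kernel.

Local Close Scope quotient_scope.

Theorem theorem4p7 (R : realType) (p : nat) (F : finFieldType)
    (pcharF : p \in [pchar F])
    (v : {poly F}) (v_monic : v \is monic) (v_irr : irreducible_poly v)
    (kv : fieldType) (Nkv : absolute_value R kv)
    (iota : {rmorphism {fraction {poly F}} -> kv})
    (kvP : is_completion (@vadic_abs F v R) Nkv iota)
    (kvbar : closedFieldType) (Nkvbar : absolute_value R kvbar)
    (jbar : {rmorphism kv -> kvbar})
    (kvbar_alg : forall x, algebraicOver jbar x)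
    (Nkvbar_ext : forall x, Nkvbar (jbar x) = Nkv x)
    (Cv : closedFieldType) (NCv : absolute_value R Cv)
    (jC : {rmorphism kvbar -> Cv})
    (CvP : is_completion Nkvbar NCv jC) :
  [set u : Uari p #|F| |
     ari_gamma_hat (p := p) v Nkv iota (jC \o jbar) u = 0] =
  lspan (orbit_sums p #|F| (pdeg v)).
Proof.
apply/seteqP; split=> u /=.
  exact: (hat_ker_span pcharF v_monic v_irr kvP).
exact: (hat_span pcharF v_monic v_irr kvP).
Qed.
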